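(* Let $\Omega_0$ be a nonempty bounded open set in $\mathbb{R}^d$ of finite measure, let $\Lambda_0$ be a discrete subset of $\mathbb{R}^d$, and let $A$ be an invertible real $d\times d$ matrix. Assume in addition that (a) $\Omega_0$ packs with the lattice $A\mathbb{Z}^d$, and (b) $\lambda_0\cdot Ak\in\mathbb{Z}$ for all $\lambda_0\in\Lambda_0$ and $k\in\mathbb{Z}^d$; equivalently, $\Lambda_0\subseteq (A^T)^{-1}\mathbb{Z}^d$. Put $\Omega:=\Omega_0+A\mathbb{Z}^d$ and $$\mu:=\frac{|\det A|}{|\Omega_0|}\,\mathrm{Leb}_{(A^T)^{-1}[-\frac12,\frac12]^d+\Lambda_0}.$$ The following statements are equivalent: (i) $\Omega_0$ has spectrum $\Lambda_0$. (ii) The set $\Omega$ is spectral with pair measure $\mu$. (iii) The restriction of the Fourier transform $$L^2(\Omega)\ni f\mapsto \hat f\,\big|_{(A^T)^{-1}[-\frac12,\frac12]^d+\Lambda_0}\in L^2(\mu)$$ is an isometry.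
   Context: $|E|$ is the Lebesgue measure of a measurable set $E\subseteq\mathbb{R}^d$, and $\mathrm{Leb}_E$ is the restriction of Lebesgue measure to $E$. For $\lambda\in\mathbb{R}^d$, $e_\lambda(x)=e^{2\pi i\lambda\cdot x}$. The Fourier transform is $\hat f(t)=\int_{\mathbb{R}^d}f(x)e^{-2\pi i t\cdot x}\,dx$ for $f\in L^1(\mathbb{R}^d)$, extended to $L^2(\mathbb{R}^d)$ by continuity; functions on a subset $\Omega$ are extended by $0$ to $\mathbb{R}^d$. A measurable set $\Omega_0$ *packs* with a set $\mathcal{T}\subset\mathbb{R}^d$ if the sets $\Omega_0+t$, $t\in\mathcal{T}$, are mutually disjoint up to Lebesgue measure zero. A measurable set $\Omega_0$ of finite measure *has spectrum* $\Lambda_0\subset\mathbb{R}^d$ if $\{e_\lambda:\lambda\in\Lambda_0\}$ is an orthogonal basis of $L^2(\Omega_0)$. For a measurable set $\Omega\subseteq\mathbb{R}^d$ (possibly of infinite measure) and a positive Radon measure $\mu$ on $\mathbb{R}^d$, $\Omega$ is *spectral with pair measure* $\mu$ if: (1) for each $f\in L^1(\Omega)\cap L^2(\Omega)$ the continuous function $\hat f$ satisfies $\int|\hat f|^2\,d\mu<\infty$; and (2) the map $f\mapsto\hat f$ from $L^1(\Omega)\cap L^2(\Omega)\subset L^2(\Omega)$ into $L^2(\mu)$ is isometric and has dense range (so it extends to an isometric isomorphism $L^2(\Omega)\to L^2(\mu)$). *)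

(* Defs.v *)
From HB Require Import structures.
From mathcomp Require Import all_boot all_order all_algebra.
From mathcomp Require Import complex.
From mathcomp Require Import all_classical all_reals all_analysis.

Set Implicit Arguments.
Unset Strict Implicit.
Unset Printing Implicit Defensive.

Import Order.TTheory GRing.Theory Num.Theory.
Import numFieldNormedType.Exports.

Local Open Scope classical_set_scope.
Local Open Scope ring_scope.

(* Points of R^n are column vectors, with the sigma-algebra generated by the
   coordinate maps, i.e. the Borel sigma-algebra. *)
Definition cV_display : measure_display.
Proof. exact: default_measure_display. Qed.

Section measurable_cV.
Context {R : realType} (n : nat).

Let coord : 'I_n -> 'cV[R]_n -> measurableTypeR R := fun i x => x i ord0.

Let cV_set0 : g_sigma_preimage coord set0.
Proof. exact: sigma_algebra0. Qed.

Let cV_setC A : g_sigma_preimage coord A -> g_sigma_preimage coord (~` A).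
Proof. exact: sigma_algebraC. Qed.

Let cV_bigcup (F : _^nat) : (forall i, g_sigma_preimage coord (F i)) ->
  g_sigma_preimage coord (\bigcup_i (F i)).
Proof. exact: sigma_algebra_bigcup. Qed.

HB.instance Definition _ := @isMeasurable.Build cV_display
  'cV[R]_n (g_sigma_preimage coord) cV_set0 cV_setC cV_bigcup.

End measurable_cV.

Lemma measurable_cV_coord {R : realType} (n : nat) (i : 'I_n) :
  measurable_fun [set: 'cV[R]_n]
    ((fun x => x i ord0) : 'cV[R]_n -> measurableTypeR R).
Proof.
move=> _ Y mY; rewrite setTI; apply: sub_sigma_algebra => /=.
rewrite -bigcup_seq/=; exists i => /=; first by rewrite mem_index_enum.
by exists Y => //; rewrite setTI.
Qed.

Lemma measurable_fun_cVP {R : realType} d (T : measurableType d) (n : nat)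
    (f : T -> 'cV[R]_n) :
  (forall i, measurable_fun [set: T]
    ((fun x => f x i ord0) : T -> measurableTypeR R)) ->
  measurable_fun [set: T] f.
Proof.
move=> mf; pose coord (i : 'I_n) (x : 'cV[R]_n) : measurableTypeR R := x i ord0.
suff H : preimage_set_system [set: T] f (g_sigma_preimage coord) `<=` measurable.
  by move=> _ A mA; apply: H; exists A.
rewrite -g_sigma_preimage_comp; apply: smallest_sub.
  exact: sigma_algebra_measurable.
rewrite -bigcup_seq; apply: bigcup_sub => i _ A [B mB <-].
exact: mf.
Qed.

Section cons_cV.
Context {R : realType} (n : nat).

Definition cons_cV (p : measurableTypeR R * 'cV[R]_n) : 'cV[R]_(n.+1) :=
  col_mx (const_mx p.1 : 'cV[R]_1) p.2.

Definition uncons_cV (x : 'cV[R]_(n.+1)) : measurableTypeR R * 'cV[R]_n :=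
  (x ord0 ord0, dsubmx (x : 'cV[R]_(1 + n))).

Lemma cons_cVK : cancel cons_cV uncons_cV.
Proof.
move=> [a v]; rewrite /uncons_cV /cons_cV /=; congr pair; last first.
  exact: col_mxKd.
have -> : (ord0 : 'I_n.+1) = lshift n (ord0 : 'I_1) by exact: val_inj.
by rewrite [LHS](col_mxEu (const_mx a : 'cV[R]_1)) mxE.
Qed.

Lemma measurable_cons_cV : measurable_fun [set: _] cons_cV.
Proof.
apply: measurable_fun_cVP => i; rewrite /cons_cV.
have [j|j] := split_ordP (i : 'I_(1 + n)) => ->.
  rewrite (_ : (fun _ => _) = fst); first exact: measurable_fst.
  by apply/funext => p; rewrite [LHS](col_mxEu (const_mx p.1 : 'cV[R]_1)) mxE.
rewrite (_ : (fun _ => _) = (fun x : 'cV[R]_n => x j ord0) \o snd).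
  exact: (measurableT_comp (measurable_cV_coord j)).
by apply/funext => p; rewrite [LHS](col_mxEd (const_mx p.1 : 'cV[R]_1)).
Qed.

Lemma measurable_uncons_cV : measurable_fun [set: _] uncons_cV.
Proof.
apply/measurable_fun_pairP; split.
  exact: measurable_cV_coord.
apply: measurable_fun_cVP => i.
rewrite (_ : (fun _ => _) = fun x : 'cV[R]_n.+1 => x (rshift 1 i) ord0).
  exact: measurable_cV_coord.
by apply/funext => x /=; rewrite mxE.
Qed.

Variable m : {sigma_finite_measure set 'cV[R]_n -> \bar R}.

Definition cons_measure : set 'cV[R]_(n.+1) -> \bar R :=
  pushforward (@lebesgue_measure R \x m)%E cons_cV.

Let m_cons A : measurable A -> measurable (cons_cV @^-1` A).
Proof. by move=> mA; rewrite -[X in measurable X]setTI; exact: measurable_cons_cV. Qed.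

Let cons_measure0 : cons_measure set0 = 0%E.
Proof. by rewrite /cons_measure /pushforward preimage_set0 measure0. Qed.

Let cons_measure_ge0 A : (0 <= cons_measure A)%E.
Proof. by rewrite /cons_measure /pushforward; exact: measure_ge0. Qed.

Let cons_measure_sigma_additive : semi_sigma_additive cons_measure.
Proof.
move=> F mF tF mUF; rewrite /cons_measure /pushforward preimage_bigcup.
apply: measure_semi_sigma_additive.
- by move=> k; exact: m_cons.
- apply/trivIsetP => /= i j _ _ ij; rewrite -preimage_setI.
  by move/trivIsetP : tF => /(_ _ _ _ _ ij) ->//; rewrite preimage_set0.
- by rewrite -preimage_bigcup; exact: m_cons.
Qed.

HB.instance Definition _ := isMeasure.Build _ _ _ cons_measure
  cons_measure0 cons_measure_ge0 cons_measure_sigma_additive.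

Let cons_measure_sigma_finite : sigma_finite setT cons_measure.
Proof.
have /sigma_finiteP[F [TF ndF Foo]] := sigma_finiteT (@lebesgue_measure R).
have /sigma_finiteP[G [TG ndG Goo]] := sigma_finiteT m.
exists (fun k => uncons_cV @^-1` (F k `*` G k)).
  rewrite -preimage_bigcup (_ : \bigcup_k _ = setT) ?preimage_setT//.
  apply/seteqP; split => // -[x v] _.
  have [i _ Fix] : (\bigcup_k F k) x by rewrite -TF.
  have [j _ Gjv] : (\bigcup_k G k) v by rewrite -TG.
  exists (maxn i j) => //; split.
    by move: x Fix; exact/subsetPset/ndF/leq_maxl.
  by move: v Gjv; exact/subsetPset/ndG/leq_maxr.
move=> k; have [mF Fk] := Foo k; have [mG Gk] := Goo k; split.
  rewrite -[X in measurable X]setTI; apply: measurable_uncons_cV => //.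
  exact: measurableX.
rewrite /cons_measure /pushforward -comp_preimage.
rewrite (_ : uncons_cV \o cons_cV = id) ?preimage_id; last first.
  by apply/funext => p /=; rewrite cons_cVK.
by rewrite product_measure1E// lte_mul_pinfty// ge0_fin_numE.
Qed.

HB.instance Definition _ := Measure_isSigmaFinite.Build _ _ _ cons_measure
  cons_measure_sigma_finite.

End cons_cV.

(* Lebesgue measure on R^n: the n-fold product of Lebesgue measure on R
   (the unit mass at the origin when n = 0). *)
Fixpoint lebesgue_cV {R : realType} (n : nat) :
    {sigma_finite_measure set 'cV[R]_n -> \bar R} :=
  match n with
  | 0 => \d_(0 : 'cV[R]_0)
  | k.+1 => cons_measure (lebesgue_cV k)
  end.

Section spectral.
Context {R : realType} {d : nat}.

Local Notation V := 'cV[R]_d.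
Local Notation C := R[i].
Local Notation leb := (@lebesgue_cV R d).

Implicit Types (mu nu : {measure set V -> \bar R}) (D E T Lambda : set V).
Implicit Types (f g h : V -> C).

(* Restriction of Lebesgue measure to E. The library's [mrestr] takes a proof
   that E is measurable; the second branch only serves to make the definition
   total. *)
Definition Leb_on E : {measure set V -> \bar R} :=
  match pselect (measurable E) with
  | left mE => mrestr leb mE
  | right _ => mzero
  end.

Definition dot (x y : V) : R := \sum_(i < d) x i ord0 * y i ord0.

Definition expi (t : R) : C := Complex (cos t) (sin t).

Definition expchar (l x : V) : C := expi (2 * pi * dot l x).

Definition cmeasurable D f :=
  measurable_fun D ((fun x => complex.Re (f x)) : V -> measurableTypeR R) /\
  measurable_fun D ((fun x => complex.Im (f x)) : V -> measurableTypeR R).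

Definition cintegral mu D f : C :=
  Complex (Rintegral mu D (fun x => complex.Re (f x)))
          (Rintegral mu D (fun x => complex.Im (f x))).

Definition normL1 mu D f : \bar R :=
  (\int[mu]_(x in D) (ComplexField.Normc.normc (f x))%:E)%E.

Definition sqnormL2 mu D f : \bar R :=
  (\int[mu]_(x in D) (ComplexField.Normc.normc (f x) ^+ 2)%:E)%E.

Definition inner mu D f g : C := cintegral mu D (fun x => f x * conjc (g x)).

(* Membership in L^1(D, mu) and L^2(D, mu); only the values of f on D matter,
   and functions are not quotiented by equality almost everywhere. *)
Definition inL1 mu D f := cmeasurable D f /\ (normL1 mu D f < +oo)%E.

Definition inL2 mu D f := cmeasurable D f /\ (sqnormL2 mu D f < +oo)%E.

Definition L2_dense mu D (F : set (V -> C)) :=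
  forall h, inL2 mu D h -> forall e : R, 0 < e ->
    exists2 f, F f & (sqnormL2 mu D (f \- h)%R < e%:E)%E.

(* The map [op], defined on the functions satisfying [dom], is isometric from
   L^2(D, mu) to L^2(E, nu). *)
Definition L2_isometry mu D nu E (dom : set (V -> C))
    (op : (V -> C) -> (V -> C)) :=
  (forall f, dom f -> inL2 nu E (op f)) /\
  (forall f g, dom f -> dom g ->
    sqnormL2 nu E (op f \- op g) = sqnormL2 mu D (f \- g)).

Definition ext0 D f : V -> C := fun x => if x \in D then f x else 0.

Definition fourier f : V -> C :=
  fun t => cintegral leb setT (fun x => f x * expi (- (2 * pi * dot t x))).

(* g represents the value at f of the extension by continuity of [fourier] to
   L^2(R^d): it is the limit in L^2 of [fourier u] as u tends to f in L^2 with
   u in L^1 and L^2. *)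
Definition is_fourierL2 f g :=
  inL2 leb setT g /\
  forall e : R, 0 < e -> exists2 r : R, 0 < r &
    forall u, inL1 leb setT u -> inL2 leb setT u ->
      (sqnormL2 leb setT (u \- f)%R < r%:E)%E ->
      (sqnormL2 leb setT (fourier u \- g)%R < e%:E)%E.

(* Determined by [is_fourierL2] up to equality almost everywhere. *)
Definition fourierL2 f : V -> C := xget (fun=> 0) (is_fourierL2 f).

Definition packs D T :=
  measurable D /\
  forall s t, T s -> T t -> s <> t ->
    leb ([set x + s | x in D] `&` [set x + t | x in D]) = 0%E.

Definition trig_span Lambda : set (V -> C) :=
  [set f | exists s : seq V, exists c : V -> C,
     (forall l, l \in s -> Lambda l) /\
     f = (fun x => \sum_(l <- s) c l * expchar l x)].

Definition has_spectrum D Lambda :=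
  [/\ measurable D, (leb D < +oo)%E,
      forall l, Lambda l -> sqnormL2 leb D (expchar l) != 0%E,
      forall l l', Lambda l -> Lambda l' -> l <> l' ->
        inner leb D (expchar l) (expchar l') = 0 &
      L2_dense leb D (trig_span Lambda)].

(* On R^d a Borel measure that is finite on compact sets is automatically
   regular. *)
Definition radon mu := forall K, compact K -> (mu K < +oo)%E.

Definition inL12 D : set (V -> C) := [set f | inL1 leb D f /\ inL2 leb D f].

Definition spectral_pair D mu :=
  [/\ measurable D, radon mu,
      forall f, inL12 D f -> (sqnormL2 mu setT (fourier (ext0 D f)) < +oo)%E,
      L2_isometry leb D mu setT (inL12 D) (fun f => fourier (ext0 D f)) &
      L2_dense mu setT [set fourier (ext0 D f) | f in inL12 D]].

Definition sumset D E : set V := [set x + y | x in D & y in E].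

Definition lattice (A : 'M[R]_d) : set V :=
  [set A *m map_mx intr k | k in [set: 'cV[int]_d]].

Definition dual_cell (A : 'M[R]_d) : set V :=
  [set invmx A^T *m c | c in [set c : V | forall i, `|c i ord0| <= 2^-1]].

Lemma density_ge0 (A : 'M[R]_d) D : 0 <= `|\det A| / fine (leb D).
Proof. by rewrite divr_ge0// fine_ge0. Qed.

Definition pair_measure (A : 'M[R]_d) D S : {measure set V -> \bar R} :=
  mscale (NngNum (density_ge0 A D)) (Leb_on S).

End spectral.

(* Main.v *)
Require Import Defs.
From HB Require Import structures.
From mathcomp Require Import all_boot all_order all_algebra.
From mathcomp Require Import complex.
From mathcomp Require Import all_classical all_reals all_analysis.
From mathcomp Require Import measurable_realfun.
From mathcomp Require Import ring lra.

(** The idea is to cut both sides into pieces of finite size. Write [O] for the base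
    set, [Q] for the half-open unit cube centred at the origin, and [e_l] for the
    exponential of frequency [l]. Two overlapping translates of an open set overlap in a
    nonempty open set, so the packing condition makes the translates [O - A k] disjoint
    ([packs_disjoint]), and a function on [Omega] is a family of functions [g_k] on [O].
    Dually, [Lambda_0] is a set of points [A^-T m] with [m] in a set [M] of integer
    vectors, and up to a null set [S] is the disjoint union of the cells
    [A^-T (Q + m)] for [m] in [M].

    For [f] with finitely many nonzero [g_k], form the function on [Q * O]
    [H (c, x) = sum_k e_k(c) g_k(x) conj(e_(A^-T c)(x))].
    The exponentials [e_k] are orthonormal on [Q], so that [H] has the norm of [f]
    ([sqn_twist_tensor]), and since [m] pairs integrally with the lattice, the value of
    the transform of [f] at [A^-T (c + m)] is the coefficient of [H (c, _)] against
    [e_(A^-T m)] on [O] ([fourier_synth]). Hence the norm of the transform on [S] is the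
    integral over [c] in [Q] of the sum over [M] of the squared coefficients of
    [H (c, _)], and the factors [|det A|] and [|O|] are those of the pair measure.

    If [Lambda_0] is a spectrum, Bessel's inequality and Parseval's identity for each
    [c] integrate to the same statements for the transform ([spec_norm_fourier_le],
    [nrm2_spec_fourier]). The range is dense because any [h] on finitely many cells is
    the family of coefficients of a function on [Q * O], and the functions [H] are dense
    there ([twisted_tensors_dense], [fourier_range_dense]); this rests on the density of
    trigonometric polynomials on the cube ([trig_dense]). This gives (ii).

    The extension of the transform to [L^2] exists by Plancherel's inequality, which is
    the Bessel inequality above in the case where [A] is the identity, [O] is the cube
    and [M] is everything ([sqn_fourier_le]), together with completeness of [L^2]
    ([riesz_fischer]). Both sides of the isometry being continuous, it passes from
    integrable functions to all of [L^2] ([fourierL2_isometry]), which is (iii).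

    Conversely, the isometry on finite sums of translates is an integrated Parseval
    identity on a dense set of functions on [Q * O]. Approximating a function [f (x)]
    that does not depend on [c] gives Bessel's inequality for [f] on [O]; for
    [f = e_(A^-T m)] one term of the sum already attains the bound, so the others vanish
    and the exponentials are orthogonal ([iso_orthogonal]). A gap in Bessel's inequality
    for some [f] would then survive the approximation and contradict the isometry, so
    the system is complete ([iso_complete]).

    Measure theory on column vectors is developed along the way: translation invariance
    and the linear change of variables ([linear_change_unitmx]), and a density criterion
    based on Dynkin's theorem ([L2_dense_criterion]). The inequality
    [|z + w|^2 <= (1 + e) |z|^2 + (1 + 1/e) |w|^2] replaces Minkowski's inequality
    throughout. *)

Set Implicit Arguments.
Unset Strict Implicit.
Unset Printing Implicit Defensive.

Import Order.TTheory GRing.Theory Num.Theory.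
Import numFieldNormedType.Exports.

Local Open Scope classical_set_scope.
Local Open Scope ring_scope.

(** * Complex numbers and exponentials *)

Section complex_numbers.
Context {R : realType}.
Implicit Types (z w : R[i]) (t : R).

Definition abs2 z : R := ComplexField.Normc.normc z ^+ 2.

Lemma abs2E z : abs2 z = complex.Re z ^+ 2 + complex.Im z ^+ 2.
Proof. by case: z => a b; rewrite /abs2 /= sqr_sqrtr// addr_ge0// sqr_ge0. Qed.

Lemma cReD z w : complex.Re (z + w) = complex.Re z + complex.Re w.
Proof. by case: z w => a b [c e]. Qed.

Lemma cImD z w : complex.Im (z + w) = complex.Im z + complex.Im w.
Proof. by case: z w => a b [c e]. Qed.

Lemma cReN z : complex.Re (- z) = - complex.Re z.
Proof. by case: z. Qed.

Lemma cImN z : complex.Im (- z) = - complex.Im z.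
Proof. by case: z. Qed.

Lemma cReM z w : complex.Re (z * w) =
  complex.Re z * complex.Re w - complex.Im z * complex.Im w.
Proof. by case: z w => a b [c e]. Qed.

Lemma cImM z w : complex.Im (z * w) =
  complex.Re z * complex.Im w + complex.Im z * complex.Re w.
Proof. by case: z w => a b [c e]. Qed.

Lemma cRe_conj z : complex.Re (conjc z) = complex.Re z.
Proof. by case: z. Qed.

Lemma cIm_conj z : complex.Im (conjc z) = - complex.Im z.
Proof. by case: z. Qed.

Lemma complex_eq z w : complex.Re z = complex.Re w ->
  complex.Im z = complex.Im w -> z = w.
Proof. by case: z w => a b [c e] /= -> ->. Qed.

Definition ReImE := (cReD, cImD, cReN, cImN, cReM, cImM, cRe_conj, cIm_conj).

Lemma conj_sum I (s : seq I) (P : pred I) (F : I -> R[i]) :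
  conjc (\sum_(i <- s | P i) F i) = \sum_(i <- s | P i) conjc (F i).
Proof. by rewrite (big_morph _ (@rmorphD _ _ (@conjc R)) (rmorph0 _)). Qed.

Lemma abs2_ge0 z : 0 <= abs2 z.
Proof. exact: sqr_ge0. Qed.

Lemma abs2_0 : abs2 0 = 0.
Proof. by rewrite abs2E expr0n addr0. Qed.

Lemma abs2_eq0 z : abs2 z = 0 -> z = 0.
Proof.
rewrite abs2E => /eqP; rewrite paddr_eq0 ?sqr_ge0// !sqrf_eq0.
by case: z => a b /= /andP[/eqP -> /eqP ->].
Qed.

Lemma abs2_1 : abs2 1 = 1.
Proof. by rewrite abs2E /= expr0n addr0 expr1n. Qed.

Lemma abs2N z : abs2 (- z) = abs2 z.
Proof. by rewrite !abs2E !ReImE !sqrrN. Qed.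

Lemma abs2_conj z : abs2 (conjc z) = abs2 z.
Proof. by rewrite !abs2E !ReImE sqrrN. Qed.

Lemma abs2M z w : abs2 (z * w) = abs2 z * abs2 w.
Proof. by rewrite !abs2E !ReImE; ring. Qed.

Lemma abs2D z w : abs2 (z + w) = abs2 z + abs2 w + 2 * complex.Re (z * conjc w).
Proof. by rewrite !abs2E !ReImE; ring. Qed.

Lemma mul_conjc z : z * conjc z = (abs2 z)%:C%C.
Proof. by apply: complex_eq; rewrite !ReImE ?abs2E /=; ring. Qed.

Lemma abs2_real t : abs2 (t%:C)%C = t ^+ 2.
Proof. by rewrite abs2E /= expr0n addr0. Qed.

(** The weighted parallelogram inequality: a substitute for the triangle
    inequality of the [L^2] norm that involves no square root. *)
Lemma abs2D_le (e : R) z w : 0 < e ->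
  abs2 (z + w) <= (1 + e) * abs2 z + (1 + e^-1) * abs2 w.
Proof.
move=> e0; rewrite -subr_ge0.
have -> : (1 + e) * abs2 z + (1 + e^-1) * abs2 w - abs2 (z + w) =
   e * abs2 (z - (e^-1%:C)%C * w).
  by rewrite !abs2E !ReImE /=; field; rewrite gt_eqF.
by rewrite mulr_ge0 ?abs2_ge0// ltW.
Qed.

Lemma abs2D_le2 z w : abs2 (z + w) <= 2 * abs2 z + 2 * abs2 w.
Proof. by have := abs2D_le z w ltr01; rewrite invr1. Qed.

Lemma Re_sqr_le z : complex.Re z ^+ 2 <= abs2 z.
Proof. by rewrite abs2E lerDl sqr_ge0. Qed.

Lemma Im_sqr_le z : complex.Im z ^+ 2 <= abs2 z.
Proof. by rewrite abs2E lerDr sqr_ge0. Qed.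

Lemma expiD (s t : R) : expi (s + t) = expi s * expi t.
Proof. by rewrite /expi cosD sinD; apply: complex_eq; rewrite !ReImE /=; ring. Qed.

Lemma expi0 : expi (0 : R) = 1.
Proof. by rewrite /expi cos0 sin0. Qed.

Lemma expiN t : expi (- t) = conjc (expi t).
Proof. by rewrite /expi cosN sinN. Qed.

Lemma abs2_expi t : abs2 (expi t) = 1.
Proof. by rewrite abs2E /expi /= cos2Dsin2. Qed.

Lemma expi_conjM t : expi t * conjc (expi t) = 1.
Proof. by rewrite mul_conjc abs2_expi. Qed.

Lemma expi_int (k : int) : expi (2 * pi * k%:~R : R) = 1.
Proof.
have expi2pi : expi (2 * pi : R) = 1.
  by rewrite /expi mulr_natl cos2pi sin2pi.
have expin (n : nat) : expi (2 * pi * n%:R : R) = 1.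
  elim: n => [|n IH]; first by rewrite mulr0 expi0.
  by rewrite -[n.+1%:R]natr1 mulrDr expiD IH mul1r mulr1.
case: k => n; first exact: expin.
by rewrite NegzE mulrNz mulrN expiN expin rmorph1.
Qed.

End complex_numbers.

(** * Square integrable complex functions *)

Section complex_measurability.
Context {R : realType} {d} {T : measurableType d}.
Implicit Types (f g : T -> R[i]).

Definition cmeas f := measurable_fun setT (fun x => complex.Re (f x)) /\
  measurable_fun setT (fun x => complex.Im (f x)).

Lemma cmeas_cst (z : R[i]) : cmeas (fun=> z).
Proof. by split; exact: measurable_cst. Qed.

Lemma cmeasD f g : cmeas f -> cmeas g -> cmeas (f \+ g).
Proof.
move=> [f1 f2] [g1 g2]; split.
- by apply: eq_measurable_fun (measurable_funD f1 g1) => x _ /=; rewrite cReD.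
- by apply: eq_measurable_fun (measurable_funD f2 g2) => x _ /=; rewrite cImD.
Qed.

Lemma cmeasN f : cmeas f -> cmeas (fun x => - f x).
Proof.
move=> [f1 f2]; split.
- by apply: eq_measurable_fun (measurable_funN f1) => x _ /=; rewrite cReN.
- by apply: eq_measurable_fun (measurable_funN f2) => x _ /=; rewrite cImN.
Qed.

Lemma cmeasB f g : cmeas f -> cmeas g -> cmeas (f \- g).
Proof. by move=> mf mg; apply: cmeasD mf (cmeasN mg). Qed.

Lemma cmeas_conj f : cmeas f -> cmeas (fun x => conjc (f x)).
Proof.
move=> [f1 f2]; split.
- by apply: eq_measurable_fun f1 => x _; rewrite cRe_conj.
- by apply: eq_measurable_fun (measurable_funN f2) => x _; rewrite cIm_conj.
Qed.

Lemma cmeasM f g : cmeas f -> cmeas g -> cmeas (fun x => f x * g x).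
Proof.
move=> [f1 f2] [g1 g2]; split.
- by apply: eq_measurable_fun (measurable_funB (measurable_funM f1 g1)
    (measurable_funM f2 g2)) => x _ /=; rewrite cReM.
- by apply: eq_measurable_fun (measurable_funD (measurable_funM f1 g2)
    (measurable_funM f2 g1)) => x _ /=; rewrite cImM.
Qed.

Lemma cmeas_sum I (s : seq I) (F : I -> T -> R[i]) :
  (forall i, cmeas (F i)) -> cmeas (fun x => \sum_(i <- s) F i x).
Proof.
move=> mF; elim: s => [|i s IH].
  rewrite (_ : (fun _ => _) = fun=> 0); first exact: cmeas_cst.
  by apply/funext => x; rewrite big_nil.
rewrite (_ : (fun _ => _) = F i \+ (fun x => \sum_(j <- s) F j x)).
  exact: cmeasD.
by apply/funext => x; rewrite big_cons.
Qed.

Lemma cmeas_comp d' (T' : measurableType d') (phi : T' -> T) f :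
  measurable_fun setT phi -> cmeas f ->
  measurable_fun setT (fun x => complex.Re (f (phi x))) /\
  measurable_fun setT (fun x => complex.Im (f (phi x))).
Proof.
move=> mphi [f1 f2]; split.
- exact: (measurableT_comp f1 mphi).
- exact: (measurableT_comp f2 mphi).
Qed.

Lemma measurable_abs2 f : cmeas f -> measurable_fun setT (fun x => abs2 (f x)).
Proof.
move=> [f1 f2]; apply: eq_measurable_fun (measurable_funD
  (measurable_funX 2 f1) (measurable_funX 2 f2)) => x _ /=.
by rewrite abs2E.
Qed.

Lemma emeasurable_abs2 f :
  cmeas f -> measurable_fun setT (fun x => (abs2 (f x))%:E).
Proof. by move=> mf; apply/measurable_EFinP/measurable_abs2. Qed.

Lemma cmeas_expi (u : T -> R) : measurable_fun setT u ->
  cmeas (fun x => expi (u x)).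
Proof.
move=> mu; split; rewrite /expi /=.
- apply: measurableT_comp => //.
  by apply: continuous_measurable_fun; exact: continuous_cos.
- apply: measurableT_comp => //.
  by apply: continuous_measurable_fun; exact: continuous_sin.
Qed.

Lemma cmeas_indic (A : set T) : measurable A ->
  cmeas (fun x => ((\1_A x)%:C)%C : R[i]).
Proof. by move=> mA; split => /=; [exact: measurable_indic|exact: measurable_cst]. Qed.

Lemma cmeas_real (u : T -> R) : measurable_fun setT u ->
  cmeas (fun x => ((u x)%:C)%C).
Proof. by move=> mu; split => /=; [|exact: measurable_cst]. Qed.

End complex_measurability.

Section square_integrable.
Context {R : realType} {d} {T : measurableType d}.
Implicit Types (m : {measure set T -> \bar R}) (f g h : T -> R[i]).

Definition sqn m f : \bar R := (\int[m]_x (abs2 (f x))%:E)%E.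

Definition L2 m f := cmeas f /\ (sqn m f < +oo)%E.

Definition L1 m f := m.-integrable setT (fun x => (complex.Re (f x))%:E) /\
  m.-integrable setT (fun x => (complex.Im (f x))%:E).

Definition cint m f : R[i] :=
  Complex (\int[m]_x complex.Re (f x))%R (\int[m]_x complex.Im (f x))%R.

(** Functions are not quotiented by almost everywhere equality: [sqn] and [ip] are the
    square seminorm and the inner product, on everywhere defined functions. Restrictions
    to a subset are expressed by restricting the measure or truncating the function. *)
Definition ip m f g : R[i] := cint m (fun x => f x * conjc (g x)).

Definition nrm2 m f : R := fine (sqn m f).

Lemma sqn_ge0 m f : (0 <= sqn m f)%E.
Proof. by apply: integral_ge0 => x _; rewrite lee_fin abs2_ge0. Qed.

Lemma nrm2_ge0 m f : 0 <= nrm2 m f.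
Proof. by rewrite fine_ge0// sqn_ge0. Qed.

Lemma sqnE m f : L2 m f -> sqn m f = (nrm2 m f)%:E.
Proof. by move=> [_ fo]; rewrite fineK// ge0_fin_numE// sqn_ge0. Qed.

Lemma eq_sqn m f g : f =1 g -> sqn m f = sqn m g.
Proof. by move=> fg; apply: eq_integral => x _; rewrite fg. Qed.

Lemma sqnN m f : sqn m (fun x => - f x) = sqn m f.
Proof. by apply: eq_integral => x _; rewrite abs2N. Qed.

Lemma sqnBC m f g : sqn m (f \- g) = sqn m (g \- f).
Proof. by rewrite -sqnN; apply: eq_sqn => x /=; rewrite opprB. Qed.

Lemma le_sqn m f g : cmeas f -> cmeas g -> (forall x, abs2 (f x) <= abs2 (g x)) ->
  (sqn m f <= sqn m g)%E.
Proof.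
move=> mf mg fg; apply: ge0_le_integral => //.
- by move=> x _; rewrite lee_fin abs2_ge0.
- exact: emeasurable_abs2.
- exact: emeasurable_abs2.
- by move=> x _; rewrite lee_fin.
Qed.

Lemma sqnM_le m f h (K : R) : cmeas f -> cmeas h -> (forall x, abs2 (h x) <= K) ->
  (sqn m (fun x => h x * f x)%R <= K%:E * sqn m f)%E.
Proof.
move=> mf mh hK; rewrite /sqn -ge0_integralZl//; last 3 first.
- exact: emeasurable_abs2.
- by move=> x _; rewrite lee_fin abs2_ge0.
- by rewrite lee_fin (le_trans (abs2_ge0 (h point))).
apply: ge0_le_integral => //.
- by move=> x _; rewrite lee_fin abs2_ge0.
- by apply: emeasurable_abs2; exact: cmeasM.
- by apply: measurable_funeM; exact: emeasurable_abs2.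
- by move=> x _; rewrite lee_fin abs2M ler_wpM2r ?abs2_ge0.
Qed.

Lemma sqnD_le m (e : R) f g : 0 < e -> cmeas f -> cmeas g ->
  (sqn m (f \+ g)%R <= (1 + e)%R%:E * sqn m f + (1 + e^-1)%R%:E * sqn m g)%E.
Proof.
move=> e0 mf mg.
have e1 : (0 <= 1 + e^-1)%R by rewrite addr_ge0// invr_ge0 ltW.
have e2 : (0 <= 1 + e)%R by rewrite addr_ge0// ltW.
rewrite -!ge0_integralZl//; last 4 first.
- exact: emeasurable_abs2.
- by move=> x _; rewrite lee_fin abs2_ge0.
- exact: emeasurable_abs2.
- by move=> x _; rewrite lee_fin abs2_ge0.
rewrite -ge0_integralD//; last 4 first.
- by move=> x _; rewrite mule_ge0 ?lee_fin ?abs2_ge0.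
- by apply: measurable_funeM; exact: emeasurable_abs2.
- by move=> x _; rewrite mule_ge0 ?lee_fin ?abs2_ge0.
- by apply: measurable_funeM; exact: emeasurable_abs2.
apply: ge0_le_integral => //.
- by move=> x _; rewrite lee_fin abs2_ge0.
- by apply: emeasurable_abs2; exact: cmeasD.
- by apply: emeasurable_funD; apply: measurable_funeM; exact: emeasurable_abs2.
- by move=> x _; rewrite -!EFinM -EFinD lee_fin abs2D_le.
Qed.

Lemma L2_cst0 m : L2 m (fun=> 0).
Proof.
split; first exact: cmeas_cst.
by rewrite /sqn integral0_eq// => x _; rewrite abs2_0.
Qed.

Lemma L2D m f g : L2 m f -> L2 m g -> L2 m (f \+ g).
Proof.
move=> [mf fo] [mg go]; split; first exact: cmeasD.
apply: (le_lt_trans (sqnD_le m ltr01 mf mg)).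
by rewrite lte_add_pinfty// lte_mul_pinfty// ?lee_fin ?addr_ge0 ?invr_ge0.
Qed.

Lemma L2M m f h (K : R) : cmeas h -> (forall x, abs2 (h x) <= K) -> L2 m f ->
  L2 m (fun x => h x * f x).
Proof.
move=> mh hK [mf fo]; split; first exact: cmeasM.
apply: (le_lt_trans (sqnM_le m mf mh hK)).
by rewrite lte_mul_pinfty// lee_fin (le_trans (abs2_ge0 (h point))).
Qed.

Lemma L2Z m f (a : R[i]) : L2 m f -> L2 m (fun x => a * f x).
Proof. by apply: (@L2M _ _ _ (abs2 a)); [exact: cmeas_cst|]. Qed.

Lemma L2N m f : L2 m f -> L2 m (fun x => - f x).
Proof.
move=> /(L2Z (-1)); congr (L2 m _); apply/funext => x; exact: mulN1r.
Qed.

Lemma L2B m f g : L2 m f -> L2 m g -> L2 m (f \- g).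
Proof. by move=> mf mg; apply: L2D mf (L2N mg). Qed.

Lemma L2_sum m I (s : seq I) (F : I -> T -> R[i]) :
  (forall i, L2 m (F i)) -> L2 m (fun x => \sum_(i <- s) F i x).
Proof.
move=> mF; elim: s => [|i s IH].
  rewrite (_ : (fun _ => _) = fun=> 0); first exact: L2_cst0.
  by apply/funext => x; rewrite big_nil.
rewrite (_ : (fun _ => _) = F i \+ (fun x => \sum_(j <- s) F j x)).
  exact: L2D.
by apply/funext => x; rewrite big_cons.
Qed.

Lemma L2_integrable m f : L2 m f -> m.-integrable setT (fun x => (abs2 (f x))%:E).
Proof.
move=> [mf fo]; apply/integrableP; split; first exact: emeasurable_abs2.
rewrite (eq_integral (fun x => (abs2 (f x))%:E))// => x _.
by rewrite gee0_abs// lee_fin abs2_ge0.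
Qed.

Lemma L1_mul_conj m f g : L2 m f -> L2 m g -> L1 m (fun x => f x * conjc (g x)).
Proof.
move=> Lf Lg; have [mf _] := Lf; have [mg _] := Lg.
have [m1 m2] := cmeasM mf (cmeas_conj mg).
have H := integrableD measurableT (L2_integrable Lf) (L2_integrable Lg).
have bnd (x : T) : (`|complex.Re (f x * conjc (g x))| <= abs2 (f x) + abs2 (g x)) /\
    (`|complex.Im (f x * conjc (g x))| <= abs2 (f x) + abs2 (g x)).
  rewrite !ReImE !abs2E.
  have aux (a b a' b' : R) :
      `|a * b + a' * b'| <= a ^+ 2 + b ^+ 2 + (a' ^+ 2 + b' ^+ 2).
    have := sqr_ge0 (a + b); have := sqr_ge0 (a - b).
    have := sqr_ge0 (a' + b'); have := sqr_ge0 (a' - b').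
    have := sqr_ge0 a; have := sqr_ge0 b; have := sqr_ge0 a'; have := sqr_ge0 b'.
    by rewrite ler_norml !sqrrB !sqrrD => *; apply/andP; split; lra.
  split.
  - by rewrite mulrN opprK; apply: le_trans (aux _ _ _ _) _; rewrite addrACA.
  - rewrite mulrN addrC -mulNr; apply: le_trans (aux _ _ _ _) _.
    by rewrite sqrrN; lra.
split; apply: le_integrable H => //.
- exact/measurable_EFinP.
- move=> x _ /=; rewrite lee_fin [leRHS]ger0_norm ?addr_ge0 ?abs2_ge0//.
  by have [] := bnd x.
- exact/measurable_EFinP.
- move=> x _ /=; rewrite lee_fin [leRHS]ger0_norm ?addr_ge0 ?abs2_ge0//.
  by have [] := bnd x.
Qed.

Lemma L1D m f g : L1 m f -> L1 m g -> L1 m (f \+ g).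
Proof.
move=> [f1 f2] [g1 g2]; split.
- by under eq_fun do rewrite /= cReD EFinD; exact: integrableD.
- by under eq_fun do rewrite /= cImD EFinD; exact: integrableD.
Qed.

Lemma L1Z m f (a : R[i]) : L1 m f -> L1 m (fun x => a * f x).
Proof.
move=> [f1 f2]; split.
- under eq_fun do rewrite /= cReM EFinB !EFinM.
  by apply: integrableB => //; exact: integrableZl.
- under eq_fun do rewrite /= cImM EFinD !EFinM.
  by apply: integrableD => //; exact: integrableZl.
Qed.

Lemma cint0 m : cint m (fun=> 0) = 0.
Proof. by apply: complex_eq; rewrite /= /Rintegral integral0_eq. Qed.

Lemma cintD m f g : L1 m f -> L1 m g -> cint m (f \+ g) = cint m f + cint m g.
Proof.
move=> [f1 f2] [g1 g2]; apply: complex_eq; rewrite ?ReImE /=.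
- by rewrite -RintegralD//; apply: eq_Rintegral => x _; rewrite cReD.
- by rewrite -RintegralD//; apply: eq_Rintegral => x _; rewrite cImD.
Qed.

Lemma cintZ m f (a : R[i]) : L1 m f -> cint m (fun x => a * f x) = a * cint m f.
Proof.
move=> [f1 f2].
have iZ (r : R) (u : T -> R) : m.-integrable setT (fun x => (u x)%:E) ->
    m.-integrable setT (EFin \o (fun x => r * u x)).
  by move=> iu; exact: (integrableZl measurableT r iu).
apply: complex_eq; rewrite ?ReImE /=.
- rewrite -!RintegralZl// -RintegralB//; last 2 first.
  + exact: iZ.
  + exact: iZ.
  by apply: eq_Rintegral => x _; rewrite cReM.
- rewrite -!RintegralZl// -RintegralD//; last 2 first.
  + exact: iZ.
  + exact: iZ.
  by apply: eq_Rintegral => x _; rewrite cImM.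
Qed.

Lemma cint_sum m I (s : seq I) (F : I -> T -> R[i]) : (forall i, L1 m (F i)) ->
  L1 m (fun x => \sum_(i <- s) F i x) /\
  cint m (fun x => \sum_(i <- s) F i x) = \sum_(i <- s) cint m (F i).
Proof.
move=> LF; elim: s => [|i s [IH1 IH2]].
  under eq_fun do rewrite big_nil; rewrite big_nil cint0; split => //.
  by split; exact: integrable0.
under eq_fun do rewrite big_cons.
by split; [exact: L1D|rewrite big_cons -IH2 -cintD].
Qed.

Lemma cint_conj m f : L1 m f -> cint m (fun x => conjc (f x)) = conjc (cint m f).
Proof.
move=> [f1 f2]; apply: complex_eq; rewrite !ReImE /=.
  by apply: eq_Rintegral => x _; rewrite cRe_conj.
rewrite -mulN1r -RintegralZl//.
by apply: eq_Rintegral => x _; rewrite cIm_conj mulN1r.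
Qed.

End square_integrable.

(** * Inner products and Bessel's inequality *)

Section inner_product.
Context {R : realType} {d} {T : measurableType d}.
Context (m : {measure set T -> \bar R}).
Implicit Types (f g h : T -> R[i]).

Lemma ipDl f g h : L2 m f -> L2 m g -> L2 m h ->
  ip m (f \+ g) h = ip m f h + ip m g h.
Proof.
move=> Lf Lg Lh; rewrite /ip -cintD; [|exact: L1_mul_conj..].
by congr cint; apply/funext => x /=; rewrite mulrDl.
Qed.

Lemma ipZl (a : R[i]) f h : L2 m f -> L2 m h ->
  ip m (fun x => a * f x) h = a * ip m f h.
Proof.
move=> Lf Lh; rewrite /ip -cintZ; last exact: L1_mul_conj.
by congr cint; apply/funext => x /=; rewrite mulrA.
Qed.

Lemma ip_sumZl I (s : seq I) (a : I -> R[i]) (F : I -> T -> R[i]) h :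
  (forall i, L2 m (F i)) -> L2 m h ->
  ip m (fun x => \sum_(i <- s) a i * F i x) h = \sum_(i <- s) a i * ip m (F i) h.
Proof.
move=> LF Lh.
have L1F i : L1 m (fun x => a i * F i x * conjc (h x)).
  by apply: L1_mul_conj => //; exact: L2Z.
have [_ H] := cint_sum s L1F.
rewrite /ip (_ : (fun x => _) =
    (fun x => \sum_(i <- s) (a i * F i x * conjc (h x)))); last first.
  by apply/funext => x; rewrite mulr_suml.
by rewrite H; apply: eq_bigr => i _; rewrite -ipZl.
Qed.

Lemma ip_conj f g : L2 m f -> L2 m g -> ip m g f = conjc (ip m f g).
Proof.
move=> Lf Lg; rewrite /ip -cint_conj; last exact: L1_mul_conj.
by congr cint; apply/funext => x; rewrite rmorphM /= conjcK mulrC.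
Qed.

Lemma ipxx f : L2 m f -> ip m f f = (nrm2 m f)%:C%C.
Proof.
move=> Lf; rewrite /ip /cint; under eq_Rintegral do rewrite mul_conjc /=.
by under [X in Complex _ X]eq_Rintegral do rewrite mul_conjc /=;
  rewrite /Rintegral integral0.
Qed.

Lemma nrm2D f g : L2 m f -> L2 m g ->
  nrm2 m (f \+ g) = nrm2 m f + nrm2 m g + 2 * complex.Re (ip m f g).
Proof.
move=> Lf Lg; have [L1r _] := L1_mul_conj Lf Lg.
have If := L2_integrable Lf; have Ig := L2_integrable Lg.
rewrite [LHS](_ : _ = \int[m]_x (abs2 (f x) + abs2 (g x) +
   2 * complex.Re (f x * conjc (g x)))); last first.
  by apply: eq_Rintegral => x _; rewrite abs2D.
rewrite RintegralD//; last 2 first.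
- exact: (integrableD measurableT If Ig).
- exact: (integrableZl measurableT 2 L1r).
by rewrite RintegralD// RintegralZl.
Qed.

Lemma nrm2Z (a : R[i]) f : L2 m f -> nrm2 m (fun x => a * f x) = abs2 a * nrm2 m f.
Proof.
move=> Lf; rewrite /nrm2 /sqn -/(Rintegral m setT _).
under eq_Rintegral do rewrite abs2M.
by rewrite RintegralZl//; exact: L2_integrable.
Qed.

End inner_product.

Section orthogonal_family.
Context {R : realType} {d} {T : measurableType d}.
Context (m : {measure set T -> \bar R}) (I : eqType) (e : I -> T -> R[i]) (M : R).
Hypothesis Le : forall i, L2 m (e i).
Hypothesis eM : forall i, nrm2 m (e i) = M.

Definition ortho_family (s : seq I) :=
  {in s &, forall i j, i != j -> ip m (e i) (e j) = 0}.

Lemma nrm2_subproj (s : seq I) (a : I -> R[i]) (f : T -> R[i]) :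
    uniq s -> ortho_family s -> L2 m f ->
  nrm2 m (f \- (fun x => \sum_(i <- s) a i * e i x)) =
  nrm2 m f - 2 * \sum_(i <- s) complex.Re (conjc (a i) * ip m f (e i)) +
  M * \sum_(i <- s) abs2 (a i).
Proof.
elim: s f => [|i s IH] f; move=> /=.
  move=> _ _ Lf; rewrite !big_nil !mulr0 subr0 addr0.
  by congr (nrm2 m _); apply/funext => x /=; rewrite big_nil subr0.
move=> /andP[si us] os Lf.
have Lai : L2 m (fun x => - a i * e i x) by exact: L2Z.
have Lfi : L2 m (f \+ (fun x => - a i * e i x)) by exact: L2D.
have os' : ortho_family s.
  by move=> j k js ks; apply: os; rewrite inE ?js ?ks orbT.
rewrite [X in nrm2 m X](_ : _ = (f \+ (fun x => - a i * e i x)) \-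
    (fun x => \sum_(j <- s) a j * e j x)); last first.
  by apply/funext => x /=; rewrite big_cons opprD addrA mulNr.
rewrite IH// nrm2D// nrm2Z// abs2N eM.
rewrite !big_cons.
have -> : \sum_(j <- s) complex.Re (conjc (a j) *
    ip m (f \+ (fun x => - a i * e i x)) (e j)) =
   \sum_(j <- s) complex.Re (conjc (a j) * ip m f (e j)).
  apply: eq_big_seq => j js; rewrite ipDl// ipZl// os ?mulr0 ?addr0//.
  - by rewrite mem_head.
  - by rewrite inE js orbT.
  - by apply: contraNneq si => ->.
have -> : ip m f (fun x => - a i * e i x) = - conjc (a i) * ip m f (e i).
  by rewrite (ip_conj Lai Lf) ipZl// rmorphM /= rmorphN (ip_conj (Le i) Lf).
rewrite mulNr cReN; ring.
Qed.

Hypothesis M0 : 0 < M.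

Definition proj (s : seq I) (f : T -> R[i]) : T -> R[i] :=
  fun x => \sum_(i <- s) (ip m f (e i) / M%:C%C) * e i x.

(** The defect in Bessel's inequality is the squared distance to the span. The factor
    [M] is kept on both sides because the characters are not normalized. *)
Lemma nrm2_sub_proj (s : seq I) (f : T -> R[i]) :
    uniq s -> ortho_family s -> L2 m f ->
  M * nrm2 m (f \- proj s f) =
  M * nrm2 m f - \sum_(i <- s) abs2 (ip m f (e i)).
Proof.
move=> us os Lf; rewrite nrm2_subproj//.
have MC : (M%:C%C)^-1 = (M^-1)%:C%C :> R[i] by rewrite fmorphV.
under eq_bigr do rewrite MC rmorphM mulrAC [conjc (ip _ _ _) * _]mulrC mul_conjc.
under [X in _ + M * X]eq_bigr do rewrite MC abs2M abs2_real.
have -> : \sum_(i <- s) complex.Re (((abs2 (ip m f (e i)))%:C%C) *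
    conjc ((M^-1)%:C%C)) = M^-1 * \sum_(i <- s) abs2 (ip m f (e i)).
  by rewrite mulr_sumr; apply: eq_bigr => i _; rewrite !ReImE /=; ring.
rewrite -mulr_suml; field; exact: lt0r_neq0.
Qed.

Lemma bessel (s : seq I) (f : T -> R[i]) : uniq s -> ortho_family s -> L2 m f ->
  \sum_(i <- s) abs2 (ip m f (e i)) <= M * nrm2 m f.
Proof.
move=> us os Lf; rewrite -subr_ge0 -nrm2_sub_proj// mulr_ge0 ?nrm2_ge0//.
exact: ltW.
Qed.

Lemma cauchy_schwarz (i : I) (f : T -> R[i]) : L2 m f ->
  abs2 (ip m f (e i)) <= M * nrm2 m f.
Proof.
move=> Lf; have := @bessel [:: i] f isT _ Lf; rewrite big_seq1; apply.
by move=> j k; rewrite !inE => /eqP -> /eqP ->; rewrite eqxx.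
Qed.

(** The orthogonal projection is the best approximation, so approximability by
    some combination of the [e i] bounds the Bessel defect. *)
Lemma proj_best (s : seq I) (a : I -> R[i]) (f : T -> R[i]) :
    uniq s -> ortho_family s -> L2 m f ->
  nrm2 m (f \- proj s f) <= nrm2 m (f \- (fun x => \sum_(i <- s) a i * e i x)).
Proof.
move=> us os Lf; rewrite -(ler_pM2l M0) nrm2_sub_proj// nrm2_subproj//.
rewrite -subr_ge0.
set N := nrm2 m f; set X := \sum_(i <- s) complex.Re _.
set Y := \sum_(i <- s) abs2 (a i); set Z := \sum_(i <- s) abs2 (ip _ _ _).
have -> : M * (N - 2 * X + M * Y) - (M * N - Z) = Z - 2 * M * X + M * M * Y.
  by ring.
have -> : Z - 2 * M * X + M * M * Y =
  \sum_(i <- s) abs2 (ip m f (e i) - M%:C%C * a i).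
  rewrite !mulr_sumr -sumrN -!big_split /=; apply: eq_bigr => i _.
  by rewrite !abs2E !ReImE /=; ring.
by apply: sumr_ge0 => i _; exact: abs2_ge0.
Qed.

End orthogonal_family.

(** * Pointwise convergence and truncation *)

Section complex_convergence.
Context {R : realType}.
Implicit Types (z : nat -> R[i]) (w : R[i]).

Definition ccvg z w := (fun n => complex.Re (z n)) @ \oo --> complex.Re w /\
  (fun n => complex.Im (z n)) @ \oo --> complex.Im w.

Lemma ccvg_abs2 z w : ccvg z w -> (fun n => abs2 (z n)) @ \oo --> abs2 w.
Proof.
move=> [zr zi]; rewrite abs2E; under eq_fun do rewrite abs2E !expr2.
by rewrite !expr2; apply: cvgD; apply: cvgM.
Qed.

Lemma ccvg_cst w : ccvg (fun=> w) w.
Proof. by split; exact: cvg_cst. Qed.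

Lemma ccvgB z1 z2 w1 w2 : ccvg z1 w1 -> ccvg z2 w2 ->
  ccvg (fun n => z1 n - z2 n) (w1 - w2).
Proof.
move=> [? ?] [? ?]; split; rewrite ?(cReD, cReN, cImD, cImN).
- by under eq_fun do rewrite cReD cReN; exact: cvgB.
- by under eq_fun do rewrite cImD cImN; exact: cvgB.
Qed.

Lemma ccvgM z1 z2 w1 w2 : ccvg z1 w1 -> ccvg z2 w2 ->
  ccvg (fun n => z1 n * z2 n) (w1 * w2).
Proof.
move=> [? ?] [? ?]; split; rewrite ?(cReM, cImM).
- by under eq_fun do rewrite cReM; apply: cvgB; exact: cvgM.
- by under eq_fun do rewrite cImM; apply: cvgD; exact: cvgM.
Qed.

End complex_convergence.

Section convergence_theorems.
Context {R : realType} {d} {T : measurableType d}.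
Context (m : {measure set T -> \bar R}).
Implicit Types (f g h : T -> R[i]) (A : set T).

Definition trunc A f : T -> R[i] := fun x => ((\1_A x)%:C)%C * f x.

Lemma truncE A f x : trunc A f x = if x \in A then f x else 0.
Proof. by rewrite /trunc indicE; case: (x \in A); rewrite /= ?mul1r ?mul0r. Qed.

Lemma cmeas_trunc A f : measurable A -> cmeas f -> cmeas (trunc A f).
Proof. by move=> mA mf; apply: cmeasM => //; exact: cmeas_indic. Qed.

Lemma abs2_trunc_le A f x : abs2 (trunc A f x) <= abs2 (f x).
Proof. by rewrite truncE; case: ifPn => // _; rewrite abs2_0 abs2_ge0. Qed.

Lemma L2_trunc A f : measurable A -> L2 m f -> L2 m (trunc A f).
Proof.
move=> mA; apply: (@L2M _ _ _ _ _ _ 1); first exact: cmeas_indic.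
by move=> x; rewrite abs2_real indicE; case: (x \in A); rewrite /= ?expr0n.
Qed.

Lemma cvg_trunc (A : nat -> set T) f x : (\forall n \near \oo, A n x) ->
  ccvg (fun n => trunc (A n) f x) (f x).
Proof.
move=> Ax; split; apply: cvg_near_cst;
  by near=> n; rewrite truncE mem_set//; near: n.
Unshelve. all: by end_near. Qed.

Lemma dominated_sqn (g : nat -> T -> R[i]) f (b : T -> R) :
    (forall n, cmeas (g n)) -> cmeas f ->
    (forall x, ccvg (fun n => g n x) (f x)) ->
    m.-integrable setT (EFin \o b) ->
    (forall n x, abs2 (g n x - f x) <= b x) ->
  sqn m (g n \- f) @[n --> \oo] --> 0%E.
Proof.
move=> mg mf gf ib gb.
have := @dominated_convergence _ T R m setT measurableT
  (fun n x => (abs2 ((g n \- f) x))%:E) (cst 0%E) (EFin \o b).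
case.
- by move=> n; apply: emeasurable_abs2; exact: cmeasB.
- exact: measurable_cst.
- apply/aeW => x _; apply/fine_cvgP; split; first exact: nearW.
  have := ccvg_abs2 (ccvgB (gf x) (ccvg_cst (f x))).
  by rewrite subrr abs2_0.
- exact: ib.
- by apply/aeW => x n _; rewrite gee0_abs ?lee_fin ?abs2_ge0//= gb.
by move=> _ _; rewrite integral_cst// mul0e.
Qed.

Lemma sqn_sub_trunc_cvg (A : nat -> set T) f : (forall n, measurable (A n)) ->
    (forall x, \forall n \near \oo, A n x) -> L2 m f ->
  sqn m (trunc (A n) f \- f) @[n --> \oo] --> 0%E.
Proof.
move=> mA Acvg Lf; have [mf _] := Lf.
apply: (@dominated_sqn _ _ (fun x => abs2 (f x))) => //.
- by move=> n; exact: cmeas_trunc.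
- by move=> x; exact: cvg_trunc.
- exact: L2_integrable.
- move=> n x; rewrite truncE.
  by case: ifPn => _; rewrite ?sub0r ?abs2N// subrr abs2_0 abs2_ge0.
Qed.

Lemma ecvg0_lt (u : nat -> \bar R) (e : R) : u @ \oo --> 0%E -> 0 < e ->
  \forall n \near \oo, (u n < e%:E)%E.
Proof.
move=> u0 e0; apply: (u0 [set x | (x < e%:E)%E]).
by apply: open_nbhs_nbhs; split; [exact: open_ereal_lt_ereal|rewrite /= lte_fin].
Qed.

Lemma cint_trunc_cvg (A : nat -> set T) f : (forall n, measurable (A n)) ->
    (forall x, \forall n \near \oo, A n x) -> L1 m f ->
  ccvg (fun n => cint m (trunc (A n) f)) (cint m f).
Proof.
move=> mA Acvg Lf.
have key (u : T -> R) : m.-integrable setT (EFin \o u) ->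
    (\int[m]_x (\1_(A n) x * u x))%R @[n --> \oo] --> (\int[m]_x u x)%R.
  move=> iu; have mu := measurable_int m iu; have := @dominated_convergence _ T R
    m setT measurableT (fun n x => (\1_(A n) x * u x)%:E) (EFin \o u)
    (abse \o (EFin \o u)).
  case.
  - move=> n; apply/measurable_EFinP; apply: measurable_funM.
      exact: measurable_indic.
    exact/measurable_EFinP.
  - by [].
  - apply/aeW => x _; apply: cvg_near_cst.
    by near=> n; rewrite indicE mem_set /= ?mul1r//; near: n; exact: Acvg.
  - exact: integrable_abse.
  - apply/aeW => x n _ /=; rewrite lee_fin indicE normrM.
    by case: (x \in A n); rewrite /= ?normr1 ?mul1r// normr0 mul0r.
  move=> _ _ H.
  rewrite /Rintegral; apply: fine_cvg; rewrite fineK//.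
  exact: integrable_fin_num.
have [f1 f2] := Lf; split => /=.
- under eq_fun do under eq_Rintegral do rewrite cReM /= mul0r subr0.
  exact: key.
- under eq_fun do under eq_Rintegral do rewrite cImM /= mul0r addr0.
  exact: key.
Unshelve. all: by end_near. Qed.

Lemma fatou_sqn (g : nat -> T -> R[i]) h (K : \bar R) : (forall n, cmeas (g n)) ->
    (forall x, ccvg (fun n => g n x) (h x)) ->
    (\forall n \near \oo, sqn m (g n) <= K)%E -> (sqn m h <= K)%E.
Proof.
move=> mg gh gK.
have := @fatou _ T R m setT measurableT (fun n x => (abs2 (g n x))%:E)
  (fun n => emeasurable_abs2 (mg n)) (fun n x _ => _).
move/(_ (fun n x => _)); rewrite (eq_integral (fun x => (abs2 (h x))%:E)); last first.
  move=> x _; apply: (@cvg_limn_einf_sup _ _ _ _).1.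
  apply/fine_cvgP; split; first exact: nearW.
  exact: ccvg_abs2.
move=> H; apply: le_trans (H _) _; first by move=> n x; rewrite lee_fin abs2_ge0.
rewrite limn_einf_lim; apply: lime_le; first exact: is_cvg_einfs.
have [N _ NK] := gK; apply: nearW => n.
apply: (@le_trans _ _ (sqn m (g (maxn n N)))); last by apply: NK => /=; exact: leq_maxr.
by apply: ereal_inf_lbound; exists (maxn n N) => //=; exact: leq_maxl.
Qed.

Lemma cmeas_cvg (g : nat -> T -> R[i]) h : (forall n, cmeas (g n)) ->
  (forall x, ccvg (fun n => g n x) (h x)) -> cmeas h.
Proof.
move=> mg gh; split.
- by apply: (measurable_fun_cvg (fun n => (mg n).1)) => x _; exact: (gh x).1.
- by apply: (measurable_fun_cvg (fun n => (mg n).2)) => x _; exact: (gh x).2.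
Qed.

End convergence_theorems.

(** * Completeness of the space of square integrable functions *)

Section riesz_fischer.
Context {R : realType}.

(** With increments decaying like [q ^ n] for [q <= 1/4], the weighted
    parallelogram inequality loses only a factor [4] when telescoped. *)
Lemma abs2_telescope (a : nat -> R[i]) (s q : R) : 0 <= s -> 0 <= q -> q <= 4^-1 ->
    (forall n, abs2 (a n.+1 - a n) <= s * q ^+ n) ->
  forall k n, abs2 (a (n + k)%N - a n) <= 4 * s * q ^+ n.
Proof.
move=> s0 q0 q4 aq; elim=> [|k IH] n.
  by rewrite addn0 subrr abs2_0 !mulr_ge0// exprn_ge0.
have -> : a (n + k.+1)%N - a n = (a n.+1 - a n) + (a (n.+1 + k)%N - a n.+1).
  by rewrite addnS addSn; ring.
apply: (le_trans (abs2D_le2 _ _)).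
have := aq n; have := IH n.+1; rewrite exprS.
have : q * (s * q ^+ n) <= 4^-1 * (s * q ^+ n).
  by rewrite ler_wpM2r// mulr_ge0// exprn_ge0.
set A := abs2 _; set B := abs2 _.
have -> : 4 * s * (q * q ^+ n) = 4 * (q * (s * q ^+ n)) by ring.
rewrite -[4 * s * _]mulrA; set C := s * q ^+ n; set D := q * C.
by lra.
Qed.

Lemma real_cvg_geometric (u : nat -> R) (K q : R) : 0 <= q -> q < 1 ->
  (forall n k, (u (n + k)%N - u n) ^+ 2 <= K * q ^+ n) -> cvgn u.
Proof.
move=> q0 q1 uK; apply/cauchy_cvgP/cauchy_exP => e e0.
have /cvgrPdist_lt : (fun n => K * q ^+ n) @ \oo --> (0 : R).
  rewrite -[X in _ --> X](mulr0 K); apply: cvgM; first exact: cvg_cst.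
  by apply: cvg_expr; rewrite ger0_norm.
move=> /(_ (e ^+ 2)); rewrite exprn_gt0// => /(_ isT)[N _ NP].
exists (u N); exists N => // n /= Nn; rewrite /ball /=.
have := uK N (n - N)%N; rewrite subnKC// => H.
have := NP N (leqnn N); rewrite sub0r normrN => H2.
rewrite distrC -(ltr_pXn2r (n := 2))// ?nnegrE ?ltW// real_normK ?num_real//.
apply: le_lt_trans H _; apply: le_lt_trans H2; exact: ler_norm.
Qed.

Context {d} {T : measurableType d} (m : {measure set T -> \bar R}).
Implicit Types (f h : T -> R[i]).

Lemma sqn_ae_trunc (E : set T) f : measurable E -> cmeas f ->
  {ae m, forall x, E x} -> sqn m (trunc E f) = sqn m f.
Proof.
move=> mE mf aE; apply: ae_eq_integral => //.
- by apply: emeasurable_abs2; exact: cmeas_trunc.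
- exact: emeasurable_abs2.
- by apply: filterS aE => x Ex _; rewrite truncE mem_set.
Qed.

Lemma sqn_telescope (g : nat -> T -> R[i]) (q : R) : 0 <= q -> q <= 4^-1 ->
    (forall n, cmeas (g n)) ->
    (forall n, (sqn m (g n.+1 \- g n)%R <= (q ^+ n)%:E)%E) ->
  forall k n, (sqn m (g (n + k)%N \- g n)%R <= (4 * q ^+ n)%:E)%E.
Proof.
move=> q0 q4 mg gq; elim=> [|k IH] n.
  rewrite addn0 /sqn integral0_eq; last by move=> x _ /=; rewrite subrr abs2_0.
  by rewrite lee_fin mulr_ge0// exprn_ge0.
rewrite (_ : (g _ \- g n) = (g n.+1 \- g n) \+ (g (n.+1 + k)%N \- g n.+1)); last first.
  by apply/funext => x /=; rewrite addnS addSn; ring.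
apply: le_trans (sqnD_le m ltr01 _ _) _; [exact: cmeasB|exact: cmeasB|].
have two0 : (0 <= (2 : R)%:E)%E by rewrite lee_fin.
rewrite invr1 -[1 + 1]/(2%:R).
apply: le_trans (leeD (lee_wpmul2l two0 (gq n)) (lee_wpmul2l two0 (IH n.+1))) _.
rewrite -!EFinM -EFinD lee_fin exprS.
have : q * q ^+ n <= 4^-1 * q ^+ n by rewrite ler_wpM2r// exprn_ge0.
by set A := q ^+ n; set B := q * A; lra.
Qed.

(** The weighted sum of the increments [q ^- n * |g n.+1 - g n|^2] is integrable, hence
    finite almost everywhere, and where it is finite [g] converges geometrically. Fatou's
    lemma gives the rate. The squares [q ^+ 2] in the hypothesis pay for the weights. *)
Theorem riesz_fischer (g : nat -> T -> R[i]) (q : R) : 0 < q -> q <= 4^-1 ->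
    (forall n, L2 m (g n)) ->
    (forall n, (sqn m (g n.+1 \- g n)%R <= ((q ^+ 2) ^+ n)%:E)%E) ->
  exists2 h, L2 m h & forall n, (sqn m (h \- g n)%R <= (4 * (q ^+ 2) ^+ n)%:E)%E.
Proof.
move=> q0 q4 Lg gq.
have mg n : cmeas (g n) by have [] := Lg n.
have qn0 n : 0 < q ^+ n by rewrite exprn_gt0.
have q1 : q < 1 by rewrite (le_lt_trans q4)// invf_lt1// ltr1n.
pose D n x : \bar R := ((q ^+ n)^-1 * abs2 (g n.+1 x - g n x))%:E.
have D0 n x : (0 <= D n x)%E by rewrite lee_fin mulr_ge0 ?abs2_ge0// invr_ge0 ltW.
have mD n : measurable_fun setT (D n).
  apply/measurable_EFinP; apply: measurable_funM; first exact: measurable_cst.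
  by apply: measurable_abs2; exact: cmeasB.
pose S x := (\sum_(n <oo) D n x)%E.
have S0 x : (0 <= S x)%E by apply: nneseries_ge0 => n _ _; exact: D0.
have mS : measurable_fun setT S.
  by apply: ge0_emeasurable_sum => // k x _ _; exact: D0.
have iS : m.-integrable setT S.
  apply/integrableP; split => //.
  rewrite (eq_integral S); last by move=> x _; rewrite gee0_abs.
  rewrite integral_nneseries//.
  have bnd n : (\int[m]_x D n x <= (q ^+ n)%:E)%E.
    rewrite (_ : (\int[m]_x D n x = ((q ^+ n)^-1)%:E * sqn m (g n.+1 \- g n)%R)%E).
      have := lee_wpmul2l (_ : 0 <= ((q ^+ n)^-1)%:E)%E (gq n).
      rewrite lee_fin invr_ge0 ltW// => /(_ isT)/le_trans; apply.
      rewrite -EFinM lee_fin -exprM mulnC muln2 -addnn exprD mulKf//.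
      exact: lt0r_neq0.
    rewrite /sqn -ge0_integralZl//.
    - by apply: emeasurable_abs2; exact: cmeasB.
    - by move=> x _; rewrite lee_fin abs2_ge0.
    - by rewrite lee_fin invr_ge0 ltW.
  apply: (@le_lt_trans _ _ 2%:E); last exact: ltry.
  apply: lime_le; first by apply: is_cvg_nneseries => n _ _; exact: integral_ge0.
  apply: nearW => n; rewrite big_mkord.
  apply: (@le_trans _ _ (2 - 2 * q ^+ n)%:E); last first.
    by rewrite lee_fin gerBl mulr_ge0// ltW.
  elim: n => [|n IH]; first by rewrite big_ord0 expr0 mulr1 subrr.
  rewrite big_ord_recr /=; apply: le_trans (leeD IH (bnd n)) _.
  rewrite -EFinD lee_fin exprS; have : q * q ^+ n <= 4^-1 * q ^+ n.
    by rewrite ler_wpM2r// ltW.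
  by have := qn0 n; set A := q ^+ n; set B := q * A; lra.
pose E := [set x | S x \is a fin_num].
have mE : measurable E.
  by rewrite -[E]setTI; exact: emeasurable_fin_num.
have aE : {ae m, forall x, E x}.
  by have := integrable_ae measurableT iS; apply: filterS => x; apply.
(* On the exceptional null set everything is set to zero, to converge everywhere. *)
pose g' n := trunc E (g n).
have diffE n x : E x -> abs2 (g n.+1 x - g n x) <= fine (S x) * q ^+ n.
  move=> Ex; have : (D n x <= S x)%E.
    have := @nneseries_lim_ge R (D ^~ x) xpredT 0 n.+1.
    rewrite big_mkord big_ord_recr /= => /(_ (fun k _ _ => D0 k x)).
    by apply: le_trans; rewrite leeDr// sume_ge0.
  by rewrite -{1}(fineK Ex) lee_fin mulrC ler_pdivrMr.
have g'cvg x : exists w, ccvg (fun n => g' n x) w.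
  have H n k : abs2 (g' (n + k)%N x - g' n x) <=
      (4 * (if x \in E then fine (S x) else 0)) * q ^+ n.
    rewrite /g' !truncE; case: ifPn => xE; last first.
      by rewrite subrr abs2_0 mulr0 mul0r.
    rewrite inE in xE; apply: (@abs2_telescope (g^~ x)) => //; last first.
    - by move=> j; exact: diffE.
    - exact: ltW.
    - exact: fine_ge0.
  have Hr : cvgn (fun n => complex.Re (g' n x)).
    apply: (real_cvg_geometric (ltW q0) q1) => n k.
    by apply: le_trans (H n k); rewrite -cReN -cReD Re_sqr_le.
  have Hi : cvgn (fun n => complex.Im (g' n x)).
    apply: (real_cvg_geometric (ltW q0) q1) => n k.
    by apply: le_trans (H n k); rewrite -cImN -cImD Im_sqr_le.
  by exists (Complex (limn (fun n => complex.Re (g' n x)))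
    (limn (fun n => complex.Im (g' n x)))); split.
have [h hP] := choice g'cvg.
have mg' n : cmeas (g' n) by exact: cmeas_trunc.
have mh : cmeas h by exact: cmeas_cvg mg' hP.
have bnd n : (sqn m (h \- g n)%R <= (4 * (q ^+ 2) ^+ n)%:E)%E.
  rewrite -(sqn_ae_trunc mE _ aE); last exact: cmeasB.
  rewrite (_ : trunc E (h \- g n) = h \- g' n); last first.
    apply/funext => x; rewrite /g' /= !truncE; case: ifPn => // xE.
    have z n' : g' n' x = 0 by rewrite /g' truncE (negbTE xE).
    have [] := hP x; under eq_fun do rewrite z; move=> H1.
    under eq_fun do rewrite z; move=> H2.
    have h1 := cvg_unique (@norm_hausdorff _ _) H1 (cvg_cst _).
    have h2 := cvg_unique (@norm_hausdorff _ _) H2 (cvg_cst _).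
    by rewrite subr0; apply: complex_eq; rewrite ?h1 ?h2.
  apply: (@fatou_sqn _ _ _ _ (fun k => g' (n + k)%N \- g' n)).
  - by move=> k; exact: cmeasB.
  - move=> x; apply: ccvgB; last exact: ccvg_cst.
    have [h1 h2] := hP x; split.
    + by under eq_fun do rewrite addnC; move: h1; rewrite -(cvg_shiftn n).
    + by under eq_fun do rewrite addnC; move: h2; rewrite -(cvg_shiftn n).
  - apply: nearW => k.
    rewrite (_ : (g' (n + k)%N \- g' n) = trunc E (g (n + k)%N \- g n)); last first.
      apply/funext => x; rewrite /g' /= !truncE; case: ifPn => // _.
      by rewrite subr0.
    rewrite sqn_ae_trunc//; last exact: cmeasB.
    apply: sqn_telescope => //; first exact: exprn_ge0 (ltW q0).
    by rewrite expr2 (le_trans _ q4)// ger_pMr// ltW.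
exists h => //.
have -> : h = (h \- g 0%N) \+ g 0%N by apply/funext => x /=; rewrite subrK.
apply: L2D => //; split; first exact: cmeasB.
by apply: le_lt_trans (bnd 0%N) _; rewrite ltry.
Qed.

End riesz_fischer.

(** * A criterion for density in L^2 *)

Section approximation.
Context {R : realType} {d} {T : measurableType d}.
Context (m : {measure set T -> \bar R}) (F : set (T -> R[i])).
Hypothesis F_cmeas : forall f, F f -> cmeas f.
Hypothesis FD : forall f g, F f -> F g -> F (f \+ g).
Hypothesis FZ : forall (a : R[i]) f, F f -> F (fun x => a * f x).
Implicit Types (f g h : T -> R[i]).

Definition approximable h := forall e : R, 0 < e ->
  exists2 f, F f & (sqn m (f \- h)%R < e%:E)%E.

Lemma approximableD f g : cmeas f -> cmeas g -> approximable f -> approximable g -> approximable (f \+ g).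
Proof.
move=> mf mg af ag e e0; have e4 : 0 < e / 4 by rewrite divr_gt0.
have [f' Ff' f'e] := af _ e4; have [g' Fg' g'e] := ag _ e4.
exists (f' \+ g'); first exact: FD.
rewrite (_ : _ \- _ = (f' \- f) \+ (g' \- g)); last first.
  by apply/funext => x /=; rewrite opprD addrACA.
apply: le_lt_trans (sqnD_le m ltr01 _ _) _.
- by apply: cmeasB => //; exact: F_cmeas.
- by apply: cmeasB => //; exact: F_cmeas.
rewrite invr1 -[1 + 1]/(2%:R).
have -> : e%:E = (2%:E * (e / 4)%:E + 2%:E * (e / 4)%:E)%E.
  by rewrite -!EFinM -EFinD; congr EFin; field.
by rewrite lteD// lte_pmul2l.
Qed.

Lemma approximableZ (a : R[i]) f : cmeas f -> approximable f -> approximable (fun x => a * f x).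
Proof.
move=> mf af e e0; have a0 : 0 < abs2 a + 1 by rewrite ltr_wpDl ?abs2_ge0.
have [g Fg ge] := af (e / (abs2 a + 1)) (divr_gt0 e0 a0).
exists (fun x => a * g x); first exact: FZ.
rewrite (_ : _ \- _ = (fun x => a * (g \- f) x)); last first.
  by apply/funext => x /=; rewrite mulrBr.
have mgf : cmeas (g \- f) by apply: cmeasB => //; exact: F_cmeas.
apply: le_lt_trans (sqnM_le m (K := abs2 a + 1) mgf (cmeas_cst a) _) _.
  by move=> _; rewrite lerDl.
have -> : e%:E = ((abs2 a + 1)%:E * (e / (abs2 a + 1))%:E)%E.
  by rewrite -EFinM mulrC divfK// gt_eqF.
by rewrite lte_pmul2l// lte_fin.
Qed.

Lemma approximable_lim h : cmeas h -> (forall e : R, 0 < e ->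
    exists f, [/\ cmeas f, approximable f & (sqn m (f \- h)%R < e%:E)%E]) -> approximable h.
Proof.
move=> mh H e e0; have e4 : 0 < e / 4 by rewrite divr_gt0.
have [f [mf af fe]] := H _ e4; have [g Fg ge] := af _ e4.
exists g => //; have mg := F_cmeas Fg.
rewrite (_ : _ \- _ = (g \- f) \+ (f \- h)); last first.
  by apply/funext => x /=; rewrite subrKA.
apply: le_lt_trans (sqnD_le m ltr01 _ _) _; [exact: cmeasB..|].
rewrite invr1 -[1 + 1]/(2%:R).
have -> : e%:E = (2%:E * (e / 4)%:E + 2%:E * (e / 4)%:E)%E.
  by rewrite -!EFinM -EFinD; congr EFin; field.
by rewrite lteD// lte_pmul2l.
Qed.

Lemma approximable_cvg (g : nat -> T -> R[i]) h : cmeas h -> (forall n, cmeas (g n)) ->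
  (forall n, approximable (g n)) -> sqn m (g n \- h) @[n --> \oo] --> 0%E -> approximable h.
Proof.
move=> mh mg ag gh; apply: approximable_lim => // e e0.
have [N _ /(_ N (leqnn N)) Ne] := ecvg0_lt gh e0.
by exists (g N).
Qed.

Hypothesis F0 : F (fun=> 0).

Lemma approximable_F f : F f -> approximable f.
Proof.
move=> Ff e e0; exists f => //.
by rewrite /sqn integral0_eq ?lte_fin// => x _ /=; rewrite subrr abs2_0.
Qed.

Lemma approximable_sum I (s : seq I) (f : I -> T -> R[i]) : (forall i, cmeas (f i)) ->
  (forall i, approximable (f i)) -> approximable (fun x => \sum_(i <- s) f i x).
Proof.
move=> mf af; elim: s => [|i s IH].
  rewrite (_ : (fun _ => _) = fun=> 0); first exact: approximable_F.
  by apply/funext => x; rewrite big_nil.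
rewrite (_ : (fun _ => _) = f i \+ (fun x => \sum_(j <- s) f j x)).
  by apply: approximableD => //; exact: cmeas_sum.
by apply/funext => x; rewrite big_cons.
Qed.

Definition cindic (A : set T) : T -> R[i] := fun x => ((\1_A x)%:C)%C.

Hypothesis m_fin : (m setT < +oo)%E.

Lemma L2_bounded f (K : R) : cmeas f -> (forall x, abs2 (f x) <= K) -> L2 m f.
Proof.
move=> mf fK; split => //.
apply: (@le_lt_trans _ _ (\int[m]_x K%:E)%E); last first.
  have K0 : 0 <= K by exact: le_trans (abs2_ge0 (f point)) (fK point).
  by rewrite integral_cst// lte_mul_pinfty.
apply: ge0_le_integral => //.
- by move=> x _; rewrite lee_fin abs2_ge0.
- exact: emeasurable_abs2.
- by move=> x _; rewrite lee_fin.
Qed.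

Section generators.
Variable G : set (set T).
Hypothesis GE : @measurable _ T = <<s G >>.
Hypothesis GI : setI_closed G.
Hypothesis GT : approximable (cindic setT).
Hypothesis GA : forall A, G A -> approximable (cindic A).

(** Approximable sets form a lambda-system: disjoint unions are monotone limits of
    finite ones, and the truncation to [B n] below is the partial union. *)
Lemma approximable_cindic A : measurable A -> approximable (cindic A).
Proof.
rewrite GE; apply: (dynkin_induction (P := fun A => approximable (cindic A)) GE GI) => //.
- move=> S mS aS; rewrite (_ : cindic _ =
      cindic setT \+ (fun x => (-1) * cindic S x)); last first.
    apply/funext => x; rewrite /cindic /= !indicE in_setT in_setC.
    by case: (x \in S); rewrite /= mulN1r ?subrr// oppr0 addr0.
  apply: approximableD => //; first exact: cmeas_indic.
  + by apply: cmeasM; [exact: cmeas_cst|exact: cmeas_indic].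
  + by apply: approximableZ => //; exact: cmeas_indic.
- move=> E mE tE aE; have mU : measurable (\bigcup_k E k) by exact: bigcupT_measurable.
  pose U n := \bigcup_(k < n) E k.
  have mUn n : measurable (U n) by exact: bigcup_measurable.
  pose B n := U n `|` ~` (\bigcup_k E k).
  have mB n : measurable (B n) by apply: measurableU => //; exact: measurableC.
  apply: (approximable_cvg (g := fun n => trunc (B n) (cindic (\bigcup_k E k)))).
  + exact: cmeas_indic.
  + by move=> n; apply: cmeas_trunc => //; exact: cmeas_indic.
  + move=> n; rewrite (_ : trunc _ _ = cindic (U n)); last first.
      apply/funext => x; rewrite truncE /cindic !indicE.
      have [xU|xU] := pselect (U n x).
        rewrite [x \in B n]mem_set; last by left.
        by rewrite !mem_set//; case: xU => k _ ?; exists k.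
      rewrite [x \in U n]memNset//; case: ifPn => //; rewrite inE => -[//|xE].
      by rewrite memNset.
    elim: n => [|n IH].
      rewrite (_ : cindic _ = fun=> 0); first exact: approximable_F.
      by apply/funext => x; rewrite /cindic indicE memNset// => -[].
    rewrite (_ : cindic _ = cindic (U n) \+ cindic (E n)).
      by apply: approximableD => //; exact: cmeas_indic.
    apply/funext => x; rewrite /cindic /= !indicE.
    have [xE|xE] := pselect (E n x).
      rewrite [x \in E n]mem_set// [x \in U n.+1]mem_set; last by exists n => /=.
      rewrite [x \in U n]memNset ?add0r// => -[k /= kn xk].
      have kE : k = n by apply: tE => //; exists x.
      by rewrite kE ltnn in kn.
    rewrite [x \in E n]memNset// addr0; congr (((nat_of_bool _)%:R)%:C)%C.
    apply/idP/idP; rewrite !inE => -[k /= kn xk].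
      exists k => //=; move: kn; rewrite ltnS leq_eqVlt => /predU1P[kn|//].
      by rewrite kn in xk.
    by exists k => //=; exact: ltnW.
  + apply: sqn_sub_trunc_cvg => //.
    * move=> x; have [[k _ Ekx]|xU] := pselect ((\bigcup_k E k) x).
        by exists k.+1 => // n /= kn; left; exists k.
      by apply: nearW => n; right.
    * apply: (@L2_bounded _ 1); first exact: cmeas_indic.
      by move=> x; rewrite abs2_real indicE; case: (x \in _); rewrite /= ?expr1n ?expr0n.
Qed.

Import HBNNSimple.

Lemma approximable_nonneg (u : T -> R) : measurable_fun setT u -> (forall x, 0 <= u x) ->
  L2 m (fun x => ((u x)%:C)%C) -> approximable (fun x => ((u x)%:C)%C).
Proof.
move=> mu u0 Lu; have /measurable_EFinP meu := mu.
pose s := nnsfun_approx measurableT meu.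
have ms n : measurable_fun setT (s n) by exact: measurable_funP.
have sE (x : T) : s n x @[n --> \oo] --> u x.
  have := @cvg_nnsfun_approx _ _ _ _ measurableT _ meu.
  move=> /(_ (fun y _ => _) x I) H.
  by apply: fine_cvg (H _) => y; rewrite lee_fin.
apply: (approximable_cvg (g := fun n x => ((s n x)%:C)%C)).
- exact: cmeas_real.
- by move=> n; exact: cmeas_real.
- move=> n; rewrite (_ : (fun _ => _) = (fun x => \sum_(y <- finmap.enum_fset (fset_set (range (s n))))
      (y%:C)%C * cindic (s n @^-1` [set y]) x)); last first.
    apply/funext => x; rewrite fimfunE fsbig_finite//= rmorph_sum.
    by apply: eq_bigr => y _; rewrite rmorphM.
  have mc y : cmeas (cindic (s n @^-1` [set y])) by exact: cmeas_indic.
  apply: approximable_sum => y; first by apply: cmeasM => //; exact: cmeas_cst.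
  by apply: approximableZ => //; exact: approximable_cindic.
- apply: (@dominated_sqn _ _ _ _ _ _ (fun x => abs2 ((u x)%:C)%C)).
  + by move=> n; exact: cmeas_real.
  + exact: cmeas_real.
  + by move=> x; split; [exact: sE|exact: cvg_cst].
  + exact: L2_integrable.
  + move=> n x.
    have sx : s n x <= u x.
      rewrite -(cvg_lim (@Rhausdorff _) (sE x)).
      apply: (@nondecreasing_cvgn_le _ (fun k => s k x)).
        by move=> i j ij; exact/lefP/nd_nnsfun_approx.
      by apply/cvg_ex; exists (u x).
    have s0 : 0 <= s n x by exact: fun_ge0.
    rewrite -rmorphB !abs2_real -[leLHS]sqrrN opprB ler_sqr ?nnegrE ?subr_ge0//.
    by rewrite gerBl.
Qed.

(** Dynkin's theorem turns approximability of the indicators of a generating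
    pi-system into density: the approximable functions form a closed
    subspace, so approximable sets are stable under complements and disjoint
    unions, and simple functions do the rest. *)
Theorem L2_dense_criterion h : L2 m h -> approximable h.
Proof.
move=> Lh; have [[m1 m2] _] := Lh.
have bnd (r : T -> R) : measurable_fun setT r -> L2 m (fun x => ((r x)%:C)%C) ->
    approximable (fun x => ((r x)%:C)%C).
  move=> mr Lr.
  have mabs : measurable_fun setT (fun x => `|r x|) by exact: measurableT_comp.
  have key (s : R) : s ^+ 2 = 1 -> approximable (fun x => (((`|r x| + s * r x) / 2)%:C)%C).
    move=> s1; have mw : measurable_fun setT (fun x => (`|r x| + s * r x) / 2).
      apply: measurable_funM => //; apply: measurable_funD => //.
      exact: measurable_funM.
    have s_norm : `|s| = 1.
      by apply/eqP; rewrite -sqrp_eq1 ?normr_ge0// real_normK ?num_real// s1.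
    have absE x : `|s * r x| = `|r x| by rewrite normrM s_norm mul1r.
    apply: approximable_nonneg => //.
      move=> x; rewrite divr_ge0// -absE -lerBlDr sub0r.
      by rewrite -normrN ler_norm.
    split; first exact: cmeas_real.
    apply: le_lt_trans Lr.2; apply: le_sqn; [exact: cmeas_real..|].
    move=> x; rewrite !abs2_real -[leRHS]real_normK ?num_real//.
    rewrite -[leLHS]real_normK ?num_real// ler_sqr ?nnegrE//.
    rewrite normrM [`|2^-1|]ger0_norm// ler_pdivrMr// (le_trans (ler_normD _ _))//.
    by rewrite absE normr_id mulr_natr mulr2n.
  rewrite (_ : (fun x => _) = (fun x => (((`|r x| + 1 * r x) / 2)%:C)%C) \+
     (fun x => (-1) * (((`|r x| + (-1) * r x) / 2)%:C)%C)); last first.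
    by apply/funext => x /=; rewrite mulN1r -rmorphB /=; congr (_%:C)%C; field.
  have mw s : cmeas (fun x => (((`|r x| + s * r x) / 2)%:C)%C).
    apply: cmeas_real; apply: measurable_funM => //; apply: measurable_funD => //.
    exact: measurable_funM.
  apply: approximableD => //.
  - by apply: cmeasM => //; exact: cmeas_cst.
  - by apply: key; rewrite expr1n.
  - by apply: approximableZ => //; apply: key; rewrite sqrrN expr1n.
have Lr : L2 m (fun x => ((complex.Re (h x))%:C)%C).
  split; first exact: cmeas_real.
  apply: le_lt_trans Lh.2; apply: le_sqn; [exact: cmeas_real|by []|].
  by move=> x; rewrite abs2_real Re_sqr_le.
have Li : L2 m (fun x => ((complex.Im (h x))%:C)%C).
  split; first exact: cmeas_real.
  apply: le_lt_trans Lh.2; apply: le_sqn; [exact: cmeas_real|by []|].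
  by move=> x; rewrite abs2_real Im_sqr_le.
rewrite (_ : h = (fun x => ((complex.Re (h x))%:C)%C) \+
   (fun x => Complex 0 1 * ((complex.Im (h x))%:C)%C)); last first.
  by apply/funext => x /=; rewrite [LHS]complexE.
apply: approximableD.
- exact: cmeas_real.
- by apply: cmeasM; [exact: cmeas_cst|exact: cmeas_real].
- exact: bnd.
- by apply: approximableZ; [exact: cmeas_real|exact: bnd].
Qed.

End generators.
End approximation.

(** * Lebesgue measure under affine maps *)

Section change_of_variables.
Context {R : realType}.
Local Open Scope ereal_scope.

Lemma ge0_integral_measure_preserving d1 d2 (X : measurableType d1)
    (Y : measurableType d2) (phi : X -> Y) (mu : {measure set X -> \bar R})
    (nu : {measure set Y -> \bar R}) (f : Y -> \bar R) :
  measurable_fun setT phi ->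
  (forall A, measurable A -> mu (phi @^-1` A) = nu A) ->
  measurable_fun setT f -> (forall y, 0 <= f y) ->
  \int[mu]_x f (phi x) = \int[nu]_y f y.
Proof.
move=> mphi munu mf f0.
have := ge0_integral_pushforward mphi mu measurableT mf (fun y _ => f0 y).
rewrite preimage_setT => <-; apply: eq_measure_integral => A mA _.
exact: munu.
Qed.

Local Notation mu := (@lebesgue_measure R).

Lemma measurable_addr (a : R) :
  measurable_fun setT ((fun x => x + a)%R : measurableTypeR R -> measurableTypeR R).
Proof. by apply: measurable_funD => //; exact: measurable_cst. Qed.

Lemma measurable_mull (a : R) :
  measurable_fun setT ((fun x => a * x)%R : measurableTypeR R -> measurableTypeR R).
Proof. by apply: measurable_funM => //; exact: measurable_cst. Qed.

(** The translate of Lebesgue measure gives intervals their length, so that it is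
    Lebesgue measure by uniqueness. *)
Lemma lebesgue_integral_shift (a : R) (f : measurableTypeR R -> \bar R) :
  measurable_fun setT f -> (forall x, 0 <= f x) ->
  \int[mu]_x f (x + a)%R = \int[mu]_x f x.
Proof.
move=> mf f0.
apply: (ge0_integral_measure_preserving (measurable_addr a)) => // A mA.
have mphi := measurable_addr a.
pose nu_ := Measure.clone _ _ _ (pushforward mu
  ((fun x => x + a)%R : measurableTypeR R -> measurableTypeR R)) _.
pose nu := nu_ mphi.
suff H : forall A, measurable A -> mu A = nu A by exact/esym/H.
move=> {mA}A mA; apply: (@lebesgue_measure_unique R nu) => // _ [[x y] _ <-] /=.
rewrite /nu /= /pushforward (_ : _ @^-1` _ = `]x - a, y - a]%classic)%R; last first.
  apply/seteqP; split => z /=; rewrite !in_itv /=; lra.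
rewrite !lebesgue_measure_itv /= !lte_fin ltrD2r.
by case: ifPn => // _; rewrite -!EFinB; congr EFin; ring.
Qed.

Lemma lebesgue_integral_scale (a : R) (f : measurableTypeR R -> \bar R) :
  (a != 0)%R -> measurable_fun setT f -> (forall x, 0 <= f x) ->
  `|a|%:E * \int[mu]_x f (a * x)%R = \int[mu]_x f x.
Proof.
wlog a0 : a f / (0 < a)%R.
  move=> H an0 mf f0; have [a0|a0|a0] := ltgtP 0%R a.
  - exact: H.
  - have mfN : measurable_fun setT (fun x : measurableTypeR R => f (- x)%R).
      by apply: (measurableT_comp mf); exact: measurable_funN.
    have /= := H (- a)%R (fun x => f (- x)%R).
    rewrite oppr_gt0 oppr_eq0 normrN => /(_ a0 an0 mfN (fun=> f0 _)).
    under eq_integral do rewrite mulNr opprK.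
    move=> ->; apply: ge0_integral_measure_preserving => //.
    exact: lebesgue_measureN.
  - by rewrite a0 eqxx in an0.
move=> _ mf f0; have mphi := measurable_mull a.
rewrite gtr0_norm//.
have a0' : (0 <= a)%R by exact: ltW.
pose nu_ := Measure.clone _ _ _ (pushforward mu
  ((fun x => a * x)%R : measurableTypeR R -> measurableTypeR R)) _.
pose nu := nu_ mphi.
pose nu' := Measure.clone _ _ _ (mscale (NngNum a0') nu) _.
have nuE A : measurable A -> mu A = nu' A.
  apply: (@lebesgue_measure_unique R nu') => // _ [[x y] _ <-] /=.
  rewrite /nu' /mscale /= /pushforward (_ : _ @^-1` _ = `]x / a, y / a]%classic)%R;
    last first.
    apply/seteqP; split => z /=; rewrite !in_itv /=.
      by rewrite ltr_pdivrMr// ler_pdivlMr// ![(_ * a)%R]mulrC.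
    by rewrite ltr_pdivrMr// ler_pdivlMr// ![(_ * a)%R]mulrC.
  rewrite !lebesgue_measure_itv /= !lte_fin ltr_pM2r ?invr_gt0//.
  case: ifPn => // _; last by rewrite mule0.
  by rewrite -!EFinB -EFinM; congr EFin; field; rewrite gt_eqF.
rewrite [RHS](eq_measure_integral nu'); last by move=> A mA _; exact: nuE.
rewrite ge0_integral_mscale//=; congr (_ * _).
by apply: ge0_integral_measure_preserving.
Qed.

End change_of_variables.

Section measurable_columns.
Context {R : realType}.

Lemma measurable_coord (n : nat) (i : 'I_n) :
  measurable_fun setT (fun x : 'cV[R]_n => x i ord0).
Proof. exact: measurable_cV_coord. Qed.

Lemma measurable_shift_cV (n : nat) (a : 'cV[R]_n) :
  measurable_fun setT (fun x : 'cV[R]_n => x + a).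
Proof.
apply: measurable_fun_cVP => i.
apply: (@eq_measurable_fun _ _ _ _ _ (fun x : 'cV[R]_n => x i ord0 + a i ord0)).
  by move=> x _; rewrite mxE.
by apply: measurable_funD; [exact: measurable_coord|exact: measurable_cst].
Qed.

Lemma measurable_mulmx (n p : nat) (A : 'M[R]_(p, n)) :
  measurable_fun setT (fun x : 'cV[R]_n => A *m x).
Proof.
apply: measurable_fun_cVP => i.
apply: (@eq_measurable_fun _ _ _ _ _ (fun x : 'cV[R]_n => \sum_j A i j * x j ord0)).
  by move=> x _; rewrite mxE.
apply: measurable_sum => j; apply: measurable_funM; first exact: measurable_cst.
exact: measurable_coord.
Qed.

Lemma measurable_dot d (T : measurableType d) (n : nat) (u v : T -> 'cV[R]_n) :
  measurable_fun setT u -> measurable_fun setT v ->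
  measurable_fun setT (fun x => dot (u x) (v x)).
Proof.
move=> mu mv; apply: measurable_sum => j; apply: measurable_funM.
- exact: (measurableT_comp (measurable_coord j) mu).
- exact: (measurableT_comp (measurable_coord j) mv).
Qed.

Lemma uncons_cVK (n : nat) : cancel (@uncons_cV R n) (@cons_cV R n).
Proof.
move=> x; rewrite /cons_cV /= -[RHS](vsubmxK (x : 'cV_(1 + n))).
suff -> : const_mx (x ord0 ord0) = usubmx (x : 'cV_(1 + n)) by [].
by apply/matrixP => i j; rewrite !mxE !ord1; congr (x _ _); exact: val_inj.
Qed.

Lemma cons_cVD (n : nat) (p : R * 'cV[R]_n) (x : 'cV[R]_n.+1) :
  cons_cV p + x = cons_cV (p.1 + (uncons_cV x).1, p.2 + (uncons_cV x).2).
Proof.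
rewrite -{1}(uncons_cVK x) /cons_cV /= [LHS](@add_col_mx _ 1 n 1).
suff -> : const_mx (p.1 + x ord0 ord0) =
  const_mx p.1 + const_mx (x ord0 ord0) :> 'cV[R]_1 by [].
by apply/matrixP => i j; rewrite !mxE.
Qed.

End measurable_columns.

Section lebesgue_columns.
Context {R : realType}.
Local Open Scope ereal_scope.
Local Notation mu := (@lebesgue_measure R).

Lemma cV0_eq (x y : 'cV[R]_0) : x = y.
Proof. by apply/matrixP => -[]. Qed.

Lemma lebesgue_cVS_integral (n : nat) (f : 'cV[R]_n.+1 -> \bar R) :
  measurable_fun setT f -> (forall x, 0 <= f x) ->
  \int[lebesgue_cV n.+1]_x f x =
  \int[mu]_s \int[lebesgue_cV n]_v f (cons_cV (s, v)).
Proof.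
move=> mf f0.
have mc := @measurable_cons_cV R n.
have mp A : measurable A ->
  (mu \x lebesgue_cV n) (@cons_cV R n @^-1` A) = lebesgue_cV n.+1 A by [].
rewrite -(ge0_integral_measure_preserving mc mp)//.
rewrite (fubini_tonelli1 (f \o @cons_cV R n))//.
  exact: (measurableT_comp mf mc).
by move=> x; exact: f0.
Qed.

Lemma lebesgue_cVS_integral_swap (n : nat) (f : 'cV[R]_n.+1 -> \bar R) :
  measurable_fun setT f -> (forall x, 0 <= f x) ->
  \int[lebesgue_cV n.+1]_x f x =
  \int[lebesgue_cV n]_v \int[mu]_s f (cons_cV (s, v)).
Proof.
move=> mf f0; rewrite lebesgue_cVS_integral//.
rewrite (fubini_tonelli (f \o @cons_cV R n))//.
  by apply: (measurableT_comp mf); exact: measurable_cons_cV.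
by move=> x; exact: f0.
Qed.

Lemma measurable_cons_cVl (n : nat) (v : 'cV[R]_n) :
  measurable_fun setT (fun s : measurableTypeR R => cons_cV (s, v)).
Proof.
apply: (measurableT_comp (@measurable_cons_cV R n)).
exact: pair2_measurable.
Qed.

Lemma measurable_cons_cVr (n : nat) (s : measurableTypeR R) :
  measurable_fun setT (fun v : 'cV[R]_n => cons_cV (s, v)).
Proof.
apply: (measurableT_comp (@measurable_cons_cV R n)).
exact: pair1_measurable.
Qed.

(** Induction on the dimension: Tonelli's theorem isolates one coordinate at a time. *)
Lemma lebesgue_cV_shift (n : nat) (a : 'cV[R]_n) (f : 'cV[R]_n -> \bar R) :
  measurable_fun setT f -> (forall x, 0 <= f x) ->
  \int[lebesgue_cV n]_x f (x + a)%R = \int[lebesgue_cV n]_x f x.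
Proof.
elim: n a f => [|n IH] a f mf f0.
  by apply: eq_integral => x _; congr f; exact: cV0_eq.
rewrite lebesgue_cVS_integral//; last first.
  by apply: (measurableT_comp mf); exact: measurable_shift_cV.
under eq_integral => s _.
  under eq_integral do rewrite cons_cVD /=.
  rewrite (IH _ (fun v => f (cons_cV ((s + (uncons_cV a).1)%R, v))))//; last first.
    by apply: (measurableT_comp mf); exact: measurable_cons_cVr.
  over.
rewrite (lebesgue_integral_shift _ (f := fun s =>
   \int[lebesgue_cV n]_v f (cons_cV (s, v)))); first by rewrite lebesgue_cVS_integral.
  apply: (measurable_fun_fubini_tonelli_F (f \o @cons_cV R n)) => [|x]; last exact: f0.
  by apply: (measurableT_comp mf); exact: measurable_cons_cV.
by move=> s; apply: integral_ge0 => *; exact: f0.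
Qed.

(** Linear change of variables, as a property of the matrix, so that it can be
    transported along products of matrices. *)
Definition linear_change (n : nat) (A : 'M[R]_n) := forall f : 'cV[R]_n -> \bar R,
  measurable_fun setT f -> (forall x, 0 <= f x) ->
  `|\det A|%:E * \int[lebesgue_cV n]_x f (A *m x)%R = \int[lebesgue_cV n]_x f x.

Lemma linear_changeM (n : nat) (A B : 'M[R]_n) :
  linear_change A -> linear_change B -> linear_change (A *m B).
Proof.
move=> HA HB f mf f0; rewrite det_mulmx normrM EFinM -muleA.
under eq_integral do rewrite -mulmxA.
rewrite (HB (fun x => f (A *m x)%R)) ?HA//.
by apply: (measurableT_comp mf); exact: measurable_mulmx.
Qed.

Lemma mul_block_cons (n : nat) (a : R) (u : 'rV[R]_n) (v : 'cV[R]_n)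
    (B : 'M[R]_n) (p : R * 'cV[R]_n) :
  (block_mx (a%:M : 'M[R]_1) u v B *m cons_cV p =
  cons_cV (a * p.1 + (u *m p.2) ord0 ord0, p.1 *: v + B *m p.2))%R.
Proof.
rewrite /cons_cV [LHS](@mul_block_col _ 1 n 1 n 1) /=; congr (col_mx _ _).
  by apply/matrixP => i j; rewrite !ord1 mul_scalar_mx !mxE.
congr (_ + _)%R; apply/matrixP => i j.
by rewrite !mxE big_ord1 !mxE !ord1 mulrC.
Qed.

(** Integrating the last coordinates first turns the column [v] into a translation,
    and the pivot into a scaling of the first coordinate. *)
Lemma linear_change_lblock (n : nat) (a : R) (v : 'cV[R]_n) (B : 'M[R]_n) :
  (a != 0)%R -> linear_change B ->
  linear_change (block_mx (a%:M : 'M[R]_1) 0 v B : 'M[R]_n.+1).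
Proof.
move=> a0 HB f mf f0.
rewrite lebesgue_cVS_integral//; last first.
  by apply: (measurableT_comp mf); exact: measurable_mulmx.
rewrite [X in `|X|%:E](@det_lblock _ 1 n) det_scalar expr1 normrM EFinM -muleA.
rewrite -ge0_integralZl//; last 2 first.
  apply: (measurable_fun_fubini_tonelli_F
    (fun p => f (block_mx (a%:M : 'M[R]_1) 0 v B *m cons_cV p)%R)) => //.
  apply: (measurableT_comp mf).
  apply: (measurableT_comp (@measurable_mulmx _ _ _ _)).
  exact: measurable_cons_cV.
- by move=> s _; apply: integral_ge0 => *; exact: f0.
under eq_integral => s _.
  under eq_integral do rewrite mul_block_cons mul0mx mxE addr0 addrC /=.
  rewrite (HB (fun w => f (cons_cV ((a * s)%R, (w + s *: v)%R))))//; last first.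
    apply: (measurableT_comp mf).
    apply: (measurableT_comp (measurable_cons_cVr _)).
    exact: measurable_shift_cV.
  rewrite (lebesgue_cV_shift _ (f := fun w => f (cons_cV ((a * s)%R, w))))//; last first.
    by apply: (measurableT_comp mf); exact: measurable_cons_cVr.
  over.
rewrite (lebesgue_integral_scale (f := fun s =>
   \int[lebesgue_cV n]_v f (cons_cV (s, v))))//; first by rewrite lebesgue_cVS_integral.
  apply: (measurable_fun_fubini_tonelli_F (f \o @cons_cV R n)) => [|x]; last exact: f0.
  by apply: (measurableT_comp mf); exact: measurable_cons_cV.
by move=> s; apply: integral_ge0 => *; exact: f0.
Qed.

(** Here the first coordinate is integrated first, and the row [u] is a translation. *)
Lemma linear_change_ublock (n : nat) (a : R) (u : 'rV[R]_n) (B : 'M[R]_n) :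
  (a != 0)%R -> linear_change B ->
  linear_change (block_mx (a%:M : 'M[R]_1) u 0 B : 'M[R]_n.+1).
Proof.
move=> a0 HB f mf f0.
rewrite lebesgue_cVS_integral_swap//; last first.
  by apply: (measurableT_comp mf); exact: measurable_mulmx.
rewrite [X in `|X|%:E](@det_ublock _ 1 n) det_scalar expr1 normrM EFinM.
rewrite [X in X * _]muleC -muleA -ge0_integralZl//; last 2 first.
  apply: (measurable_fun_fubini_tonelli_G
    (fun p => f (block_mx (a%:M : 'M[R]_1) u 0 B *m cons_cV p)%R)) => //.
  apply: (measurableT_comp mf).
  apply: (measurableT_comp (@measurable_mulmx _ _ _ _)).
  exact: measurable_cons_cV.
- by move=> s _; apply: integral_ge0 => *; exact: f0.
under eq_integral => w _.
  under eq_integral do rewrite mul_block_cons scaler0 add0r /=.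
  rewrite (lebesgue_integral_scale (f := fun s =>
    f (cons_cV ((s + (u *m w) ord0 ord0)%R, (B *m w)%R))))//; last first.
    apply: (measurableT_comp mf).
    apply: (measurableT_comp (measurable_cons_cVl _)).
    exact: measurable_addr.
  rewrite (lebesgue_integral_shift _ (f := fun s => f (cons_cV (s, (B *m w)%R))))//;
    last first.
    by apply: (measurableT_comp mf); exact: measurable_cons_cVl.
  over.
rewrite (HB (fun w => \int[mu]_s f (cons_cV (s, w))))//.
- by rewrite lebesgue_cVS_integral_swap.
- apply: (measurable_fun_fubini_tonelli_G (f \o @cons_cV R n)) => [|x]; last exact: f0.
  by apply: (measurableT_comp mf); exact: measurable_cons_cV.
- by move=> s; apply: integral_ge0 => *; exact: f0.
Qed.

Lemma linear_change1 (n : nat) : linear_change (1%:M : 'M[R]_n).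
Proof.
by move=> f mf f0; rewrite det1 normr1 mul1e; under eq_integral do rewrite mul1mx.
Qed.

(** Gaussian elimination with a single pivot: adding a suitable row to the first
    one makes the pivot nonzero, and what remains is a product of a lower and an
    upper block triangular matrix. *)
Theorem linear_change_unitmx (n : nat) (A : 'M[R]_n) : A \in unitmx -> linear_change A.
Proof.
elim: n A => [|n IH] A uA.
  move=> f mf f0; rewrite det_mx00 normr1 mul1e.
  by apply: eq_integral => x _; congr f; exact: cV0_eq.
have pivot (M : 'M[R]_n.+1) : (M ord0 ord0 != 0)%R -> M \in unitmx -> linear_change M.
  move=> M0 uM; pose M' : 'M[R]_(1 + n) := M.
  pose a := M ord0 ord0; pose u := ursubmx M'; pose v := dlsubmx M'.
  pose B := drsubmx M'.
  have ME : M = (block_mx (1%:M : 'M[R]_1) 0 (a^-1 *: v)%R 1%:M : 'M[R]_(1 + n)) *m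
      (block_mx (a%:M : 'M[R]_1) u 0 (B - a^-1 *: (v *m u))%R : 'M[R]_(1 + n)).
    rewrite mulmx_block !mul1mx !mul0mx !addr0 mul_mx_scalar scalerA.
    rewrite divff// scale1r -scalemxAl addrC subrK -[LHS](submxK M').
    suff -> : ulsubmx M' = a%:M by [].
    apply/matrixP => i j; rewrite !mxE !ord1 eqxx mulr1n /a.
    by congr (M _ _); exact: val_inj.
  have uB : (B - a^-1 *: (v *m u))%R \in unitmx.
    move: uM; rewrite !unitmxE {1}ME det_mulmx unitrM => /andP[_].
    by rewrite (@det_ublock _ 1 n) unitrM => /andP[].
  rewrite ME; apply: linear_changeM.
    by apply: linear_change_lblock; [exact: oner_neq0|exact: linear_change1].
  by apply: linear_change_ublock => //; exact: IH.
have [A0|A0] := eqVneq (A ord0 ord0) 0%R; last exact: pivot.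
have [i Ai0] : exists i, A (rshift 1 i : 'I_(1 + n)) ord0 != 0%R.
  apply: contrapT => H; have Acol i : A i ord0 = 0%R.
    have [j|j] := split_ordP (i : 'I_(1 + n)) => ->.
      by rewrite -[RHS]A0; congr (A _ _); apply: val_inj; rewrite !ord1.
    by apply/eqP; apply: contrapT => /negP Aj; apply: H; exists j.
  move: uA; rewrite unitmxE (expand_det_col _ ord0) big1 ?unitr0// => j _.
  by rewrite Acol mul0r.
pose e : 'rV[R]_n := delta_mx ord0 i.
pose E (s : R) : 'M[R]_(1 + n) := block_mx (1%:M : 'M[R]_1) (s *: e) 0 1%:M.
have EK : E (-1)%R *m E 1%R = 1%:M.
  rewrite mulmx_block !mul1mx !mul0mx ?mulmx0 ?mulmx1 ?addr0 ?add0r.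
  by rewrite scaleN1r scale1r subrr -scalar_mx_block.
have AE : A = E (-1)%R *m (E 1%R *m A) by rewrite mulmxA EK mul1mx.
rewrite AE; apply: linear_changeM.
  by apply: linear_change_ublock; [exact: oner_neq0|exact: linear_change1].
apply: pivot; last first.
  by move: uA; rewrite {1}AE !unitmxE det_mulmx unitrM => /andP[].
suff -> : (E 1%R *m A) ord0 ord0 = A (rshift 1 i : 'I_(1 + n)) ord0 by [].
have l0 : (ord0 : 'I_(1 + n)) = lshift n ord0 by exact: val_inj.
rewrite mxE (@big_split_ord _ _ _ 1 n) big_ord1 -l0 A0 mulr0. rewrite Monoid.mul1m.
rewrite (bigD1 i)//= big1 ?addr0.
  by rewrite {1}l0 block_mxEur scale1r mxE !eqxx mul1r.
move=> j /negPf ji; rewrite {1}l0 block_mxEur scale1r mxE ji andbF.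
by rewrite mul0r.
Qed.

End lebesgue_columns.

(** * Boxes, open sets and cubes *)

Section boxes.
Context {R : realType}.
Local Notation mu := (@lebesgue_measure R).

Definition box (n : nat) (B : 'I_n -> set (measurableTypeR R)) : set 'cV[R]_n :=
  [set x | forall i, B i (x i ord0)].

Lemma measurable_box n (B : 'I_n -> set (measurableTypeR R)) :
  (forall i, measurable (B i)) -> measurable (box B).
Proof.
move=> mB; rewrite (_ : box B = \bigcap_(i in [set: 'I_n])
  (fun x : 'cV[R]_n => x i ord0) @^-1` B i); last first.
  by apply/seteqP; split => [x xB i _|x xB i]; [exact: xB|exact: (xB i I)].
apply: fin_bigcap_measurable => // i _; rewrite -[X in measurable X]setTI.
exact: (measurable_coord i measurableT (mB i)).
Qed.

Lemma cons_cV_ord0 n (s : R) (v : 'cV[R]_n) : cons_cV (s, v) ord0 ord0 = s.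
Proof. by have /(congr1 fst) := cons_cVK (s, v). Qed.

Lemma cons_cV_lift n (s : R) (v : 'cV[R]_n) i :
  cons_cV (s, v) (lift ord0 i) ord0 = v i ord0.
Proof.
have -> : lift ord0 i = rshift 1 i :> 'I_(1 + n) by exact: val_inj.
by rewrite /cons_cV [LHS](col_mxEd (const_mx s : 'cV[R]_1)).
Qed.

Lemma lebesgue_box n (B : 'I_n -> set (measurableTypeR R)) :
  (forall i, measurable (B i)) ->
  (lebesgue_cV n (box B) = \prod_(i < n) mu (B i))%E.
Proof.
elim: n B => [|n IH] B mB.
  rewrite big_ord0 /= (_ : box B = setT) ?diracT//.
  by apply/seteqP; split => // x _ [].
rewrite big_ord_recl -(IH (fun i => B (lift ord0 i)))// -product_measure1E//;
  last exact: measurable_box.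
rewrite -[LHS]/((mu \x lebesgue_cV n)%E (@cons_cV R n @^-1` box B)).
suff -> : @cons_cV R n @^-1` box B = B ord0 `*` box (fun i => B (lift ord0 i)) by [].
apply/seteqP.
split => -[s v] /=.
  move=> H; split => [|i]; first by have := H ord0; rewrite cons_cV_ord0.
  by have := H (lift ord0 i); rewrite cons_cV_lift.
move=> [Hs Hv] i; have [->|[j ->]] : i = ord0 \/ exists j, i = lift ord0 j.
  by case: (unliftP ord0 i) => [j ->|->]; [right; exists j|left].
- by rewrite cons_cV_ord0.
- by rewrite cons_cV_lift; exact: Hv.
Qed.

(** The sigma-algebra is generated by coordinates: an open set is the countable union
    of the boxes with rational data that it contains. *)
Lemma open_measurable_cV n (U : set 'cV[R]_n) : open U -> measurable U.
Proof.
move=> oU.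
pose ratbox (p : 'cV[rat]_n * rat) := box (fun i =>
  `]ratr (p.1 i ord0) - ratr p.2, ratr (p.1 i ord0) + ratr p.2[%classic : set R).
rewrite (_ : U = \bigcup_p (if `[< ratbox p `<=` U >] then ratbox p else set0)).
  apply: countable_bigcupT_measurable => // p; case: ifPn => // _.
  by apply: measurable_box => i; exact: measurable_itv.
apply/seteqP; split; last by move=> x [p _]; case: asboolP => // H; exact: H.
move=> x Ux; have /nbhs_ballP[/= e e0 xeU] : nbhs x U by apply: open_nbhs_nbhs.
have [r] := rat_in_itvoo (divr_gt0 e0 (ltr0n R 2)).
rewrite in_itv /= => /andP[r0 re].
have near_rat (i : 'I_n) : exists q : rat,
    x i ord0 - ratr r < ratr q < x i ord0 + ratr r.
  have xr : x i ord0 - ratr r < x i ord0 + ratr r by rewrite ltrD2l gtrN.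
  have [q] := rat_in_itvoo xr.
  by rewrite in_itv /=; exists q.
have [q qP] := choice near_rat.
exists (\col_i q i, r) => //; case: asboolP => [_|].
  by move=> i /=; rewrite in_itv /= mxE; have /andP[? ?] := qP i; lra.
case => y yB; apply: xeU; split => // i j; rewrite ord1.
have := yB i; rewrite /ball /= in_itv /= mxE; have /andP[? ?] := qP i.
by move=> /andP[? ?]; rewrite ltr_norml; apply/andP; split; lra.
Qed.

Lemma lebesgue_box_gt0 n (x : 'cV[R]_n) (e : R) : 0 < e ->
  (0 < lebesgue_cV n
    (box (fun i => (`]x i ord0 - e, x i ord0 + e[%classic : set R)%R)))%E.
Proof.
move=> e0; rewrite lebesgue_box; last by move=> i; exact: measurable_itv.
elim/big_ind : _ => //; first exact: mule_gt0.
move=> i _; rewrite lebesgue_measure_itv /= lte_fin ltrD2l gtrN//.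
by rewrite -EFinB lte_fin; lra.
Qed.

Lemma open_lebesgue_gt0 n (U : set 'cV[R]_n) : open U -> U !=set0 ->
  (0 < lebesgue_cV n U)%E.
Proof.
move=> oU [x Ux]; have /nbhs_ballP[/= e e0 xeU] : nbhs x U by apply: open_nbhs_nbhs.
apply: (lt_le_trans (lebesgue_box_gt0 x e0)); apply: le_measure.
- by rewrite inE; apply: measurable_box => i; exact: measurable_itv.
- by rewrite inE; exact: open_measurable_cV.
- move=> y yB; apply: xeU; split => // i j; rewrite ord1.
  have := yB i; rewrite /ball /= in_itv /= => /andP[H1 H2].
  by rewrite distrC ltr_distl H1 H2.
Qed.

Lemma compact_lebesgue_lty n (K : set 'cV[R]_n) : compact K ->
  measurable K /\ (lebesgue_cV n K < +oo)%E.
Proof.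
move=> cK; have mK : measurable K.
  rewrite -[K]setCK; apply: measurableC; apply: open_measurable_cV.
  by rewrite openC; apply: compact_closed => //; exact: norm_hausdorff.
split => //; have [M [_ MK]] := compact_bounded cK.
pose N := `|M| + 1.
pose B := box (fun i : 'I_n => `]- (N + 1), N + 1[%classic : set R).
have mB : measurable B by apply: measurable_box => i; exact: measurable_itv.
apply: (@le_lt_trans _ _ (lebesgue_cV n B)).
  apply: le_measure; rewrite ?inE// => x Kx i.
  have MN : M < N by rewrite ltr_pwDr// ler_norm.
  have xN := MK _ MN x Kx.
  have /= [_ /(_ i ord0)] : ball (0 : 'cV[R]_n) (N + 1) x.
    rewrite mx_norm_ball /ball_ /= sub0r normrN.
    by apply: le_lt_trans xN _; rewrite ltrDl.
  rewrite /ball /= mxE sub0r normrN ltr_norml in_itv /=.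
  by rewrite /N; lra.
rewrite lebesgue_box; last by move=> i; exact: measurable_itv.
suff /andP[//] : (0 <= \prod_(i < n) mu `](- (N + 1))%R, (N + 1)%R[%classic < +oo)%E.
elim/big_ind : _ => [|a b /andP[a0 ao] /andP[b0 bo]|i _].
- by rewrite lee_fin ler01 ltry.
- by rewrite mule_ge0// lte_mul_pinfty// ge0_fin_numE.
- by rewrite measure_ge0 lebesgue_measure_itv /=; case: ifP => // _; rewrite -EFinB ltry.
Qed.

Definition cube (n : nat) : set 'cV[R]_n :=
  box (fun=> `[- 2^-1, 2^-1[%classic : set R).

#[global] Arguments cube n : clear implicits.

Definition closed_cube (n : nat) : set 'cV[R]_n :=
  box (fun=> `[- 2^-1, 2^-1]%classic : set R).

#[global] Arguments closed_cube n : clear implicits.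

Lemma measurable_cube n : measurable (cube n).
Proof. by apply: measurable_box => i; exact: measurable_itv. Qed.

Lemma measurable_closed_cube n : measurable (closed_cube n).
Proof. by apply: measurable_box => i; exact: measurable_itv. Qed.

Lemma lebesgue_cube n : lebesgue_cV n (cube n) = 1%E.
Proof.
rewrite lebesgue_box; last by move=> i; exact: measurable_itv.
rewrite big1// => i _; rewrite lebesgue_measure_itv /= lte_fin.
by rewrite ifT; [rewrite -EFinB; congr EFin; field|lra].
Qed.

Lemma lebesgue_closed_cube n : lebesgue_cV n (closed_cube n) = 1%E.
Proof.
rewrite lebesgue_box; last by move=> i; exact: measurable_itv.
rewrite big1// => i _; rewrite lebesgue_measure_itv /= lte_fin.
by rewrite ifT; [rewrite -EFinB; congr EFin; field|lra].
Qed.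

Lemma cube_closed_cube n : cube n `<=` closed_cube n.
Proof. by move=> x xQ i; have := xQ i; rewrite /= !in_itv /= => /andP[-> /ltW]. Qed.

(** The closed and the half-open cube have the same measure. *)
Lemma lebesgue_closed_cube_boundary n :
  lebesgue_cV n (closed_cube n `\` cube n) = 0%E.
Proof.
have fin : (lebesgue_cV n (closed_cube n) < +oo)%E.
  by rewrite lebesgue_closed_cube ltry.
rewrite (measureD (@measurable_closed_cube n) (@measurable_cube n) fin).
rewrite setIidr; last exact: cube_closed_cube.
have := lebesgue_closed_cube n; rewrite /= => ->.
by have := lebesgue_cube n; rewrite /= => ->; rewrite subee.
Qed.

End boxes.
#[global] Arguments cube {R} n.
#[global] Arguments closed_cube {R} n.

(** * Integrals of cosines over the unit cube *)

Section restricted_measure.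
Context {R : realType} {d} {T : measurableType d} (m : {measure set T -> \bar R}).
Context (D : set T) (mD : measurable D) (finD : (m D < +oo)%E).

Local Open Scope ereal_scope.

Lemma integral_mrestr_in (f : T -> \bar R) :
  \int[mrestr m mD]_(x in D) f x = \int[m]_(x in D) f x.
Proof. by apply: eq_measure_integral => A mA AD; rewrite /= /mrestr (setIidl AD). Qed.

Lemma ge0_integral_mrestr (f : T -> \bar R) : measurable_fun setT f ->
  (forall x, 0 <= f x) -> \int[mrestr m mD]_x f x = \int[m]_(x in D) f x.
Proof.
move=> mf f0; rewrite -(setUv D) ge0_integral_setU//; last 3 first.
- exact: measurableC.
- by rewrite setUv.
- by rewrite disj_set2E setICr.
rewrite [X in _ + X](_ : _ = 0) ?adde0; last first.
  apply: null_set_integral => //; first exact: measurableC.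
    exact: measurable_funTS.
  by rewrite /= /mrestr setICl measure0.
exact: integral_mrestr_in.
Qed.

Definition restr_measure : {finite_measure set T -> \bar R} := mfrestr mD finD.

Lemma ge0_integral_restr (f : T -> \bar R) : measurable_fun setT f ->
  (forall x, 0 <= f x) -> \int[restr_measure]_x f x = \int[m]_(x in D) f x.
Proof. by move=> mf f0; rewrite -ge0_integral_mrestr. Qed.

Lemma integral_restr (f : T -> \bar R) : measurable_fun setT f ->
  \int[restr_measure]_x f x = \int[m]_(x in D) f x.
Proof.
move=> mf; rewrite [LHS]integralE [RHS]integralE.
rewrite ge0_integral_restr//; last exact: measurable_funepos.
by rewrite ge0_integral_restr//; exact: measurable_funeneg.
Qed.

Lemma restr_measure_setT : (restr_measure : {measure set T -> \bar R}) setT = m D.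
Proof. by rewrite /restr_measure /= /mfrestr /mrestr setTI. Qed.

Lemma restr_measure_lty : (restr_measure : {measure set T -> \bar R}) setT < +oo.
Proof. by rewrite restr_measure_setT. Qed.

Lemma ae_restr_measure : {ae restr_measure, forall x, D x}.
Proof.
exists (~` D); split => //; first exact: measurableC.
by rewrite /restr_measure /= /mfrestr /mrestr setICl measure0.
Qed.

Lemma sqn_restr (f : T -> R[i]) : cmeas f -> sqn restr_measure f = sqn m (trunc D f).
Proof.
move=> mf; rewrite /sqn ge0_integral_restr//; last 2 first.
- exact: emeasurable_abs2.
- by move=> x; rewrite lee_fin abs2_ge0.
rewrite integral_mkcond; apply: eq_integral => x _.
by rewrite /patch truncE; case: ifPn => // _; rewrite abs2_0.
Qed.

End restricted_measure.

Section cosine_integral.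
Context {R : realType}.
Local Notation mu := (@lebesgue_measure R).

Lemma derivable_primitive (w phi : R) (x : R) : w != 0 ->
  is_derive x 1 (fun s : R => s + sin (w * s + phi) / w) (1 + cos (w * x + phi)).
Proof.
move=> w0.
have H : is_derive x 1 ((sin : R -> R) \o (fun s => w * s + phi)) (cos (w * x + phi) * w).
  by apply: is_derive_eq; rewrite /GRing.scale /=; ring.
by apply: is_derive_eq; rewrite scaler0 add0r /GRing.scale /= mulrCA mulVf// mulr1.
Qed.

(** The sine in the primitive has the same value at both ends, by periodicity. *)
Lemma integral_1cos_itv (k : int) (phi : R) : k != 0 ->
  (\int[mu]_(s in `[(- 2^-1)%R, 2^-1%R[) (1 + cos (2 * pi * (k%:~R * s) + phi))%:E)%E = 1%E.
Proof.
move=> k0; pose w : R := 2 * pi * k%:~R.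
have w0 : w != 0 by rewrite !mulf_neq0// ?intr_eq0// gt_eqF// pi_gt0.
pose F (s : R) := s + sin (w * s + phi) / w.
have dF x := derivable_primitive phi x w0.
have cF : continuous F.
  by move=> x; apply: differentiable_continuous; apply/derivable1_diffP; case: (dF x).
have H : (\int[mu]_(s in `[(- 2^-1)%R, 2^-1%R]) (1 + cos (w * s + phi))%:E)%E =
    ((F 2^-1)%:E - (F (- 2^-1))%:E)%E.
  apply: (@continuous_FTC2 R (fun s => 1 + cos (w * s + phi)) F).
  - lra.
  - apply: continuous_subspaceT => x; apply: cvgD; first exact: cvg_cst.
    apply: continuous_comp; last exact: continuous_cos.
    by apply: cvgD; [apply: cvgMr; exact: cvg_id|exact: cvg_cst].
  - split.
    + by move=> x _; case: (dF x).
    + exact/cvg_at_right_filter/cF.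
    + exact/cvg_at_left_filter/cF.
  - by move=> x _; rewrite derive1E; case: (dF x).
under eq_integral do rewrite mulrA -/w.
rewrite (_ : (\int[mu]_(s in _) _)%E =
   (\int[mu]_(s in `[(- 2^-1)%R, 2^-1%R]) (1 + cos (w * s + phi))%:E)%E); last first.
  apply: integral_itv_bndo_bndc; apply/measurable_EFinP; apply: measurable_funTS.
  apply: continuous_measurable_fun => x; apply: cvgD; first exact: cvg_cst.
  apply: continuous_comp; last exact: continuous_cos.
  apply: cvgD; last exact: cvg_cst.
  by apply: cvgMr; exact: cvg_id.
rewrite H -EFinB; congr EFin; rewrite /F.
have -> : w * 2^-1 + phi = w * - 2^-1 + phi + 2 * pi * k%:~R.
  by rewrite /w; field.
have /(congr1 (@complex.Im R)) := expiD (w * - 2^-1 + phi) (2 * pi * k%:~R).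
rewrite expi_int mulr1 /= => ->; field.
exact: w0.
Qed.

Lemma cube_cons n (s : R) (v : 'cV[R]_n) :
  cube n.+1 (cons_cV (s, v)) <-> `[- 2^-1, 2^-1[%classic s /\ cube n v.
Proof.
split=> [H|[Hs Hv] i].
  split=> [|i]; first by have := H ord0; rewrite cons_cV_ord0.
  by have := H (lift ord0 i); rewrite cons_cV_lift.
case: (unliftP ord0 i) => [j ->|->]; first by rewrite cons_cV_lift; exact: Hv.
by rewrite cons_cV_ord0.
Qed.

Lemma cube_integralS n (f : 'cV[R]_n.+1 -> \bar R) : measurable_fun setT f ->
    (forall x, (0 <= f x)%E) ->
  (\int[lebesgue_cV n.+1]_(x in cube n.+1) f x =
   \int[mu]_(s in `[(- 2^-1)%R, 2^-1%R[)
     \int[lebesgue_cV n]_(v in cube n) f (cons_cV (s, v)))%E.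
Proof.
move=> mf f0; rewrite integral_mkcond lebesgue_cVS_integral.
- rewrite [RHS]integral_mkcond; apply: eq_integral => s _.
  rewrite /patch; case: ifPn => sI.
    rewrite [RHS]integral_mkcond; apply: eq_integral => v _; rewrite /patch.
    suff -> : (cons_cV (s, v) \in cube n.+1) = (v \in cube n) by [].
    apply/idP/idP; rewrite !inE; first by move=> /cube_cons[].
    by move=> vQ; apply/cube_cons; split => //; rewrite inE in sI.
  rewrite integral0_eq// => v _; rewrite ifN//; apply: contra sI.
  by rewrite !inE => /cube_cons[].
- apply: (measurable_restrictT _ (@measurable_cube R _)).1.
  exact: measurable_funTS.
- by move=> x; rewrite /patch; case: ifPn.
Qed.

Lemma cube_integralS_swap n (f : 'cV[R]_n.+1 -> \bar R) : measurable_fun setT f ->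
    (forall x, (0 <= f x)%E) ->
  (\int[lebesgue_cV n.+1]_(x in cube n.+1) f x =
   \int[lebesgue_cV n]_(v in cube n)
     \int[mu]_(s in `[(- 2^-1)%R, 2^-1%R[) f (cons_cV (s, v)))%E.
Proof.
move=> mf f0; rewrite integral_mkcond lebesgue_cVS_integral_swap.
- rewrite [RHS]integral_mkcond; apply: eq_integral => v _.
  rewrite /patch; case: ifPn => vQ.
    rewrite [RHS]integral_mkcond; apply: eq_integral => s _; rewrite /patch.
    suff -> : (cons_cV (s, v) \in cube n.+1) = (s \in `[- 2^-1, 2^-1[%classic) by [].
    apply/idP/idP; rewrite !inE; first by move=> /cube_cons[].
    by move=> sI; apply/cube_cons; split => //; rewrite inE in vQ.
  rewrite integral0_eq// => s _; rewrite ifN//; apply: contra vQ.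
  by rewrite !inE => /cube_cons[].
- apply: (measurable_restrictT _ (@measurable_cube R _)).1.
  exact: measurable_funTS.
- by move=> x; rewrite /patch; case: ifPn.
Qed.

Definition intv n (k : 'cV[int]_n) : 'cV[R]_n := map_mx intr k.

Lemma measurable_1cos_dot n (l : 'cV[R]_n) phi :
  measurable_fun setT (fun x => (1 + cos (2 * pi * dot l x + phi))%:E).
Proof.
apply/measurable_EFinP; apply: measurable_funD; first exact: measurable_cst.
apply: (measurableT_comp (continuous_measurable_fun (@continuous_cos R))).
apply: measurable_funD; last exact: measurable_cst.
apply: measurable_funM; first exact: measurable_cst.
by apply: measurable_dot; [exact: measurable_cst|exact: measurable_id].
Qed.

Lemma cos1_ge0 (t : R) : 0 <= 1 + cos t.
Proof. by rewrite -lerBlDl sub0r cos_geN1. Qed.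

(** The constant [1] keeps the integrand nonnegative, so that Tonelli's theorem
    applies without any integrability condition. *)
Lemma integral_1cos_cube n (k : 'cV[int]_n) (phi : R) : k != 0 ->
  (\int[lebesgue_cV n]_(x in cube n)
     (1 + cos (2 * pi * dot (intv k) x + phi))%:E)%E = 1%E.
Proof.
elim: n k phi => [|n IH] k phi k0.
  by case/eqP: k0; apply/matrixP => -[].
pose k' : 'cV[int]_n := \col_i k (lift ord0 i) ord0.
have dotE (s : R) (v : 'cV[R]_n) : dot (intv k) (cons_cV (s, v)) =
    (k ord0 ord0)%:~R * s + dot (intv k') v.
  rewrite /dot big_ord_recl cons_cV_ord0 [intv k _ _]mxE; congr (_ + _).
  apply: eq_bigr => i _; rewrite cons_cV_lift [intv k _ _]mxE [intv k' _ _]mxE.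
  by rewrite [k' _ _]mxE.
have mf := measurable_1cos_dot (intv k) phi.
have f0 x : (0 <= (1 + cos (2 * pi * dot (intv k) x + phi))%:E)%E.
  by rewrite lee_fin cos1_ge0.
have [k00|k00] := eqVneq (k ord0 ord0) 0.
  have k'0 : k' != 0.
    apply: contraNneq k0 => k'0; apply/eqP/matrixP => i j; rewrite ord1 [RHS]mxE.
    case: (unliftP ord0 i) => [i' ->|->//].
    by move/matrixP : k'0 => /(_ i' ord0); rewrite !mxE.
  rewrite cube_integralS//.
  under eq_integral => s _.
    under eq_integral do rewrite dotE k00 mul0r add0r.
    rewrite IH//; over.
  rewrite integral_cst//= mul1e lebesgue_measure_itv /= lte_fin.
  by rewrite ifT; [rewrite -EFinB; congr EFin; field|lra].
rewrite cube_integralS_swap//.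
under eq_integral => v _.
  under eq_integral do rewrite dotE mulrDr -addrA.
  rewrite integral_1cos_itv//; over.
rewrite integral_cst; first (rewrite mul1e; exact: lebesgue_cube).
exact: measurable_cube.
Qed.

End cosine_integral.

(** * Characters *)

Section characters.
Context {R : realType} {n : nat}.
Implicit Types (l x : 'cV[R]_n) (k : 'cV[int]_n).

Lemma dotDl l l' x : dot (l + l') x = dot l x + dot l' x.
Proof. by rewrite /dot -big_split /=; apply: eq_bigr => i _; rewrite mxE mulrDl. Qed.

Lemma dotC l x : dot l x = dot x l.
Proof. by apply: eq_bigr => i _; rewrite mulrC. Qed.

Lemma dotDr l x x' : dot l (x + x') = dot l x + dot l x'.
Proof. by rewrite dotC dotDl !(dotC l). Qed.

Lemma dotNl l x : dot (- l) x = - dot l x.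
Proof. by rewrite /dot -sumrN; apply: eq_bigr => i _; rewrite mxE mulNr. Qed.

Lemma dot_mulmx (A : 'M[R]_n) l x : dot l (A *m x) = dot (A^T *m l) x.
Proof.
rewrite /dot; under eq_bigr do rewrite mxE mulr_sumr.
rewrite exchange_big /=; apply: eq_bigr => j _.
rewrite mxE mulr_suml; apply: eq_bigr => i _.
by rewrite mxE mulrCA mulrA.
Qed.

Lemma expcharDl l l' x : expchar (l + l') x = expchar l x * expchar l' x.
Proof. by rewrite /expchar dotDl mulrDr expiD. Qed.

Lemma expcharDr l x x' : expchar l (x + x') = expchar l x * expchar l x'.
Proof. by rewrite /expchar dotDr mulrDr expiD. Qed.

Lemma expcharN l x : expchar (- l) x = conjc (expchar l x).
Proof. by rewrite /expchar dotNl mulrN expiN. Qed.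

Lemma expchar0 x : expchar 0 x = 1.
Proof.
by rewrite /expchar /dot big1 ?mulr0 ?expi0// => i _; rewrite mxE mul0r.
Qed.

Lemma abs2_expchar l x : abs2 (expchar l x) = 1.
Proof. exact: abs2_expi. Qed.

Lemma cmeas_expchar_comp d (T : measurableType d) (u v : T -> 'cV[R]_n) :
  measurable_fun setT u -> measurable_fun setT v ->
  cmeas (fun t => expchar (u t) (v t)).
Proof.
move=> mu mv; apply: cmeas_expi; apply: measurable_funM; first exact: measurable_cst.
exact: measurable_dot.
Qed.

Lemma cmeas_expchar l : cmeas (expchar l).
Proof. by apply: cmeas_expchar_comp; [exact: measurable_cst|exact: measurable_id]. Qed.

Lemma L2_expchar (m : {measure set 'cV[R]_n -> \bar R}) l :
  (m setT < +oo)%E -> L2 m (expchar l).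
Proof.
move=> mo; apply: (@L2_bounded _ _ _ m mo _ 1); first exact: cmeas_expchar.
by move=> x; rewrite abs2_expchar.
Qed.

Lemma sqn_expchar (m : {measure set 'cV[R]_n -> \bar R}) l :
  sqn m (expchar l) = m setT.
Proof.
rewrite /sqn; under eq_integral do rewrite abs2_expchar.
by rewrite integral_cst// mul1e.
Qed.

Lemma ip_expchar (m : {measure set 'cV[R]_n -> \bar R}) l l' :
  ip m (expchar l) (expchar l') = cint m (expchar (l - l')).
Proof.
by congr cint; apply/funext => x; rewrite expcharDl expcharN.
Qed.

Lemma intvD k k' : intv (k + k') = intv k + intv k' :> 'cV[R]_n.
Proof. by apply/matrixP => i j; rewrite !mxE intrD. Qed.

Lemma intvN k : intv (- k) = - intv k :> 'cV[R]_n.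
Proof. by apply/matrixP => i j; rewrite !mxE mulrNz. Qed.

Lemma intv0 : intv 0 = 0 :> 'cV[R]_n.
Proof. by apply/matrixP => i j; rewrite !mxE. Qed.

Lemma dot_intv k k' : exists z : int, dot (intv k) (intv k') = z%:~R :> R.
Proof.
exists (\sum_i k i ord0 * k' i ord0); rewrite /dot rmorph_sum /=.
by apply: eq_bigr => i _; rewrite !mxE intrM.
Qed.

Lemma expchar_dot_int l x (z : int) : dot l x = z%:~R -> expchar l x = 1.
Proof. by rewrite /expchar => ->; exact: expi_int. Qed.

End characters.

Section cube_measure.
Context {R : realType} {n : nat}.

Lemma cube_lty : (lebesgue_cV n (cube n) < +oo :> \bar R)%E.
Proof. by rewrite lebesgue_cube ltry. Qed.

Definition cube_measure : {finite_measure set 'cV[R]_n -> \bar R} :=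
  restr_measure (@measurable_cube R n) cube_lty.

Lemma cube_measure_setT :
  (cube_measure : {measure set 'cV[R]_n -> \bar R}) setT = 1%E.
Proof. by rewrite restr_measure_setT; exact: lebesgue_cube. Qed.

Lemma cube_measure_lty :
  ((cube_measure : {measure set 'cV[R]_n -> \bar R}) setT < +oo)%E.
Proof. by rewrite cube_measure_setT ltry. Qed.

Lemma nrm2_expchar_cube (l : 'cV[R]_n) : nrm2 cube_measure (expchar l) = 1.
Proof. by rewrite /nrm2 sqn_expchar cube_measure_setT. Qed.

Lemma integrable_cos_cube (l : 'cV[R]_n) (phi : R) :
  cube_measure.-integrable setT (fun x => (cos (2 * pi * dot l x + phi))%:E).
Proof.
have L1e : L1 cube_measure (fun x => expi phi * expchar l x).
  apply: L1Z; rewrite (_ : expchar l = fun x => expchar l x * conjc (expchar 0 x)).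
    by apply: L1_mul_conj; apply: L2_expchar; exact: cube_measure_lty.
  by apply/funext => x; rewrite expchar0 rmorph1 mulr1.
apply: eq_integrable L1e.1 => // x _.
by rewrite -expiD addrC.
Qed.

Lemma Rintegral_cos_cube (k : 'cV[int]_n) (phi : R) : k != 0 ->
  (\int[cube_measure]_x cos (2 * pi * dot (intv k) x + phi))%R = 0.
Proof.
move=> k0; have i1 : cube_measure.-integrable setT (fun=> (1 : R)%:E).
  exact: finite_measure_integrable_cst.
have H : (\int[cube_measure]_x (1 + cos (2 * pi * dot (intv k) x + phi)))%R = 1.
  rewrite /Rintegral ge0_integral_restr.
  - by rewrite integral_1cos_cube.
  - exact: measurable_1cos_dot.
  - by move=> x; rewrite lee_fin cos1_ge0.
move: H; rewrite RintegralD//; last exact: integrable_cos_cube.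
rewrite Rintegral_cst// mul1r cube_measure_setT /= => /eqP.
by rewrite addrC -subr_eq0 addrK => /eqP.
Qed.

(** The real and the imaginary parts are the cosine integrals for the phases [0] and
    [- pi / 2]. *)
Lemma cint_expchar_cube (k : 'cV[int]_n) : k != 0 ->
  cint cube_measure (expchar (intv k)) = 0.
Proof.
move=> k0; apply: complex_eq => /=.
- rewrite -[RHS](Rintegral_cos_cube 0 k0); apply: eq_Rintegral => x _.
  by rewrite addr0.
- rewrite -[RHS](Rintegral_cos_cube (- (pi / 2)) k0); apply: eq_Rintegral => x _.
  by rewrite cosB cos_pihalf sin_pihalf mulr0 mulr1 add0r.
Qed.

Lemma ip_expchar_cube (k k' : 'cV[int]_n) : k != k' ->
  ip cube_measure (expchar (intv k)) (expchar (intv k')) = 0.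
Proof.
by move=> kk'; rewrite ip_expchar -intvN -intvD cint_expchar_cube// subr_eq0.
Qed.

(** A list with possible repetitions makes closure under products immediate. *)
Definition trig_poly : set ('cV[R]_n -> R[i]) :=
  [set f | exists s : seq ('cV[int]_n * R[i]),
    f = fun x => \sum_(p <- s) p.2 * expchar (intv p.1) x].

Implicit Types f g : 'cV[R]_n -> R[i].

Lemma trig_expchar (k : 'cV[int]_n) : trig_poly (expchar (intv k)).
Proof. by exists [:: (k, 1)]; apply/funext => x; rewrite big_seq1 mul1r. Qed.

Lemma trig_cst (z : R[i]) : trig_poly (fun=> z).
Proof.
by exists [:: (0, z)]; apply/funext => x; rewrite big_seq1 intv0 expchar0 mulr1.
Qed.

Lemma trigD f g : trig_poly f -> trig_poly g -> trig_poly (f \+ g).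
Proof.
move=> [s ->] [t ->]; exists (s ++ t).
by apply/funext => x; rewrite big_cat.
Qed.

Lemma trigM f g : trig_poly f -> trig_poly g -> trig_poly (fun x => f x * g x).
Proof.
move=> [s ->] [t ->].
exists [seq (p.1 + q.1, p.2 * q.2) | p <- s, q <- t]; apply/funext => x.
rewrite big_allpairs_dep /= mulr_suml; apply: eq_bigr => p _.
rewrite mulr_sumr; apply: eq_bigr => q _.
by rewrite intvD expcharDl mulrACA.
Qed.

Lemma trigZ (z : R[i]) f : trig_poly f -> trig_poly (fun x => z * f x).
Proof. by move=> tf; apply: trigM => //; exact: trig_cst. Qed.

Lemma trigX f k : trig_poly f -> trig_poly (fun x => f x ^+ k).
Proof.
move=> tf; elim: k => [|k IH]; first exact: trig_cst.
by under eq_fun do rewrite exprS; exact: trigM.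
Qed.

Lemma trig_prod (I : Type) (s : seq I) (F : I -> 'cV[R]_n -> R[i]) :
  (forall i, trig_poly (F i)) -> trig_poly (fun x => \prod_(i <- s) F i x).
Proof.
move=> tF; elim: s => [|i s IH].
  by under eq_fun do rewrite big_nil; exact: trig_cst.
by under eq_fun do rewrite big_cons; exact: trigM.
Qed.

Lemma trig_conj f : trig_poly f -> trig_poly (fun x => conjc (f x)).
Proof.
move=> [s ->]; exists [seq (- p.1, conjc p.2) | p <- s]; apply/funext => x.
rewrite big_map conj_sum; apply: eq_bigr => p _ /=.
by rewrite intvN expcharN rmorphM.
Qed.

Lemma cmeas_trig f : trig_poly f -> cmeas f.
Proof.
move=> [s ->]; apply: cmeas_sum => p; apply: cmeasM; first exact: cmeas_cst.
exact: cmeas_expchar.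
Qed.

End cube_measure.

(** * Density of trigonometric polynomials *)

Section bernstein_steps.
Context {R : realType}.

Lemma bernoulli_ge (t : R) k : -1 <= t -> 1 + k%:R * t <= (1 + t) ^+ k.
Proof.
move=> t1; elim: k => [|k IH]; first by rewrite mul0r addr0 expr0.
rewrite exprS -natr1; apply: (@le_trans _ _ ((1 + t) * (1 + k%:R * t))).
  have : 0 <= k%:R * t ^+ 2 by rewrite mulr_ge0 ?sqr_ge0.
  by rewrite expr2; lra.
by rewrite ler_wpM2l//; lra.
Qed.

Lemma cvg_natr_expr (s : R) : 0 <= s -> s < 1 ->
  (fun k => k%:R * s ^+ k) @ \oo --> (0 : R).
Proof.
move=> s0 s1; pose t := (1 + s) / 2.
have t0 : 0 < t by rewrite /t; lra.
have t1 : t < 1 by rewrite /t; lra.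
have st : s <= t ^+ 2.
  rewrite -subr_ge0 (_ : _ - _ = ((1 - s) / 2) ^+ 2) ?sqr_ge0//.
  by rewrite /t; field.
pose K := t / (1 - t).
have K0 : 0 <= K by rewrite divr_ge0// ?ltW// subr_gt0.
have ub k : k%:R * s ^+ k <= K * t ^+ k.
  have h : k%:R * t ^+ k <= K.
    have := @bernoulli_ge (t^-1 - 1) k; rewrite [1 + (t^-1 - 1)]addrC subrK.
    have it : 1 <= t^-1 by rewrite invf_ge1// ltW.
    have -> : t^-1 - 1 = K^-1 by rewrite /K; field; rewrite !gt_eqF// subr_gt0.
    have K1 : 0 < K by rewrite divr_gt0// subr_gt0.
    have iK : 0 < K^-1 by rewrite invr_gt0.
    move=> /(_ ltac:(lra)); rewrite exprVn => H.
    have : k%:R * K^-1 <= (t ^+ k)^-1 by apply: le_trans H; rewrite lerDr.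
    by rewrite ler_pdivrMr// mulrC ler_pdivlMr ?exprn_gt0.
  have : s ^+ k <= t ^+ k * t ^+ k.
    by rewrite -exprMn -expr2; apply: lerXn2r; rewrite ?nnegrE ?sqr_ge0.
  move=> /(ler_wpM2l (ler0n R k))/le_trans; apply.
  by rewrite mulrA ler_wpM2r// exprn_ge0// ltW.
apply: (@squeeze_cvgr _ _ _ _ (fun=> 0) (fun k => K * t ^+ k)).
- by apply: nearW => k; rewrite mulr_ge0//= exprn_ge0.
- exact: cvg_cst.
- rewrite -[X in _ --> X](mulr0 K); apply: cvgMr; apply: cvg_expr.
  by rewrite gtr0_norm.
Qed.

(** Polynomials converging to the indicator of [[0, 1/2)] everywhere on
    [[0, 1]], the threshold included: the exponent grows a little faster than
    [2 ^ k], so that the values at [1/2] tend to [0]. *)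
Definition step (k : nat) (y : R) : R := (1 - y ^+ k) ^+ (k * 2 ^ k).

Lemma step_bounds k (y : R) : 0 <= y <= 1 -> 0 <= step k y <= 1.
Proof.
move=> /andP[y0 y1]; have yk : 0 <= 1 - y ^+ k by rewrite subr_ge0 exprn_ile1.
by rewrite exprn_ge0//= exprn_ile1// gerBl exprn_ge0.
Qed.

Lemma cvg_step (y : R) : 0 <= y <= 1 ->
  (fun k => step k y) @ \oo --> (((y < 2^-1)%R)%:R : R).
Proof.
move=> y01; have /andP[y0 y1] := y01.
have yk k : 0 <= y ^+ k <= 1 by rewrite exprn_ge0//= exprn_ile1.
have mE k : (k * 2 ^ k)%:R * y ^+ k = k%:R * (2 * y) ^+ k.
  by rewrite natrM natrX exprMn mulrA.
case: ltP => y2 /=.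
  apply: (@squeeze_cvgr _ _ _ _ (fun k => 1 - k%:R * (2 * y) ^+ k) (fun=> 1)).
  - apply: nearW => k; have /andP[_ ->] := step_bounds k y01; rewrite andbT.
    have /andP[_ ?] := yk k.
    have := @bernoulli_ge (- y ^+ k) (k * 2 ^ k); rewrite mulrN mE; apply.
    by lra.
  - rewrite -[X in _ --> X]subr0; apply: cvgB; first exact: cvg_cst.
    by apply: cvg_natr_expr; lra.
  - exact: cvg_cst.
apply: (@squeeze_cvgr _ _ _ _ (fun=> 0) (fun k => k.+1%:R^-1)).
- apply: nearW => k; have /andP[-> _] /= := step_bounds k y01.
  have /andP[yk0 yk1] := yk k.
  have h1 : k.+1%:R <= (1 + y ^+ k) ^+ (k * 2 ^ k).
    apply: le_trans (bernoulli_ge _ _); last by lra.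
    rewrite mE -natr1 addrC lerD2l ler_peMr// exprn_ege1//; lra.
  have h2 : step k y * (1 + y ^+ k) ^+ (k * 2 ^ k) <= 1.
    rewrite -exprMn; apply: exprn_ile1.
      by rewrite mulr_ge0//; lra.
    have := sqr_ge0 (y ^+ k); rewrite expr2 => ?; lra.
  rewrite -(ler_pM2r (ltr0Sn R k)) mulVf// (le_trans _ h2)//.
  by rewrite ler_wpM2l//; have /andP[] := step_bounds k y01.
- exact: cvg_cst.
- exact: cvg_harmonic.
Qed.

Lemma cvg_prod_seq (I : Type) (s : seq I) (F : I -> nat -> R) (l : I -> R) :
  (forall i, F i @ \oo --> l i) ->
  (fun k => \prod_(i <- s) F i k) @ \oo --> \prod_(i <- s) l i.
Proof.
move=> Fl; elim: s => [|i s IH].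
  by rewrite big_nil; under eq_fun do rewrite big_nil; exact: cvg_cst.
by rewrite big_cons; under eq_fun do rewrite big_cons; exact: cvgM.
Qed.

End bernstein_steps.

Section trig_density.
Context {R : realType} {n : nat}.
Local Notation V := 'cV[R]_n.

Lemma trig_Im (f : V -> R[i]) : trig_poly f -> trig_poly (fun x => ((complex.Im (f x))%:C)%C).
Proof.
move=> tf.
rewrite (_ : (fun _ => _) = (fun x => Complex 0 (- 2^-1) * f x) \+
    (fun x => Complex 0 (2^-1) * conjc (f x))).
  by apply: trigD; apply: trigZ => //; exact: trig_conj.
by apply/funext => x; apply: complex_eq; rewrite /= !ReImE /=; field.
Qed.

(** For [a] in [[-1/2, 1/2)], [sin (pi (x - a)) cos (pi x)] is a trigonometric
    polynomial of period [1] which, for [x] in the same interval, is positive exactly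
    when [x > a]. *)
Lemma ray_trig (a : R) : exists y : R -> R,
  [/\ forall i : 'I_n, trig_poly (fun x : V => ((y (x i ord0))%:C)%C),
      forall t, 0 <= y t <= 1 &
      forall t, - 2^-1 <= t < 2^-1 -> (y t < 2^-1) = (a < t)].
Proof.
have [aN|aN] := ltP a (- 2^-1).
  exists (fun=> 0); split.
  - by move=> i; exact: trig_cst.
  - by move=> t; rewrite lexx ler01.
  - move=> t /andP[t1 t2]; by rewrite invr_gt0 ltr0n; apply/esym; exact: lt_le_trans t1.
have [a1|a1] := leP (2^-1) a.
  exists (fun=> 1); split.
  - by move=> i; exact: trig_cst.
  - by move=> t; rewrite lexx ler01.
  - move=> t /andP[t1 t2]; rewrite [RHS](_ : _ = false); last first.
      by apply/negbTE; rewrite -leNgt (le_trans (ltW t2)).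
    by apply/negbTE; rewrite -leNgt invf_le1// ler1n.
(* By the product formula this is [1/2 - sin (pi (t - a)) cos (pi t) / 2]. *)
exists (fun t => 2^-1 - (sin (2 * pi * t - pi * a) - sin (pi * a)) / 4); split.
- move=> i; pose e := fun x : V => expi (- (pi * a)) * expchar (intv (delta_mx i ord0)) x.
  have eE x : complex.Im (e x) = sin (2 * pi * x i ord0 - pi * a).
    rewrite /e /expchar -expiD addrC /= (_ : dot _ x = x i ord0)//.
    rewrite /dot (bigD1 i)//= big1 ?addr0.
      by rewrite !mxE !eqxx mul1r.
    by move=> j ji; rewrite !mxE (negbTE ji) mul0r.
  have te : trig_poly e by apply: trigZ; exact: trig_expchar.
  have := trigD (trigZ (- ((4^-1)%:C)%C) (trig_Im te))
    (trig_cst ((2^-1 + sin (pi * a) / 4)%:C)%C).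
  congr trig_poly; apply/funext => x; rewrite /GRing.add_fun eE.
  by rewrite -rmorphN -rmorphM -rmorphD /=; congr (_%:C)%C; field.
- move=> t; have := sin_le1 (2 * pi * t - pi * a); have := sin_geN1 (2 * pi * t - pi * a).
  have := sin_le1 (pi * a); have := sin_geN1 (pi * a) => *.
  by apply/andP; split; lra.
- move=> t /andP[t1 t2].
  have E : sin (2 * pi * t - pi * a) - sin (pi * a) =
      2 * (sin (pi * (t - a)) * cos (pi * t)).
    have -> : 2 * pi * t - pi * a = pi * (t - a) + pi * t by ring.
    have -> : pi * a = pi * t - pi * (t - a) by ring.
    by rewrite sinD sinB; ring.
  rewrite E; have pi0 := pi_gt0 R.
  have c0 : 0 <= cos (pi * t).
    by apply: cos_ge0_pihalf; apply/andP; split; nra.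
  have [ta|ta] := ltP a t.
    have s0 : 0 < sin (pi * (t - a)) by apply: sin_gt0_pi; apply/andP; split; nra.
    have c1 : 0 < cos (pi * t) by apply: cos_gt0_pihalf; apply/andP; split; nra.
    by have := mulr_gt0 s0 c1 => ?; apply/idP; lra.
  have s0 : 0 <= sin (pi * (a - t)) by apply: sin_ge0_pi; apply/andP; split; nra.
  have -> : pi * (t - a) = - (pi * (a - t)) by ring.
  by rewrite sinN mulNr; have := mulr_ge0 s0 c0 => ?; apply/negbTE; rewrite -leNgt; lra.
Qed.

(** Products of open half-lines generate the sigma-algebra and are stable under
    intersection; on the cube their indicators are limits of trigonometric polynomials. *)
Definition orthants : set (set V) :=
  [set A | exists a : 'I_n -> R, A = box (fun i => `]a i, +oo[%classic)].

Lemma orthants_setI : setI_closed orthants.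
Proof.
move=> _ _ [a ->] [b ->]; exists (fun i => Num.max (a i) (b i)).
apply/seteqP; split => x /=.
  move=> [xa xb] i; have := xa i; have := xb i; rewrite /= !in_itv /= !andbT.
  by rewrite gt_max => -> ->.
move=> H; split => i; have := H i; rewrite /= !in_itv /= !andbT gt_max => /andP[];
  by [].
Qed.

Lemma measurable_orthants : @measurable _ V = <<s orthants >>.
Proof.
apply/seteqP; split; last first.
  apply: smallest_sub; first exact: sigma_algebra_measurable.
  by move=> _ [a ->]; apply: measurable_box => i; exact: measurable_itv.
apply: smallest_sub; first exact: smallest_sigma_algebra.
rewrite -bigcup_seq; apply: bigcup_sub => i _ _ [B mB <-].
rewrite setTI.
pose P (B : set (measurableTypeR R)) := <<s orthants >> ((fun x : V => x i ord0) @^-1` B).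
have : (@RGenOInfty.G R).-sigma.-measurable B by rewrite -RGenOInfty.measurableE.
move: B {mB}; apply: smallest_sub.
  split.
  - by rewrite /= preimage_set0; exact: sigma_algebra0.
  - by move=> A /= PA; rewrite setTD preimage_setC -setTD; exact: sigma_algebraCD.
  - by move=> A /= PA; rewrite preimage_bigcup; exact: sigma_algebra_bigcup.
move=> _ [b ->] /=.
rewrite (_ : _ @^-1` _ = \bigcup_k box (fun j =>
   `](if j == i then b else - (k%:R)), +oo[%classic : set R)).
  apply: sigma_algebra_bigcup => k; apply: sub_gen_smallest.
  by exists (fun j => if j == i then b else - k%:R).
apply/seteqP; split => x /=; last first.
  by move=> [k _ /(_ i)]; rewrite eqxx.
rewrite in_itv /= andbT => xb.
pose K : R := \sum_j `|x j ord0|.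
have K0 : 0 <= K by exact: sumr_ge0.
exists (Num.bound K) => // j; rewrite /= in_itv /= andbT; case: eqP => [->//|_].
have xK : `|x j ord0| <= K by rewrite /K (bigD1 j)//= lerDl sumr_ge0.
have := archi_boundP K0; move: xK; rewrite ler_norml => /andP[? _] ?.
by lra.
Qed.

(** By the density criterion only indicators of orthants have to be approximated. On the
    cube such an indicator is the product of those of the rays [x_i > a_i]; composing the
    polynomials [step k] with the functions of [ray_trig] gives bounded trigonometric
    polynomials converging to it everywhere, and dominated convergence applies. *)
Theorem trig_dense (h : V -> R[i]) : L2 cube_measure h ->
  approximable cube_measure trig_poly h.
Proof.
apply: (@L2_dense_criterion _ _ _ cube_measure trig_poly (@cmeas_trig R n)
  (@trigD R n) (@trigZ R n) (trig_cst 0) cube_measure_lty orthants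
  measurable_orthants orthants_setI).
- rewrite (_ : cindic setT = fun=> 1); last first.
    by apply/funext => x; rewrite /cindic indicT.
  by apply: approximable_F; exact: trig_cst.
move=> _ [a ->].
have [y yP] := choice (fun i => ray_trig (a i)).
pose p k (x : V) : R := \prod_(i < n) step k (y i (x i ord0)).
have tp k : trig_poly (fun x => ((p k x)%:C)%C).
  rewrite (_ : (fun _ => _) = (fun x : V => \prod_(i < n)
      ((1 - (((y i (x i ord0))%:C)%C) ^+ k) ^+ (k * 2 ^ k)))).
    apply: trig_prod => i; apply: trigX; apply: trigD; first exact: trig_cst.
    rewrite (_ : (fun _ => _) = (fun x : V => (-1) * (((y i (x i ord0))%:C)%C) ^+ k)).
      by apply: trigZ; apply: trigX; have [] := yP i.
    by apply/funext => x; rewrite mulN1r.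
  apply/funext => x; rewrite /p rmorph_prod /=; apply: eq_bigr => i _.
  by rewrite /step rmorphXn /= rmorphB /= rmorphXn.
have mp k := cmeas_trig (tp k).
set A := box _.
have mA : measurable A by apply: measurable_box => i; exact: measurable_itv.
have mQ := @measurable_cube R n.
apply: (@approximable_cvg _ _ _ _ _ (@cmeas_trig R n) (fun k x => ((p k x)%:C)%C)).
- exact: cmeas_indic.
- exact: mp.
- by move=> k; apply: approximable_F.
have p01 k x : 0 <= p k x <= 1.
  rewrite /p; elim/big_ind : _ => [|u v /andP[? ?] /andP[? ?]|i _].
  - by rewrite lexx ler01.
  - by rewrite mulr_ge0//= mulr_ile1.
  - by apply: step_bounds; have [_ + _] := yP i; apply.
have H : (fun k => sqn cube_measure ((fun x => ((p k x)%:C)%C) \- cindic A)) =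
    (fun k => sqn cube_measure (trunc (cube n) (fun x => ((p k x)%:C)%C) \-
        trunc (cube n) (cindic A))).
  apply/funext => k.
  rewrite -(@sqn_ae_trunc _ _ _ cube_measure _ _ mQ).
  - by apply: eq_sqn => x /=; rewrite !truncE; case: ifPn => //; rewrite subr0.
  - by apply: cmeasB => //; exact: cmeas_indic.
  - exact: ae_restr_measure.
rewrite H; apply: (@dominated_sqn _ _ _ _ _ _ (fun=> 1)).
- by move=> k; exact: cmeas_trunc.
- by apply: cmeas_trunc => //; exact: cmeas_indic.
- move=> x; split; last first.
    under eq_fun do rewrite /trunc cImM /= mulr0 mul0r addr0.
    by rewrite /trunc cImM /= mulr0 mul0r addr0; exact: cvg_cst.
  under eq_fun do rewrite /trunc cReM /= mulr0 subr0.
  rewrite /trunc cReM /= mulr0 subr0.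
  rewrite [\1_(cube n) x]indicE; have [xQ|xQ] := boolP (x \in cube n); last first.
    by rewrite mul0r; under eq_fun do rewrite mul0r; exact: cvg_cst.
  rewrite mul1r; under eq_fun do rewrite mul1r.
  rewrite (_ : \1_A x = \prod_(i < n) ((y i (x i ord0) < 2^-1)%R)%:R); last first.
    rewrite indicE; have [xA|xA] := boolP (x \in A).
      rewrite big1// => i _; have [_ _ ->] := yP i.
        by rewrite inE in xA; have := xA i; rewrite /= in_itv /= andbT => ->.
      by rewrite inE in xQ; have := xQ i; rewrite /= in_itv.
    have [i xi] : exists i, ~~ (a i < x i ord0).
      apply: contrapT => H'; move/negP : xA; apply; rewrite inE => i /=.
      rewrite in_itv /= andbT; apply: contrapT => /negP xi.
      by apply: H'; exists i.
    rewrite (bigD1 i)//=; have [_ _ ->] := yP i.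
      by rewrite (negbTE xi) mul0r.
    by rewrite inE in xQ; have := xQ i; rewrite /= in_itv.
  apply: cvg_prod_seq => i; apply: cvg_step; have [_ + _] := yP i; apply.
- exact: finite_measure_integrable_cst.
- move=> k x; rewrite /trunc -rmorphM -rmorphM -rmorphB abs2_real /=.
  have /andP[? ?] := p01 k x.
  have aux (u v : R) : 0 <= u <= 1 -> 0 <= v <= 1 -> (u - v) ^+ 2 <= 1.
    by move=> /andP[? ?] /andP[? ?]; rewrite expr2; nra.
  apply: aux; rewrite !indicE.
    by case: (x \in cube n); rewrite /= ?mul1r ?mul0r ?lexx ?ler01 ?p01.
  by case: (x \in cube n); case: (x \in A);
    rewrite /= ?mul1r ?mul0r ?lexx ?ler01.
Qed.

End trig_density.

(** * Tensors on the product of the cube and a base *)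

Section tensors.
Context {R : realType} {n : nat} {d} {X : measurableType d}.
Context (nu : {finite_measure set X -> \bar R}).
Local Notation V := 'cV[R]_n.
Local Notation e k := (expchar (intv k)).
Implicit Types (k : 'cV[int]_n) (s : seq 'cV[int]_n) (g : 'cV[int]_n -> X -> R[i]).

(** Functions on the product of the cube and the base that are trigonometric polynomials
    in the first variable with coefficients depending on the second one. *)
Definition tensor_sum s g : V * X -> R[i] :=
  fun p => \sum_(k <- s) e k p.1 * g k p.2.

(** Vanishing off [s] lets two families be summed over a common index sequence. *)
Definition finite_family s g :=
  [/\ uniq s, forall k, L2 nu (g k) & forall k, k \notin s -> g k = fun=> 0].

Definition tensors : set (V * X -> R[i]) :=
  [set F | exists s g, finite_family s g /\ F = tensor_sum s g].

Lemma cmeas_tensor_sum s g : (forall k, cmeas (g k)) -> cmeas (tensor_sum s g).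
Proof.
move=> mg; apply: cmeas_sum => k; apply: cmeasM.
- by apply: cmeas_expchar_comp; [exact: measurable_cst|exact: measurable_fst].
- exact: (cmeas_comp measurable_snd).
Qed.

Lemma cmeas_tensors F : tensors F -> cmeas F.
Proof.
by move=> [s [g [[_ Lg _] ->]]]; apply: cmeas_tensor_sum => k; have [] := Lg k.
Qed.

Lemma tensor_sum_widen s s' g : uniq s -> uniq s' -> {subset s <= s'} ->
  (forall k, k \notin s -> g k = fun=> 0) -> tensor_sum s g = tensor_sum s' g.
Proof.
move=> us us' ss' g0; apply/funext => p; rewrite /tensor_sum.
rewrite [RHS](bigID (mem s)) /= [X in _ + X]big1 ?addr0; last first.
  by move=> k /g0 ->; rewrite mulr0.
rewrite -[RHS]big_filter; apply: perm_big; apply: uniq_perm => //.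
  exact: filter_uniq.
by move=> k; rewrite mem_filter /=; case: (boolP (k \in s)) => // /ss' ->.
Qed.

Lemma tensorsD F G : tensors F -> tensors G -> tensors (F \+ G).
Proof.
move=> [s [g [[us Lg g0] ->]]] [t [h [[ut Lh h0] ->]]].
have sst : {subset s <= undup (s ++ t)}.
  by move=> k ks; rewrite mem_undup mem_cat ks.
have tst : {subset t <= undup (s ++ t)}.
  by move=> k kt; rewrite mem_undup mem_cat kt orbT.
exists (undup (s ++ t)), (fun k => g k \+ h k); split.
  split; [exact: undup_uniq|by move=> k; exact: L2D|move=> k].
  rewrite mem_undup mem_cat negb_or => /andP[/g0 -> /h0 ->].
  by apply/funext => x /=; rewrite addr0.
rewrite (tensor_sum_widen us (undup_uniq _) sst g0).
rewrite (tensor_sum_widen ut (undup_uniq _) tst h0).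
apply/funext => p; rewrite /tensor_sum /= -big_split /=.
by apply: eq_bigr => k _; rewrite mulrDr.
Qed.

Lemma tensorsZ (a : R[i]) F : tensors F -> tensors (fun p => a * F p).
Proof.
move=> [s [g [[us Lg g0] ->]]]; exists s, (fun k x => a * g k x); split.
  split=> // k; first exact: L2Z.
  by move=> /g0 ->; apply/funext => x; rewrite mulr0.
apply/funext => p; rewrite /tensor_sum mulr_sumr.
by apply: eq_bigr => k _; rewrite mulrCA.
Qed.

Lemma tensors0 : tensors (fun=> 0).
Proof.
exists [::], (fun _ _ => 0); split; last first.
  by apply/funext => p; rewrite /tensor_sum big_nil.
by split=> // k; exact: L2_cst0.
Qed.

Lemma tensors_elem k (g : X -> R[i]) : L2 nu g -> tensors (fun p => e k p.1 * g p.2).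
Proof.
move=> Lg; exists [:: k], (fun l => if l == k then g else fun=> 0); split.
  split=> // l; first by case: eqP => [_|_]; [exact: Lg|exact: L2_cst0].
  by rewrite inE => /negbTE ->.
by apply/funext => p; rewrite /tensor_sum big_seq1 eqxx.
Qed.

Local Notation prodm := (@cube_measure R n \x nu)%E.

Lemma sqn_prod_swap (F : V * X -> R[i]) : cmeas F ->
  sqn prodm F = (\int[nu]_x sqn cube_measure (fun c => F (c, x)))%E.
Proof.
move=> mF; rewrite /sqn (fubini_tonelli2 (fun p => (abs2 (F p))%:E))//.
- exact: emeasurable_abs2.
- by move=> p; rewrite lee_fin abs2_ge0.
Qed.

Lemma sqn_prod (F : V * X -> R[i]) : cmeas F ->
  sqn prodm F = (\int[cube_measure]_c sqn nu (fun x => F (c, x)))%E.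
Proof.
move=> mF; rewrite /sqn (fubini_tonelli1 (fun p => (abs2 (F p))%:E))//.
- exact: emeasurable_abs2.
- by move=> p; rewrite lee_fin abs2_ge0.
Qed.

(** Orthonormality of the exponentials on the cube, applied in the first variable
    with the second one fixed. *)
Lemma sqn_tensor_sum s g : uniq s -> (forall k, L2 nu (g k)) ->
  sqn prodm (tensor_sum s g) = (\sum_(k <- s) sqn nu (g k))%E.
Proof.
move=> us Lg; rewrite sqn_prod_swap; last first.
  by apply: cmeas_tensor_sum => k; have [] := Lg k.
rewrite /sqn -ge0_integral_sum//; last 2 first.
- by move=> k; apply: emeasurable_abs2; have [] := Lg k.
- by move=> k x _; rewrite lee_fin abs2_ge0.
apply: eq_integral => x _; rewrite -/(sqn cube_measure (fun c => tensor_sum s g (c, x))).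
have Le k : L2 cube_measure (e k : V -> R[i]).
  by apply: L2_expchar; exact: cube_measure_lty.
have os : @ortho_family _ _ _ cube_measure _ (fun k => e k : V -> R[i]) s.
  by move=> k k' _ _; exact: ip_expchar_cube.
have eM k : nrm2 cube_measure (e k : V -> R[i]) = 1 by exact: nrm2_expchar_cube.
have H := nrm2_subproj Le eM (fun k => - g k x) us os (L2_cst0 cube_measure).
rewrite (_ : (fun c => tensor_sum s g (c, x)) =
    (fun=> 0) \- (fun c => \sum_(k <- s) - g k x * e k c)); last first.
  apply/funext => c; rewrite /tensor_sum /= sub0r -sumrN.
  by apply: eq_bigr => k _; rewrite mulNr opprK mulrC.
rewrite sqnE; last first.
  by apply: L2B; [exact: L2_cst0|apply: L2_sum => k; exact: L2Z].
rewrite H sumEFin; congr EFin.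
have -> : nrm2 cube_measure ((fun=> 0) : V -> R[i]) = 0.
  by rewrite /nrm2 /sqn integral0_eq// => c _; rewrite abs2_0.
rewrite mul1r [X in _ - 2 * X + _]big1 ?mulr0 ?subr0 ?add0r; last first.
  move=> k _; rewrite (_ : ip _ _ _ = 0) ?mulr0//.
  by rewrite -[RHS](cint0 (cube_measure : {measure set V -> \bar R})); congr cint; apply/funext => c; rewrite mul0r.
by apply: eq_bigr => k _; rewrite abs2N.
Qed.

Lemma prodm_lty : (prodm setT < +oo)%E.
Proof.
rewrite -setXTT product_measure1E// cube_measure_setT mul1e.
by rewrite ltey_eq fin_num_measure.
Qed.

(** Indicators of rectangles are limits of a trigonometric polynomial in the first
    variable times an indicator in the second one. *)
Theorem tensors_dense (F : V * X -> R[i]) : L2 prodm F -> approximable prodm tensors F.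
Proof.
pose G := [set A `*` B | A in (@measurable _ V) & B in (@measurable _ X)].
apply: (@L2_dense_criterion _ _ _ prodm tensors cmeas_tensors tensorsD tensorsZ
  tensors0 prodm_lty G).
- by rewrite /G -measurable_prod_measurableType.
- move=> _ _ [A mA [B mB <-]] [A' mA' [B' mB' <-]]; rewrite -setXI.
  by exists (A `&` A'); [exact: measurableI|exists (B `&` B') => //; exact: measurableI].
- apply: approximable_F.
  have L1' : L2 nu (fun=> 1 : R[i]).
    apply: (@L2_bounded _ _ _ nu _ _ 1); first by rewrite ltey_eq fin_num_measure.
      exact: cmeas_cst.
    by move=> x; rewrite abs2_1.
  have := tensors_elem 0 L1'; congr tensors; apply/funext => p.
  by rewrite intv0 expchar0 mulr1 /cindic indicT.
move=> _ [A mA [B mB <-]] eps eps0.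
have nuB : nu B \is a fin_num by exact: fin_num_measure.
pose b := fine (nu B) + 1.
have b0 : 0 < b by rewrite /b ltr_wpDl// fine_ge0.
have LA : L2 cube_measure (cindic A : V -> R[i]).
  apply: (@L2_bounded _ _ _ _ cube_measure_lty _ 1); first exact: cmeas_indic.
  by move=> x; rewrite abs2_real indicE; case: (x \in A); rewrite /= ?expr1n ?expr0n.
have [P [t PE] PA] := trig_dense LA (divr_gt0 eps0 b0).
have LB : L2 nu (cindic B).
  apply: (@L2_bounded _ _ _ nu _ _ 1); first by rewrite ltey_eq fin_num_measure.
    exact: cmeas_indic.
  by move=> x; rewrite abs2_real indicE; case: (x \in B); rewrite /= ?expr1n ?expr0n.
exists (fun p => P p.1 * cindic B p.2).
  rewrite PE; elim: t {PE PA} => [|[k z] t IH].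
    rewrite (_ : (fun _ => _) = fun=> 0); first exact: tensors0.
    by apply/funext => p; rewrite big_nil mul0r.
  rewrite (_ : (fun _ => _) = (fun p => e k p.1 * (z * cindic B p.2)) \+
     (fun p => (\sum_(q <- t) q.2 * e q.1 p.1) * cindic B p.2)).
    exact: tensorsD (tensors_elem k (L2Z z LB)) IH.
  by apply/funext => p /=; rewrite big_cons mulrDl mulrCA mulrA.
have mP : cmeas P by apply: cmeas_trig; exists t.
have mPA : cmeas (P \- cindic A) by apply: cmeasB => //; exact: cmeas_indic.
rewrite (_ : _ \- _ = (fun p => (P \- cindic A) p.1 * cindic B p.2)); last first.
  apply/funext => p; rewrite /= mulrBl; congr (_ - _).
  rewrite /cindic -rmorphM /=; congr (_%:C)%C.
  by rewrite !indicE in_setX; case: (_ \in _); case: (_ \in _); rewrite ?mul1r ?mul0r ?mulr0.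
rewrite sqn_prod; last first.
  apply: cmeasM; first exact: (cmeas_comp measurable_fst mPA).
  by apply: (cmeas_comp measurable_snd); exact: cmeas_indic.
rewrite (eq_integral (fun c => (fine (nu B))%:E * (abs2 ((P \- cindic A) c))%:E)%E);
  last first.
  move=> c _; rewrite /sqn; under eq_integral do rewrite abs2M EFinM abs2_real /=.
  rewrite ge0_integralZl; last 4 first.
  - by [].
  - by apply/measurable_EFinP; apply: measurable_funX; exact: measurable_indic.
  - by move=> x _; rewrite lee_fin sqr_ge0.
  - by rewrite lee_fin abs2_ge0.
  rewrite muleC fineK//; congr (_ * _)%E.
  rewrite -[in RHS](setIT B) -integral_indic//; apply: eq_integral => x _.
  by rewrite indicE; case: (x \in B); rewrite /= ?expr1n ?expr0n.
rewrite ge0_integralZl//; last 3 first.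
- exact: emeasurable_abs2.
- by move=> c _; rewrite lee_fin abs2_ge0.
- by rewrite lee_fin fine_ge0.
rewrite -/(sqn cube_measure _).
apply: (@le_lt_trans _ _ (b%:E * sqn cube_measure (P \- cindic A)%R)%E).
  by rewrite lee_wpmul2r ?sqn_ge0// lee_fin /b lerDl.
have -> : eps%:E = (b%:E * (eps / b)%:E)%E.
  by rewrite -EFinM mulrC divfK// gt_eqF.
by rewrite lte_pmul2l// lte_fin.
Qed.

End tensors.

(** * The Fourier transform of integrable functions *)

Section parametric_integrals.
Context {R : realType} {d1 d2} {T1 : measurableType d1} {T2 : measurableType d2}.

Lemma measurable_parametric (m : {sigma_finite_measure set T2 -> \bar R})
    (f : T1 * T2 -> \bar R) : measurable_fun setT f ->
  measurable_fun setT (fun t => \int[m]_x f (t, x))%E.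
Proof.
move=> mf.
have mp : measurable_fun setT (fun t => \int[m]_x (f^\+ (t, x)))%E.
  by apply: (measurable_fun_fubini_tonelli_F (f^\+)%E) => //; exact: measurable_funepos.
have mn : measurable_fun setT (fun t => \int[m]_x (f^\- (t, x)))%E.
  by apply: (measurable_fun_fubini_tonelli_F (f^\-)%E) => //; exact: measurable_funeneg.
apply: eq_measurable_fun (emeasurable_funB mp mn) => t _.
rewrite [RHS]integralE -[fun x0 => f (t, x0)]/(f \o pair t).
by rewrite (funepos_comp f (pair t)) (funeneg_comp f (pair t)).
Qed.

(** Tonelli's theorem gives measurability for the positive and negative parts. *)
Lemma cmeas_parametric (m : {sigma_finite_measure set T2 -> \bar R})
    (F : T1 * T2 -> R[i]) :
  cmeas F -> cmeas (fun t => cint m (fun x => F (t, x))).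
Proof.
move=> [F1 F2]; split => /=.
- apply: (measurableT_comp (fine_measurable measurableT)).
  by apply: (measurable_parametric m (f := fun p => (complex.Re (F p))%:E));
    exact/measurable_EFinP.
- apply: (measurableT_comp (fine_measurable measurableT)).
  by apply: (measurable_parametric m (f := fun p => (complex.Im (F p))%:E));
    exact/measurable_EFinP.
Qed.

End parametric_integrals.

Section lebesgue_cV_change.
Context {R : realType} {n : nat}.
Local Notation V := 'cV[R]_n.
Local Notation leb := (lebesgue_cV n : {sigma_finite_measure set 'cV[R]_n -> \bar R}).

Lemma cint_shift (a : V) (f : V -> R[i]) : cmeas f ->
  cint leb (fun x => f (x + a)) = cint leb f.
Proof.
have key (u : V -> R) : measurable_fun setT u ->
    (\int[leb]_x u (x + a) = \int[leb]_x u x)%R.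
  move=> mu; rewrite /Rintegral; congr fine.
  have meu : measurable_fun setT (EFin \o u) by exact/measurable_EFinP.
  rewrite [LHS]integralE [RHS]integralE.
  rewrite -[fun x => (u (x + a))%:E]/((EFin \o u) \o (fun x => x + a)).
  rewrite (funepos_comp (EFin \o u)) (funeneg_comp (EFin \o u)).
  have Hp := lebesgue_cV_shift a (measurable_funepos meu) (funepos_ge0 _).
  have Hn := lebesgue_cV_shift a (measurable_funeneg meu) (funeneg_ge0 _).
  by congr (_ - _)%E; [exact: Hp|exact: Hn].
by move=> [m1 m2]; apply: complex_eq; exact: key.
Qed.

Lemma sqn_shift (a : V) (f : V -> R[i]) : cmeas f ->
  sqn leb (fun x => f (x + a)) = sqn leb f.
Proof.
move=> mf; rewrite /sqn (lebesgue_cV_shift a (f := fun x => (abs2 (f x))%:E))//.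
- exact: emeasurable_abs2.
- by move=> x; rewrite lee_fin abs2_ge0.
Qed.

Lemma L1_shift (a : V) (f : V -> R[i]) : L1 leb f -> L1 leb (fun x => f (x + a)).
Proof.
have key (u : V -> R) : leb.-integrable setT (EFin \o u) ->
    leb.-integrable setT (EFin \o (fun x => u (x + a))).
  move=> /integrableP[mu uo]; apply/integrableP; split.
    exact: (measurableT_comp mu (measurable_shift_cV a)).
  have ma : measurable_fun setT (abse \o (EFin \o u)) by exact: measurableT_comp.
  by have := lebesgue_cV_shift a ma (fun x => abse_ge0 _) => /= ->.
by move=> [f1 f2]; split; [exact: (key _ f1)|exact: (key _ f2)].
Qed.

Lemma cmeas_shift (a : V) (f : V -> R[i]) : cmeas f ->
  cmeas (fun x : V => f (x + a)).
Proof. by move=> mf; exact: (cmeas_comp (measurable_shift_cV a) mf). Qed.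

Lemma fourierE (f : V -> R[i]) t :
  fourier f t = cint leb (fun x => f x * conjc (expchar t x)).
Proof.
rewrite /fourier /expchar -/(cint _ _); congr cint.
by apply/funext => x; rewrite expiN.
Qed.

Lemma cmeas_fourier (f : V -> R[i]) : cmeas f -> cmeas (fourier f).
Proof.
move=> mf; rewrite (_ : fourier f =
    (fun t => cint leb (fun x => f x * conjc (expchar t x)))); last first.
  by apply/funext => t; exact: fourierE.
apply: (@cmeas_parametric _ _ _ _ _ leb (fun p => f p.2 * conjc (expchar p.1 p.2))).
apply: cmeasM; first exact: (cmeas_comp measurable_snd).
by apply: cmeas_conj; apply: cmeas_expchar_comp; [exact: measurable_fst|exact: measurable_snd].
Qed.

Lemma L1_cmeas (m : {measure set V -> \bar R}) (f : V -> R[i]) : L1 m f -> cmeas f.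
Proof.
move=> [f1 f2]; split.
- by apply/measurable_EFinP; exact: (measurable_int m f1).
- by apply/measurable_EFinP; exact: (measurable_int m f2).
Qed.

Lemma L1_mul_bounded (m : {measure set V -> \bar R}) (f h : V -> R[i]) :
  L1 m f -> cmeas h -> (forall x, abs2 (h x) <= 1) -> L1 m (fun x => f x * h x).
Proof.
move=> Lf mh h1; have [f1 f2] := Lf; have mf := L1_cmeas Lf.
have [fh1 fh2] := cmeasM mf mh.
have H := integrableD measurableT (integrable_abse f1) (integrable_abse f2).
have hb x : `|complex.Re (h x)| <= 1 /\ `|complex.Im (h x)| <= 1.
  have := h1 x; rewrite abs2E => ?.
  have := sqr_ge0 (complex.Re (h x)); have := sqr_ge0 (complex.Im (h x)) => ? ?.
  split; rewrite -(@ler_sqr _ `|_|) ?nnegrE// real_normK ?num_real// expr1n; lra.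
have aux (a b u v : R) : `|u| <= 1 -> `|v| <= 1 -> `|a * u + b * v| <= `|a| + `|b|.
  move=> u1 v1; apply: le_trans (ler_normD _ _) _; rewrite !normrM.
  by apply: lerD; rewrite ler_piMr.
split; apply: le_integrable H => //; try exact/measurable_EFinP.
- move=> x _ /=; have [? ?] := hb x; rewrite lee_fin cReM [leRHS]ger0_norm ?addr_ge0//.
  by rewrite -mulrN; apply: aux => //; rewrite normrN.
- move=> x _ /=; have [? ?] := hb x; rewrite lee_fin cImM [leRHS]ger0_norm ?addr_ge0//.
  exact: aux.
Qed.

Lemma L1_mul_char (m : {measure set V -> \bar R}) (f : V -> R[i]) t :
  L1 m f -> L1 m (fun x => f x * conjc (expchar t x)).
Proof.
move=> Lf; apply: L1_mul_bounded => //; first by apply: cmeas_conj; exact: cmeas_expchar.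
by move=> x; rewrite abs2_conj abs2_expchar.
Qed.

Lemma fourierB (f g : V -> R[i]) t : L1 leb f -> L1 leb g ->
  fourier (f \- g) t = fourier f t - fourier g t.
Proof.
move=> Lf Lg; rewrite !fourierE.
have := cintD (L1_mul_char t Lf) (L1Z (-1) (L1_mul_char t Lg)).
rewrite cintZ ?mulN1r; last exact: L1_mul_char.
move=> <-; congr cint; apply/funext => x /=.
by rewrite mulN1r mulrBl.
Qed.

End lebesgue_cV_change.

(** * The lattice, the dual cells, and sums over translates *)

Section dual_cells.
Context {R : realType} {n : nat} (A : 'M[R]_n) (uA : A \in unitmx).
Local Notation V := 'cV[R]_n.
Local Notation leb := (lebesgue_cV n : {sigma_finite_measure set 'cV[R]_n -> \bar R}).
Implicit Types (k m : 'cV[int]_n) (s : seq 'cV[int]_n).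

Definition latp k : V := A *m intv k.

Definition dualp (c : V) : V := invmx A^T *m c.

Lemma uAT : A^T \in unitmx.
Proof. by rewrite unitmx_tr. Qed.

Lemma dualpK c : A^T *m dualp c = c.
Proof. by rewrite /dualp mulmxA mulmxV ?mul1mx// uAT. Qed.

Lemma dualpVK t : dualp (A^T *m t) = t.
Proof. by rewrite /dualp mulmxA mulVmx ?mul1mx// uAT. Qed.

Lemma dualpD c c' : dualp (c + c') = dualp c + dualp c'.
Proof. exact: mulmxDr. Qed.

Lemma dualpN c : dualp (- c) = - dualp c.
Proof. exact: mulmxN. Qed.

Lemma dot_dualp c k : dot (dualp c) (latp k) = dot c (intv k).
Proof. by rewrite dot_mulmx dualpK. Qed.

Lemma expchar_dual_lat m k : expchar (dualp (intv m)) (latp k) = 1 :> R[i].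
Proof. by have [z zE] := @dot_intv R n m k; apply: (@expchar_dot_int _ _ _ _ z); rewrite dot_dualp. Qed.

Lemma measurable_dualp : measurable_fun setT dualp.
Proof. exact: measurable_mulmx. Qed.

Definition cell m : set V := [set t | cube n (A^T *m t - intv m)].

Lemma measurable_cell m : measurable (cell m).
Proof.
have mf := measurableT_comp (measurable_shift_cV (- intv m)) (measurable_mulmx A^T).
rewrite -[cell m]setTI; exact: (mf measurableT _ (@measurable_cube R n)).
Qed.

Lemma cell_uniq m m' t : cell m t -> cell m' t -> m = m'.
Proof.
move=> mt mt'; apply/matrixP => i j; rewrite ord1.
have := mt i; have := mt' i; rewrite /= !in_itv /= !mxE.
set x := \sum_j _ => /andP[a1 a2] /andP[b1 b2].
have h1 : (m i ord0)%:~R - (m' i ord0)%:~R < (1 : R) by lra.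
have h2 : (m' i ord0)%:~R - (m i ord0)%:~R < (1 : R) by lra.
move: h1 h2; rewrite -!rmorphB /= !ltrz1 => h1 h2.
by apply/eqP; rewrite eq_le -!ltzD1 -!ltrBlDl h1 h2.
Qed.

Lemma cell_cover t : exists m, cell m t.
Proof.
pose c := A^T *m t; exists (\col_i Num.floor (c i ord0 + 2^-1)) => i.
rewrite /= in_itv /= mxE -/c.
have -> : (- intv (\col_i Num.floor (c i ord0 + 2^-1))) i ord0 =
  - (Num.floor (c i ord0 + 2^-1))%:~R :> R by rewrite !mxE.
have /andP[h1 h2] := floor_itv (c i ord0 + 2^-1).
by move: h2; rewrite intrD; lra.
Qed.

(** The cell is the image of the cube under the affine map [c |-> A^-T (c + m)], whose
    Jacobian is [1 / |det A|]. *)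
Lemma ge0_integral_cell m (h : V -> \bar R) : measurable_fun setT h ->
  (forall t, 0 <= h t)%E ->
  (`|\det A|%:E * \int[leb]_(t in cell m) h t =
   \int[cube_measure]_c h (dualp (c + intv m)))%E.
Proof.
move=> mh h0; pose g := h \_ (cell m).
have mg : measurable_fun setT g.
  by apply: (measurable_restrictT _ (measurable_cell m)).1; exact: measurable_funTS.
have g0 t : (0 <= g t)%E by rewrite /g /patch; case: ifPn.
have uB : invmx A^T \in unitmx by rewrite unitmx_inv uAT.
have mgB : measurable_fun setT (g \o dualp).
  by apply: (measurableT_comp mg); exact: measurable_dualp.
rewrite [X in (_ * X)%E]integral_mkcond -/g -(linear_change_unitmx uB mg g0).
rewrite muleA -EFinM -normrM det_inv det_tr divff ?normr1 ?mul1e; last first.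
  by rewrite -unitfE -unitmxE.
rewrite -[LHS](lebesgue_cV_shift (intv m) mgB)//; last by move=> c; exact: g0.
rewrite ge0_integral_restr//; last first.
  apply: (measurableT_comp mh).
  exact: (measurableT_comp measurable_dualp (measurable_shift_cV _)).
rewrite [RHS]integral_mkcond; apply: eq_integral => c _.
rewrite /g /patch /=; suff -> : (dualp (c + intv m) \in cell m) = (c \in cube n) by [].
by apply/idP/idP; rewrite !inE /cell /= dualpK addrK.
Qed.

Definition cells s : set V := \big[setU/set0]_(m <- s) cell m.

Lemma cellsP s t : cells s t <-> exists2 m, m \in s & cell m t.
Proof.
rewrite /cells; split.
  by rewrite -bigcup_seq => -[m /= ms mt]; exists m.
by move=> [m ms mt]; rewrite -bigcup_seq; exists m.
Qed.

Lemma measurable_cells s : measurable (cells s).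
Proof. by apply: bigsetU_measurable => m _; exact: measurable_cell. Qed.

Lemma ge0_integral_cells s (h : V -> \bar R) : uniq s -> measurable_fun setT h ->
  (forall t, 0 <= h t)%E ->
  (`|\det A|%:E * \int[leb]_(t in cells s) h t =
   \sum_(m <- s) \int[cube_measure]_c h (dualp (c + intv m)))%E.
Proof.
move=> us mh h0; rewrite ge0_integral_bigsetU//=.
- rewrite ge0_sume_distrr; last by move=> m _; exact: integral_ge0.
  by apply: eq_bigr => m _; exact: ge0_integral_cell.
- by move=> m; exact: measurable_cell.
- by move=> m m' _ _ [t [mt m't]]; exact: cell_uniq mt m't.
- exact: measurable_funTS.
Qed.

End dual_cells.

Section synthesis.
Context {R : realType} {n : nat} (A : 'M[R]_n) (uA : A \in unitmx).
Local Notation V := 'cV[R]_n.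
Local Notation leb := (lebesgue_cV n : {sigma_finite_measure set 'cV[R]_n -> \bar R}).
Context (O : set V) (mO : measurable O) (finO : (leb O < +oo)%E).
Hypothesis disjO : forall (k k' : 'cV[int]_n) (y : V),
  O (y + latp A k) -> O (y + latp A k') -> k = k'.
Implicit Types (k m : 'cV[int]_n) (s : seq 'cV[int]_n) (g : 'cV[int]_n -> V -> R[i]).

Definition base_measure : {finite_measure set V -> \bar R} := restr_measure mO finO.

Local Notation nu := base_measure.

(** Every function on the union of the translates [O - A k] that vanishes off finitely
    many of them has this form. With this sign the translate of index [k] contributes
    the factor [expchar (intv k) c] to the transform. *)
Definition synth s g : V -> R[i] :=
  fun y => \sum_(k <- s) trunc O (g k) (y + latp A k).

Lemma sqn_trunc_base (f : V -> R[i]) : cmeas f -> sqn leb (trunc O f) = sqn nu f.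
Proof. by move=> mf; rewrite [RHS]sqn_restr. Qed.

Lemma L2_trunc_base (f : V -> R[i]) : L2 nu f -> L2 leb (trunc O f).
Proof.
by move=> [mf fo]; split; [exact: cmeas_trunc|rewrite sqn_trunc_base].
Qed.

Lemma L1_trunc_base (f : V -> R[i]) : L2 nu f -> L1 leb (trunc O f).
Proof.
move=> Lf; have LO : L2 leb (trunc O (fun=> 1)).
  apply: L2_trunc_base; split; first exact: cmeas_cst.
  apply: (@le_lt_trans _ _ (leb O)) => //.
  rewrite /sqn; under eq_integral do rewrite abs2_1.
  by rewrite integral_cst// mul1e restr_measure_setT.
have := L1_mul_conj (L2_trunc_base Lf) LO; congr L1; apply/funext => x.
by rewrite !truncE; case: ifPn; rewrite ?mul0r// rmorph1 mulr1.
Qed.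

Lemma cint_trunc_base (f : V -> R[i]) : cmeas f -> cint leb (trunc O f) = cint nu f.
Proof.
have key (u : V -> R) : measurable_fun setT u ->
    (\int[leb]_x (\1_O x * u x) = \int[nu]_x u x)%R.
  move=> mu; rewrite /Rintegral integral_restr; last exact/measurable_EFinP.
  rewrite [in RHS]integral_mkcond; congr fine; apply: eq_integral => x _.
  by rewrite /patch indicE; case: ifPn => _; rewrite ?mul1r ?mul0r.
move=> [m1 m2]; apply: complex_eq => /=; rewrite -key//; apply: eq_Rintegral => x _.
- by rewrite cReM /= mul0r subr0.
- by rewrite cImM /= mul0r addr0.
Qed.

Lemma L1_synth s g : (forall k, L2 nu (g k)) -> L1 leb (synth s g).
Proof.
move=> Lg; have := cint_sum (m := leb) s (F := fun k y => trunc O (g k) (y + latp A k)).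
case=> // k; apply: (@L1_shift _ _ _ (trunc O (g k))); exact: L1_trunc_base.
Qed.

Lemma sqn_synth s g : uniq s -> (forall k, L2 nu (g k)) ->
  sqn leb (synth s g) = (\sum_(k <- s) sqn nu (g k))%E.
Proof.
move=> us Lg.
have mg k : cmeas (g k) by have [] := Lg k.
have mt k : cmeas (fun y : V => trunc O (g k) (y + latp A k)).
  by apply: (@cmeas_shift _ _ _ (trunc O (g k))); exact: cmeas_trunc.
transitivity (\int[leb]_y (\sum_(k <- s)
    (abs2 (trunc O (g k) (y + latp A k)))%:E))%E.
  apply: eq_integral => y _; rewrite /synth sumEFin; congr EFin.
  have [[k ks Ok]|H] := pselect (exists2 k, k \in s & O (y + latp A k)).
    have z k' : k' != k -> trunc O (g k') (y + latp A k') = 0.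
      move=> kk'; rewrite truncE ifN//; apply/negP; rewrite inE => Ok'.
      by move/eqP: kk'; apply; exact: disjO Ok' Ok.
    rewrite (bigD1_seq k)//= [X in abs2 (_ + X)]big1; last by move=> k' /z.
    rewrite [RHS](bigD1_seq k)//= [X in _ = _ + X]big1 ?addr0//.
    by move=> k' /z ->; rewrite abs2_0.
  have z k : k \in s -> trunc O (g k) (y + latp A k) = 0.
    by move=> ks; rewrite truncE ifN//; apply/negP; rewrite inE => Ok; apply: H; exists k.
  rewrite big_seq big1; last by move=> k /z.
  by rewrite abs2_0 big_seq big1// => k /z ->; rewrite abs2_0.
rewrite ge0_integral_sum//.
- apply: eq_bigr => k _; rewrite -sqn_trunc_base//.
  exact: (sqn_shift _ (cmeas_trunc mO (mg k))).
- by move=> k; exact: emeasurable_abs2.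
- by move=> k y _; rewrite lee_fin abs2_ge0.
Qed.

Lemma L2_synth s g : uniq s -> (forall k, L2 nu (g k)) -> L2 leb (synth s g).
Proof.
move=> us Lg; split; first by apply: L1_cmeas; exact: L1_synth.
by rewrite sqn_synth//; apply: lte_sum_pinfty => k _; have [] := Lg k.
Qed.

(** Translating by [A k] multiplies the transform at [t] by [expchar t (A k)], and at
    [t = A^-T (c + m)] this factor does not depend on [m], because [m] pairs integrally
    with [k]. *)
Lemma fourier_synth s g c m : (forall k, L2 nu (g k)) ->
  fourier (synth s g) (dualp A (c + intv m)) =
  ip nu (fun x => tensor_sum s g (c, x) * conjc (expchar (dualp A c) x))
        (expchar (dualp A (intv m))).
Proof.
move=> Lg; set t := dualp A (c + intv m).
have mg k : cmeas (g k) by have [] := Lg k.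
have mt k : cmeas (fun y : V => trunc O (g k) (y + latp A k)).
  by apply: (@cmeas_shift _ _ _ (trunc O (g k))); exact: cmeas_trunc.
have char_lat k : expchar t (latp A k) = expchar (intv k) c.
  rewrite /t dualpD expcharDl expchar_dual_lat// mulr1.
  by rewrite /expchar dot_dualp// dotC.
rewrite fourierE.
rewrite (_ : (fun x => _) = (fun x => \sum_(k <- s)
    trunc O (g k) (x + latp A k) * conjc (expchar t x))); last first.
  by apply/funext => x; rewrite /synth mulr_suml.
have LF k : L1 leb (fun x => trunc O (g k) (x + latp A k) * conjc (expchar t x)).
  by apply: L1_mul_char; apply: (@L1_shift _ _ _ (trunc O (g k))); exact: L1_trunc_base.
rewrite (cint_sum s LF).2.
rewrite (_ : (fun x => tensor_sum s g (c, x) * _) = (fun x => \sum_(k <- s)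
    expchar (intv k) c * (conjc (expchar (dualp A c) x) * g k x))); last first.
  apply/funext => x; rewrite /tensor_sum mulr_suml; apply: eq_bigr => k _ /=.
  by rewrite -mulrA [g k x * _]mulrC.
have Lgk k : L2 nu (fun x => conjc (expchar (dualp A c) x) * g k x).
  apply: (@L2M _ _ _ _ _ _ 1) => //; first by apply: cmeas_conj; exact: cmeas_expchar.
  by move=> x; rewrite abs2_conj abs2_expchar.
rewrite ip_sumZl//; last by apply: L2_expchar; exact: restr_measure_lty.
apply: eq_bigr => k _; rewrite -char_lat.
pose f x := trunc O (fun x => g k x * conjc (expchar t x)) x * expchar t (latp A k).
rewrite -[LHS](_ : cint leb (fun x => f (x + latp A k)) = _); last first.
  congr cint; apply/funext => x; rewrite /f !truncE; case: ifPn => _; rewrite ?mul0r//.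
  by rewrite -mulrA expcharDr rmorphM -mulrA [conjc _ * expchar _ _]mulrC
    expi_conjM mulr1.
have mgt : cmeas (fun x => g k x * conjc (expchar t x)).
  by apply: cmeasM => //; apply: cmeas_conj; exact: cmeas_expchar.
rewrite cint_shift; last first.
  by apply: cmeasM; [exact: cmeas_trunc|exact: cmeas_cst].
rewrite (_ : f = fun x => expchar t (latp A k) *
    trunc O (fun x => g k x * conjc (expchar t x)) x); last first.
  by apply/funext => x; rewrite /f mulrC.
rewrite cintZ; last first.
  apply: L1_trunc_base; have := Lg k => /(@L2M _ _ _ _ _ (fun x => conjc (expchar t x)) 1).
  rewrite (_ : (fun x => conjc (expchar t x) * g k x) =
    (fun x => g k x * conjc (expchar t x))).
    apply; first by apply: cmeas_conj; exact: cmeas_expchar.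
    by move=> x; rewrite abs2_conj abs2_expchar.
  by apply/funext => x; rewrite mulrC.
rewrite /ip (cint_trunc_base mgt); congr (_ * cint _ _); apply/funext => x.
rewrite /t dualpD expcharDl rmorphM mulrA; congr (_ * _).
by rewrite mulrC.
Qed.

End synthesis.

(** * Continuity of the norm *)

Section norm_continuity.
Context {R : realType} {d} {T : measurableType d} (m : {measure set T -> \bar R}).
Implicit Types (f : T -> R[i]).

Lemma nrm2D_le (e : R) f g : 0 < e -> L2 m f -> L2 m g ->
  nrm2 m (f \+ g) <= (1 + e) * nrm2 m f + (1 + e^-1) * nrm2 m g.
Proof.
move=> e0 Lf Lg; have [mf _] := Lf; have [mg _] := Lg.
have := sqnD_le m e0 mf mg.
by rewrite (sqnE (L2D Lf Lg)) (sqnE Lf) (sqnE Lg) -!EFinM -EFinD lee_fin.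
Qed.

Lemma nrm2N f : nrm2 m (fun x => - f x) = nrm2 m f.
Proof. by rewrite /nrm2 sqnN. Qed.

(** The parallelogram inequality with weight [e] compares the norms up to a factor
    [1 + e]; the weight is chosen according to the norm of the limit. *)
Lemma nrm2_cvg (g : nat -> T -> R[i]) f : L2 m f -> (forall j, L2 m (g j)) ->
  sqn m (g j \- f) @[j --> \oo] --> 0%E -> nrm2 m (g j) @[j --> \oo] --> nrm2 m f.
Proof.
move=> Lf Lg gf.
have df : (fun j => nrm2 m (g j \- f)) @ \oo --> (0 : R) by exact: (fine_cvg gf).
apply/cvgrPdist_le => eps eps0.
pose y := nrm2 m f; have y0 : 0 <= y by exact: nrm2_ge0.
have y1 : 0 < 8 * (y + 1) by rewrite mulr_gt0// ltr_wpDl.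
pose e := Num.min 1 (eps / (8 * (y + 1))).
have e0 : 0 < e by rewrite lt_min ltr01 divr_gt0.
have e1 : e <= 1 by rewrite /e ge_min lexx.
have ey : e * y <= eps / 8.
  apply: (@le_trans _ _ (eps / (8 * (y + 1)) * (y + 1))).
    apply: ler_pM => //; first exact: ltW.
      by rewrite /e ge_min lexx orbT.
    by rewrite lerDl.
  have y2 : y + 1 != 0 by rewrite gt_eqF// ltr_wpDl.
  by rewrite (_ : _ * _ = eps / 8)//; field.
have ie0 : 0 < 1 + e^-1 by rewrite addr_gt0// invr_gt0.
have eps2 : 0 < eps / 8 / (1 + e^-1) by rewrite !divr_gt0.
move/cvgrPdist_le: df => /(_ _ eps2); apply: filterS => j.
rewrite sub0r normrN ger0_norm ?nrm2_ge0// => dj.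
have {dj} : (1 + e^-1) * nrm2 m (g j \- f) <= eps / 8.
  by rewrite mulrC -ler_pdivlMr.
have Ld : L2 m (g j \- f) by exact: L2B.
have := nrm2D_le e0 Lf Ld; rewrite (_ : f \+ (g j \- f) = g j); last first.
  by apply/funext => x /=; rewrite addrC subrK.
have := nrm2D_le e0 (Lg j) (L2N Ld); rewrite nrm2N.
rewrite (_ : g j \+ (fun x => - (g j \- f) x) = f); last first.
  by apply/funext => x /=; rewrite opprB addrC subrK.
rewrite -/y; set z := nrm2 m (g j); set t := (1 + e^-1) * _ => H2 H1 H3.
have ez : e * z <= eps / 8 + eps / 8 + eps / 8.
  have h1 : e * z <= e * ((1 + e) * y + t) by rewrite ler_wpM2l// ltW.
  have h2 : e * (e * y) <= 1 * (e * y) by rewrite ler_wpM2r// mulr_ge0// ltW.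
  have t0 : 0 <= t by rewrite mulr_ge0 ?nrm2_ge0// ltW.
  have h3 : e * t <= 1 * t by rewrite ler_wpM2r.
  by move: h1; rewrite !mulrDr mulrDl mul1r mulrDr; lra.
by rewrite ler_norml; apply/andP; split; lra.
Qed.

End norm_continuity.

(** * Character coefficients on the base *)

Section enumeration.
Context {n : nat}.

(** An increasing exhaustion of the integer vectors by finite sets. *)
Definition initial_seq (N : nat) : seq 'cV[int]_n := undup (pmap unpickle (iota 0 N)).

Lemma initial_seq_uniq N : uniq (initial_seq N).
Proof. exact: undup_uniq. Qed.

Lemma mem_initial_seq (k : 'cV[int]_n) N : (pickle k < N)%N -> k \in initial_seq N.
Proof.
move=> kN; rewrite mem_undup mem_pmap; apply/mapP; exists (pickle k).
  by rewrite mem_iota.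
by rewrite pickleK.
Qed.

Lemma initial_seq_mono N N' : (N <= N')%N -> {subset initial_seq N <= initial_seq N'}.
Proof.
move=> NN' k; rewrite !mem_undup !mem_pmap => /mapP[i iN ->].
apply/mapP; exists i => //; move: iN; rewrite !mem_iota /= !add0n => iN.
exact: leq_trans NN'.
Qed.

Lemma near_initial_seq (k : 'cV[int]_n) : \forall N \near \oo, k \in initial_seq N.
Proof. by exists (pickle k).+1 => // N; exact: mem_initial_seq. Qed.

Context (M : set 'cV[int]_n).

Definition initial_in (N : nat) := [seq m <- initial_seq N | `[< M m >]].

Lemma initial_in_uniq N : uniq (initial_in N).
Proof. by rewrite filter_uniq ?initial_seq_uniq. Qed.

Lemma initial_inP N m : m \in initial_in N -> M m.
Proof. by rewrite mem_filter => /andP[/asboolP]. Qed.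

Lemma near_initial_in m : M m -> \forall N \near \oo, m \in initial_in N.
Proof.
move=> Mm; apply: filterS (near_initial_seq m) => N mN.
by rewrite mem_filter mN andbT; apply/asboolP.
Qed.

Lemma initial_in_mono N N' : (N <= N')%N -> {subset initial_in N <= initial_in N'}.
Proof.
move=> NN' m; rewrite !mem_filter => /andP[-> /=]; exact: initial_seq_mono.
Qed.

Lemma sub_initial_in (s : seq 'cV[int]_n) : (forall m, m \in s -> M m) ->
  \forall N \near \oo, {subset s <= initial_in N}.
Proof.
elim: s => [_|m s IH Ms]; first exact: nearW.
have := IH (fun k ks => Ms k (mem_behead (s := m :: s) ks)).
have := near_initial_in (Ms m (mem_head _ _)).
apply: filterS2 => N mN sN k; rewrite inE => /predU1P[->//|]; exact: sN.
Qed.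

Lemma ler_sum_subset (R : realType) (s s' : seq 'cV[int]_n) (a : 'cV[int]_n -> R) :
  uniq s -> uniq s' -> {subset s <= s'} -> (forall m, 0 <= a m) ->
  \sum_(m <- s) a m <= \sum_(m <- s') a m.
Proof.
move=> us us' ss' a0; rewrite [leRHS](bigID (mem s)) /=.
rewrite (_ : \sum_(m <- s) a m = \sum_(m <- s' | m \in s) a m).
  by rewrite lerDl sumr_ge0.
rewrite -[RHS]big_filter; apply: perm_big; apply: uniq_perm => //.
  exact: filter_uniq.
by move=> k; rewrite mem_filter /=; case: (boolP (k \in s)) => // /ss' ->.
Qed.

End enumeration.

Section coefficients.
Context {R : realType} {n : nat} (A : 'M[R]_n).
Local Notation V := 'cV[R]_n.
Context (nu : {finite_measure set V -> \bar R}).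
Hypothesis nu_gt0 : (0 < nu setT)%E.
Local Notation numeas := (nu : {measure set V -> \bar R}).
Local Notation prodm := (@cube_measure R n \x nu)%E.
Implicit Types (k m : 'cV[int]_n) (s : seq 'cV[int]_n) (H G : V * V -> R[i]).

(** The exponential with frequency the point of index [m] of the dual lattice. *)
Definition char m : V -> R[i] := expchar (dualp A (intv m)).

Definition vol : R := fine (numeas setT).

Lemma nu_lty : (numeas setT < +oo)%E.
Proof. by rewrite ltey_eq fin_num_measure. Qed.

Lemma volE : numeas setT = vol%:E.
Proof. by rewrite fineK// fin_num_measure. Qed.

Lemma vol_gt0 : 0 < vol.
Proof. by rewrite -lte_fin -volE. Qed.

Lemma L2_char m : L2 numeas (char m).
Proof. by apply: L2_expchar; exact: nu_lty. Qed.

Lemma nrm2_char m : nrm2 numeas (char m) = vol.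
Proof. by rewrite /nrm2 sqn_expchar. Qed.

Definition coef m H : V -> R[i] := fun c => ip numeas (fun x => H (c, x)) (char m).

Lemma cmeas_coef m H : cmeas H -> cmeas (coef m H).
Proof.
move=> mH; apply: (@cmeas_parametric _ _ _ _ _ nu (fun p => H p * conjc (char m p.2))).
apply: cmeasM => //; apply: cmeas_conj.
by apply: cmeas_expchar_comp; [exact: measurable_cst|exact: measurable_snd].
Qed.

Lemma base_coefB m H G : (forall c, L2 numeas (fun x => H (c, x))) ->
  (forall c, L2 numeas (fun x => G (c, x))) ->
  coef m (H \- G) = coef m H \- coef m G.
Proof.
move=> LH LG; apply/funext => c; rewrite /coef /=.
have := ipDl (LH c) (L2Z (-1) (LG c)) (L2_char m).
rewrite ipZl//; last exact: L2_char.
rewrite mulN1r => <-; congr ip; apply/funext => x /=; by rewrite mulN1r.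
Qed.

Lemma coef_cauchy_schwarz m (f : V -> R[i]) : L2 numeas f ->
  abs2 (ip numeas f (char m)) <= vol * nrm2 numeas f.
Proof. exact: (cauchy_schwarz L2_char nrm2_char vol_gt0). Qed.

(** Tonelli's theorem: the inequality is assumed on the fibers of finite norm, and on
    the others its right-hand side is infinite. *)
Lemma sum_sqn_coef_le s (K : R) H : 0 < K -> cmeas H ->
    (forall f, L2 numeas f ->
      \sum_(m <- s) abs2 (ip numeas f (char m)) <= K * nrm2 numeas f) ->
  (\sum_(m <- s) sqn cube_measure (coef m H) <= K%:E * sqn prodm H)%E.
Proof.
move=> K0 mH Hs; rewrite /sqn -ge0_integral_sum//; last 2 first.
- by move=> m; apply: emeasurable_abs2; exact: cmeas_coef.
- by move=> m c _; rewrite lee_fin abs2_ge0.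
rewrite -/(sqn prodm H) (sqn_prod _ mH) -ge0_integralZl//; last 3 first.
- apply: (measurable_fun_fubini_tonelli_F (fun p => (abs2 (H p))%:E)).
    exact: emeasurable_abs2.
  by move=> p; rewrite lee_fin abs2_ge0.
- by move=> c _; exact: sqn_ge0.
- by rewrite lee_fin ltW.
apply: ge0_le_integral => //.
- by move=> c _; apply: sume_ge0 => m _; rewrite lee_fin abs2_ge0.
- apply: emeasurable_sum => m; apply: emeasurable_abs2; exact: cmeas_coef.
- apply: measurable_funeM.
  apply: (measurable_fun_fubini_tonelli_F (fun p => (abs2 (H p))%:E)).
    exact: emeasurable_abs2.
  by move=> p; rewrite lee_fin abs2_ge0.
move=> c _; have mHc : cmeas (fun x => H (c, x)).
  exact: (cmeas_comp (pair1_measurable c) mH).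
have := sqn_ge0 numeas (fun x => H (c, x)); rewrite le_eqVlt => /predU1P[z|pos].
  have Lc : L2 numeas (fun x => H (c, x)) by split => //; rewrite -z.
  by rewrite (sqnE Lc) sumEFin -EFinM lee_fin; exact: Hs.
have [fin|] := boolP (sqn numeas (fun x => H (c, x)) < +oo)%E.
  have Lc : L2 numeas (fun x => H (c, x)) by split.
  by rewrite (sqnE Lc) sumEFin -EFinM lee_fin; exact: Hs.
rewrite -leNgt leye_eq => /eqP ->.
by rewrite gt0_muley ?leey// lte_fin.
Qed.

Lemma sqn_coef_le m H : cmeas H ->
  (sqn cube_measure (coef m H) <= vol%:E * sqn prodm H)%E.
Proof.
move=> mH; have := @sum_sqn_coef_le [:: m] vol H vol_gt0 mH.
rewrite big_seq1; apply => f Lf; rewrite big_seq1; exact: coef_cauchy_schwarz.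
Qed.

Lemma L2_coef m H : L2 prodm H -> L2 cube_measure (coef m H).
Proof.
move=> [mH Ho]; split; first exact: cmeas_coef.
apply: le_lt_trans (sqn_coef_le m mH) _.
by rewrite lte_mul_pinfty// lee_fin ltW ?vol_gt0.
Qed.

Section orthogonal_characters.
Context (M : set 'cV[int]_n).
Hypothesis orthM : forall m m', M m -> M m' -> m != m' ->
  ip numeas (char m) (char m') = 0.

Lemma ortho_char s : (forall m, m \in s -> M m) -> ortho_family numeas char s.
Proof. by move=> sM m m' ms m's; apply: orthM; exact: sM. Qed.

Lemma sum_sqn_coef_bessel s H : uniq s -> (forall m, m \in s -> M m) -> cmeas H ->
  (\sum_(m <- s) sqn cube_measure (coef m H) <= vol%:E * sqn prodm H)%E.
Proof.
move=> us sM mH; apply: sum_sqn_coef_le => //; first exact: vol_gt0.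
move=> f Lf; apply: (bessel L2_char nrm2_char vol_gt0) => //.
exact: ortho_char.
Qed.

Definition complete_chars := forall (f : V -> R[i]) (e : R), L2 numeas f -> 0 < e ->
  exists s a, [/\ uniq s, forall m, m \in s -> M m &
    nrm2 numeas (f \- (fun x => \sum_(m <- s) a m * char m x)) < e].

(** The Bessel defect decreases along the exhaustion, and the projection is at least as
    good as any given approximating combination. *)
Lemma parseval_cvg (f : V -> R[i]) : complete_chars -> L2 numeas f ->
  \sum_(m <- initial_in M N) abs2 (ip numeas f (char m)) @[N --> \oo] -->
  vol * nrm2 numeas f.
Proof.
move=> comp Lf; apply/cvgrPdist_le => e e0.
have [s [a [us sM fs]]] := comp _ _ Lf (divr_gt0 e0 vol_gt0).
apply: filterS (sub_initial_in sM) => N sN.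
have uN := initial_in_uniq M N.
have ub : \sum_(m <- initial_in M N) abs2 (ip numeas f (char m)) <= vol * nrm2 numeas f.
  apply: (bessel L2_char nrm2_char vol_gt0) => //.
  by apply: ortho_char => m; exact: initial_inP.
rewrite ger0_norm ?subr_ge0//.
have := proj_best L2_char nrm2_char vol_gt0 a us (ortho_char sM) Lf.
move=> /le_lt_trans/(_ fs); rewrite -(ltr_pM2l vol_gt0).
rewrite (nrm2_sub_proj L2_char nrm2_char vol_gt0 us (ortho_char sM) Lf).
rewrite [vol * (e / vol)]mulrC divfK ?gt_eqF ?vol_gt0// => /ltW H.
apply: le_trans H; rewrite lerB//.
by apply: ler_sum_subset => // m; exact: abs2_ge0.
Qed.

End orthogonal_characters.
End coefficients.

(** * Bessel's inequality for the Fourier transform *)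

Section spectral_transform.
Context {R : realType} {n : nat} (A : 'M[R]_n) (uA : A \in unitmx).
Local Notation V := 'cV[R]_n.
Local Notation leb := (lebesgue_cV n : {sigma_finite_measure set 'cV[R]_n -> \bar R}).
Context (O : set V) (mO : measurable O) (finO : (leb O < +oo)%E).
Hypothesis O_gt0 : (0 < leb O)%E.
Hypothesis disjO : forall (k k' : 'cV[int]_n) (y : V),
  O (y + latp A k) -> O (y + latp A k') -> k = k'.
Context (M : set 'cV[int]_n).
Implicit Types (k m : 'cV[int]_n) (s : seq 'cV[int]_n) (g : 'cV[int]_n -> V -> R[i]).

Local Notation nu := (base_measure mO finO).
Local Notation numeas := (nu : {measure set V -> \bar R}).
Local Notation prodm := (@cube_measure R n \x nu)%E.
Local Notation D := `|\det A|.
Local Notation vol := (vol nu).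

Lemma base_gt0 : (0 < numeas setT)%E.
Proof. by rewrite restr_measure_setT. Qed.

Lemma D_gt0 : 0 < D.
Proof. by rewrite normr_gt0 -unitfE -unitmxE. Qed.

(** The half-open cells make this a disjoint union; it differs by a null set from the
    union of closed cells. *)
Definition spec_set : set V := [set t | exists2 m, M m & cell A m t].

Definition domain : set V := [set y | exists k, O (y + latp A k)].

Lemma measurable_spec_set : measurable spec_set.
Proof.
rewrite (_ : spec_set = \bigcup_m (if `[< M m >] then cell A m else set0)).
  apply: countable_bigcupT_measurable => // m; case: ifPn => // _.
  exact: measurable_cell.
apply/seteqP; split=> [t [m Mm mt]|t [m _]].
  by exists m => //; rewrite asboolT.
by case: asboolP => // Mm mt; exists m.
Qed.

Lemma measurable_translate k : measurable [set y | O (y + latp A k)].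
Proof.
by rewrite -[X in measurable X]setTI; exact: (measurable_shift_cV (latp A k) measurableT mO).
Qed.

Lemma measurable_domain : measurable domain.
Proof.
rewrite (_ : domain = \bigcup_k [set y | O (y + latp A k)]).
  by apply: countable_bigcupT_measurable => // k; exact: measurable_translate.
by apply/seteqP; split=> [y [k Ok]|y [k _ Ok]]; exists k.
Qed.

Definition spec_norm (h : V -> R[i]) : \bar R := sqn leb (trunc spec_set h).

Lemma sqn_cells s (h : V -> R[i]) : uniq s -> cmeas h ->
  (D%:E * sqn leb (trunc (cells A s) h) =
   \sum_(m <- s) sqn cube_measure (fun c => h (dualp A (c + intv m))))%E.
Proof.
move=> us mh; have h0 t : (0 <= (abs2 (h t))%:E)%E by rewrite lee_fin abs2_ge0.
rewrite -[RHS](ge0_integral_cells uA us (emeasurable_abs2 mh) h0).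
congr (_ * _)%E; rewrite [RHS]integral_mkcond; apply: eq_integral => t _.
by rewrite truncE /patch; case: ifPn => // _; rewrite abs2_0.
Qed.

Lemma sqn_cells_le s (h : V -> R[i]) : (forall m, m \in s -> M m) -> cmeas h ->
  (sqn leb (trunc (cells A s) h) <= spec_norm h)%E.
Proof.
move=> sM mh; apply: le_sqn.
- by apply: cmeas_trunc => //; exact: measurable_cells.
- by apply: cmeas_trunc => //; exact: measurable_spec_set.
move=> t; rewrite !truncE; case: ifPn => [|_]; last by rewrite abs2_0 abs2_ge0.
rewrite inE => /cellsP[m ms mt]; rewrite mem_set//.
by exists m => //; exact: sM.
Qed.

Lemma trunc_cells_cvg (h : V -> R[i]) t :
  ccvg (fun N => trunc (cells A (initial_in M N)) h t) (trunc spec_set h t).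
Proof.
have [[m Mm mt]|tS] := pselect (spec_set t); last first.
  rewrite [trunc spec_set h t]truncE memNset//.
  rewrite (_ : (fun N => _) = fun=> 0); first exact: ccvg_cst.
  apply/funext => N; rewrite truncE memNset// => /cellsP[m ms mt].
  by apply: tS; exists m => //; exact: initial_inP ms.
rewrite [trunc spec_set h t]truncE mem_set//; last by exists m.
apply: cvg_trunc; apply: filterS (near_initial_in Mm) => N mN.
by apply/cellsP; exists m.
Qed.

Lemma spec_norm_le (h : V -> R[i]) (K : R) : cmeas h ->
  (forall N, D%:E * sqn leb (trunc (cells A (initial_in M N)) h) <= K%:E)%E ->
  (D%:E * spec_norm h <= K%:E)%E.
Proof.
move=> mh H; have D0 := D_gt0.
have KE : K%:E = (D%:E * (K / D)%:E)%E by rewrite -EFinM mulrC divfK// gt_eqF.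
rewrite KE lee_pmul2l// ?lte_fin//.
apply: (@fatou_sqn _ _ _ leb (fun N => trunc (cells A (initial_in M N)) h)).
- by move=> N; apply: cmeas_trunc => //; exact: measurable_cells.
- exact: trunc_cells_cvg.
- by apply: nearW => N; have := H N; rewrite KE lee_pmul2l// lte_fin.
Qed.

(** Absorbs the frequency offset [dualp c] into the function, so that the values of the
    transform on the lattice shifted by [dualp c] are plain character coefficients. *)
Definition twist (F : V * V -> R[i]) : V * V -> R[i] :=
  fun p => F p * conjc (expchar (dualp A p.1) p.2).

Lemma cmeas_twist_char : cmeas (fun p : V * V => expchar (dualp A p.1) p.2).
Proof.
apply: cmeas_expchar_comp; last exact: measurable_snd.
exact: (measurableT_comp (measurable_dualp A) measurable_fst).
Qed.

Lemma cmeas_twist F : cmeas F -> cmeas (twist F).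
Proof. by move=> mF; apply: cmeasM => //; apply: cmeas_conj; exact: cmeas_twist_char. Qed.

Lemma sqn_twist F : sqn prodm (twist F) = sqn prodm F.
Proof.
by apply: eq_integral => p _; rewrite /twist abs2M abs2_conj abs2_expchar mulr1.
Qed.

Lemma L2_twist_slice s g c : (forall k, L2 numeas (g k)) ->
  L2 numeas (fun x => twist (tensor_sum s g) (c, x)).
Proof.
move=> Lg; rewrite /twist /tensor_sum /=.
rewrite (_ : (fun x => _) = (fun x => conjc (expchar (dualp A c) x) *
    \sum_(k <- s) expchar (intv k) c * g k x)).
  apply: (@L2M _ _ _ _ _ _ 1).
  - by apply: cmeas_conj; exact: cmeas_expchar.
  - by move=> x; rewrite abs2_conj abs2_expchar.
  - by apply: L2_sum => k; exact: L2Z.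
by apply/funext => x; rewrite mulrC.
Qed.

Lemma fourier_synth_coef s g m : (forall k, L2 numeas (g k)) ->
  (fun c => fourier (synth A O s g) (dualp A (c + intv m))) =
  coef A nu m (twist (tensor_sum s g)).
Proof. by move=> Lg; apply/funext => c; rewrite (fourier_synth uA s c m Lg). Qed.

Lemma sqn_twist_tensor s g : uniq s -> (forall k, L2 numeas (g k)) ->
  sqn prodm (twist (tensor_sum s g)) = sqn leb (synth A O s g).
Proof. by move=> us Lg; rewrite sqn_twist sqn_tensor_sum// (sqn_synth disjO). Qed.

(** Carries the piece of [f] on the translate [O - A k] back to the base [O]. *)
Definition fibers (f : V -> R[i]) k : V -> R[i] := fun x => f (x - latp A k).

Lemma L2_fibers f k : L2 leb f -> L2 numeas (fibers f k).
Proof.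
move=> [mf fo]; have mfk : cmeas (fibers f k) by exact: cmeas_shift.
split => //; rewrite -(sqn_trunc_base mO finO mfk).
apply: (@le_lt_trans _ _ (sqn leb (fibers f k))).
  apply: le_sqn => //; first exact: cmeas_trunc.
  by move=> x; exact: abs2_trunc_le.
by rewrite (sqn_shift _ mf).
Qed.

Definition partial_domain N : set V :=
  [set y | (exists2 k, k \in @initial_seq n N & O (y + latp A k)) \/ ~ domain y].

Lemma measurable_partial_domain N : measurable (partial_domain N).
Proof.
rewrite (_ : partial_domain N =
    \big[setU/set0]_(k <- @initial_seq n N) [set y | O (y + latp A k)] `|` ~` domain).
  apply: measurableU; last exact: measurableC measurable_domain.
  by apply: bigsetU_measurable => k _; exact: measurable_translate.
rewrite -bigcup_seq; apply/seteqP; split=> y [[k ks Ok]|?]; by [left; exists k|right].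
Qed.

Lemma near_partial_domain y : \forall N \near \oo, partial_domain N y.
Proof.
have [[k Ok]|yD] := pselect (domain y); last by apply: nearW => N; right.
by apply: filterS (near_initial_seq k) => N kN; left; exists k.
Qed.

Lemma synth_fibers N f : trunc domain f = f ->
  synth A O (@initial_seq n N) (fibers f) = trunc (partial_domain N) f.
Proof.
move=> fD; apply/funext => y; rewrite /synth truncE.
have fibE k : trunc O (fibers f k) (y + latp A k) = if y + latp A k \in O then f y else 0.
  by rewrite truncE /fibers addrK.
have [[k ks Ok]|H] := pselect (exists2 k, k \in @initial_seq n N & O (y + latp A k)).
  rewrite (bigD1_seq k) ?initial_seq_uniq//= fibE (mem_set Ok) [X in _ + X]big1 ?addr0.
    by rewrite mem_set//; left; exists k.
  move=> k' kk'; rewrite fibE memNset// => Ok'; move/eqP: kk'; apply.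
  exact: disjO Ok' Ok.
rewrite big_seq big1.
  case: ifPn => //; rewrite inE => -[//|yD].
  by rewrite -fD truncE memNset.
by move=> k ks; rewrite fibE memNset// => Ok; apply: H; exists k.
Qed.

Section supported.
Context (f : V -> R[i]).
Hypothesis fD : trunc domain f = f.
Hypothesis L1f : L1 leb f.
Hypothesis L2f : L2 leb f.

Definition partial N := synth A O (@initial_seq n N) (fibers f).

Lemma L2_partial N : L2 leb (partial N).
Proof.
by apply: (L2_synth disjO (initial_seq_uniq N)) => k; exact: L2_fibers.
Qed.

Lemma L1_partial N : L1 leb (partial N).
Proof. by apply: (@L1_synth _ _ _ _ mO finO) => k; exact: L2_fibers. Qed.

Lemma partial_cvg : sqn leb (partial N \- f) @[N --> \oo] --> 0%E.
Proof.
rewrite /partial; under eq_fun do rewrite synth_fibers//.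
apply: sqn_sub_trunc_cvg => //; first exact: measurable_partial_domain.
exact: near_partial_domain.
Qed.

Lemma fourier_partial_cvg t : ccvg (fun N => fourier (partial N) t) (fourier f t).
Proof.
rewrite fourierE; under eq_fun do rewrite fourierE /partial synth_fibers//.
have := cint_trunc_cvg measurable_partial_domain near_partial_domain (L1_mul_char t L1f).
rewrite (_ : (fun N => cint _ (trunc _ _)) = (fun N =>
    cint leb (fun x => trunc (partial_domain N) f x * conjc (expchar t x))))//.
apply/funext => N; congr cint; apply/funext => x.
by rewrite !truncE; case: ifPn => //; rewrite mul0r.
Qed.

Section bessel.
Hypothesis orthM : forall m m', M m -> M m' -> m != m' ->
  ip numeas (char A m) (char A m') = 0.

(** For fixed [c] the values of the transform at the points [dualp (c + m)] are the
    coefficients of a single function on the base: Bessel's inequality for it integrates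
    over [c]. *)
Lemma spec_norm_synth_le s g : uniq s -> (forall k, L2 numeas (g k)) ->
  (D%:E * spec_norm (fourier (synth A O s g)) <= vol%:E * sqn leb (synth A O s g))%E.
Proof.
move=> us Lg; have Ls := L2_synth disjO us Lg.
have mF : cmeas (fourier (synth A O s g)) by apply: cmeas_fourier; have [] := Ls.
rewrite (sqnE Ls) -EFinM; apply: spec_norm_le => // N.
rewrite sqn_cells ?initial_in_uniq//.
under eq_bigr do rewrite fourier_synth_coef//.
rewrite EFinM -(sqnE Ls) -sqn_twist_tensor//.
apply: (@sum_sqn_coef_bessel _ _ _ _ base_gt0 M) => //.
- exact: initial_in_uniq.
- by move=> m; exact: initial_inP.
- by apply: cmeas_twist; apply: cmeas_tensor_sum => k; have [] := Lg k.
Qed.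

(** The partial sums over finitely many translates converge in [L^1] and [L^2], so their
    transforms converge pointwise and Fatou's lemma applies. *)
Theorem spec_norm_fourier_le :
  (D%:E * spec_norm (fourier f) <= vol%:E * sqn leb f)%E.
Proof.
have D0 := D_gt0; have v0 := vol_gt0 base_gt0.
have mFp N : cmeas (fourier (partial N)) by apply: cmeas_fourier; have [] := L2_partial N.
apply/lee_addgt0Pr => e e0.
have L2fE := sqnE L2f.
have nc := nrm2_cvg L2f L2_partial partial_cvg.
have e1 : 0 < e / vol by rewrite divr_gt0.
have nle : \forall N \near \oo, nrm2 leb (partial N) <= nrm2 leb f + e / vol.
  move/cvgrPdist_le: nc => /(_ _ e1); apply: filterS => N.
  by rewrite ler_norml => /andP[]; lra.
rewrite L2fE -EFinM -EFinD.
have KE : (vol * nrm2 leb f + e)%:E = (D%:E * ((vol * nrm2 leb f + e) / D)%:E)%E.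
  by rewrite -EFinM [D * _]mulrC divfK// gt_eqF.
rewrite KE lee_pmul2l// ?lte_fin//.
apply: (@fatou_sqn _ _ _ leb (fun N => trunc spec_set (fourier (partial N)))).
- by move=> N; apply: cmeas_trunc => //; exact: measurable_spec_set.
- move=> t; apply: ccvgM; first exact: ccvg_cst.
  exact: fourier_partial_cvg.
apply: filterS nle => N HN.
have := spec_norm_synth_le (initial_seq_uniq N) (fun k => L2_fibers k L2f).
rewrite -/(partial N) (sqnE (L2_partial N)) -EFinM => H.
have : (D%:E * spec_norm (fourier (partial N)) <= (vol * nrm2 leb f + e)%:E)%E.
  apply: le_trans H _; rewrite lee_fin.
  apply: le_trans (ler_wpM2l (ltW v0) HN) _.
  by rewrite mulrDr [vol * (e / vol)]mulrC divfK// gt_eqF.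
by rewrite KE lee_pmul2l// lte_fin.
Qed.

Lemma spec_norm_lty : (spec_norm (fourier f) < +oo)%E.
Proof.
have D0 := D_gt0; have := spec_norm_fourier_le; rewrite (sqnE L2f) -EFinM => H.
rewrite ltey; apply/eqP => E; move: H; rewrite E gt0_muley ?lte_fin//.
Qed.

End bessel.
End supported.
End spectral_transform.

(** * Parseval's identity for the Fourier transform *)

Lemma cvg_scale {R : realType} (a : R) (u : nat -> R) (l : R) :
  u @ \oo --> l -> a * u N @[N --> \oo] --> a * l.
Proof. by move=> ul; apply: cvgM => //; exact: cvg_cst. Qed.

Section isometry.
Context {R : realType} {n : nat} (A : 'M[R]_n) (uA : A \in unitmx).
Local Notation V := 'cV[R]_n.
Local Notation leb := (lebesgue_cV n : {sigma_finite_measure set 'cV[R]_n -> \bar R}).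
Context (O : set V) (mO : measurable O) (finO : (leb O < +oo)%E).
Hypothesis O_gt0 : (0 < leb O)%E.
Hypothesis disjO : forall (k k' : 'cV[int]_n) (y : V),
  O (y + latp A k) -> O (y + latp A k') -> k = k'.
Context (M : set 'cV[int]_n).
Implicit Types (k m : 'cV[int]_n) (s : seq 'cV[int]_n) (g : 'cV[int]_n -> V -> R[i]).

Local Notation nu := (base_measure mO finO).
Local Notation numeas := (nu : {measure set V -> \bar R}).
Local Notation prodm := (@cube_measure R n \x nu)%E.
Local Notation D := `|\det A|.
Local Notation vol := (vol nu).
Local Notation spec_norm := (spec_norm A M).
Local Notation spec_set := (spec_set A M).
Local Notation twist := (twist A).
Local Notation coef := (coef A nu).
Local Notation char := (char A).
Implicit Types (H G : V * V -> R[i]).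

Let D0 : 0 < D := D_gt0 uA.
Let nu0 : (0 < numeas setT)%E := base_gt0 mO finO O_gt0.
Let v0 : 0 < vol := vol_gt0 nu0.

Lemma trunc_subE (B : set V) (f h : V -> R[i]) : trunc B (f \- h) = trunc B f \- trunc B h.
Proof. by apply/funext => x /=; rewrite /trunc /= mulrBr. Qed.

Lemma L2_spec (f : V -> R[i]) : cmeas f -> (spec_norm f < +oo)%E -> L2 leb (trunc spec_set f).
Proof. by move=> mf fo; split => //; apply: cmeas_trunc => //; exact: measurable_spec_set. Qed.

Lemma L2_twist_tensor s g : uniq s -> (forall k, L2 numeas (g k)) ->
  L2 prodm (twist (tensor_sum s g)).
Proof.
move=> us Lg; split.
  by apply: cmeas_twist; apply: cmeas_tensor_sum => k; have [] := Lg k.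
by rewrite sqn_twist sqn_tensor_sum//; apply: lte_sum_pinfty => k _; have [] := Lg k.
Qed.

(** The twist is unitary, so density passes from tensors to twisted tensors. *)
Lemma twisted_tensors_dense G (e : R) : L2 prodm G -> 0 < e ->
  exists s g, [/\ uniq s, forall k, L2 numeas (g k) &
    (sqn prodm (twist (tensor_sum s g) \- G)%R < e%:E)%E].
Proof.
move=> [mG Go] e0; pose G' p := G p * expchar (dualp A p.1) p.2.
have GG' : twist G' = G.
  by apply/funext => p; rewrite /twist /G' -mulrA mul_conjc abs2_expchar mulr1.
have LG' : L2 prodm G'.
  split; first by apply: cmeasM => //; exact: cmeas_twist_char.
  by rewrite -(sqn_twist A) GG'.
have [F [s [g [[us Lg _] ->]]] Fe] := tensors_dense LG' e0.
exists s, g; split => //.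
rewrite (_ : _ \- G = twist (tensor_sum s g \- G')) ?sqn_twist//.
by rewrite -GG'; apply/funext => p; rewrite /twist /= mulrBl.
Qed.

Lemma sqn_cells_synth s' s g : uniq s' -> uniq s -> (forall k, L2 numeas (g k)) ->
  (D%:E * sqn leb (trunc (cells A s') (fourier (synth A O s g))) =
   \sum_(m <- s') sqn cube_measure (coef m (twist (tensor_sum s g))))%E.
Proof.
move=> us' us Lg; have [mf _] := L2_synth disjO us Lg.
rewrite (sqn_cells uA us' (cmeas_fourier mf)); apply: eq_bigr => m _.
by rewrite (fourier_synth_coef uA s m Lg).
Qed.

(** ** From the spectral property of the base to the isometry *)
Section complete.
Hypothesis orthM : forall m m', M m -> M m' -> m != m' ->
  ip numeas (char m) (char m') = 0.

Lemma L2_spec_fourier f : trunc (domain A O) f = f -> L1 leb f -> L2 leb f ->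
  L2 leb (trunc spec_set (fourier f)).
Proof.
move=> fD L1f L2f; apply: L2_spec.
  by apply: cmeas_fourier; have [] := L2f.
exact: (spec_norm_lty uA O_gt0 disjO fD L1f L2f orthM).
Qed.

Lemma nrm2_spec_fourier_le f : trunc (domain A O) f = f -> L1 leb f -> L2 leb f ->
  D * nrm2 leb (trunc spec_set (fourier f)) <= vol * nrm2 leb f.
Proof.
move=> fD L1f L2f; rewrite -lee_fin !EFinM -(sqnE L2f) -sqnE; last exact: L2_spec_fourier.
exact: (spec_norm_fourier_le uA O_gt0 disjO fD L1f L2f orthM).
Qed.

Hypothesis comp : complete_chars A nu M.

(** Parseval's identity holds for each [c]; monotone convergence integrates it. *)
Lemma sum_sqn_coef_parseval H : cmeas H ->
    (forall c, L2 numeas (fun x => H (c, x))) ->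
  \sum_(m <- initial_in M N) sqn cube_measure (coef m H) @[N --> \oo] -->
  (vol%:E * sqn prodm H)%E.
Proof.
move=> mH LH.
have mq : measurable_fun setT (fun c => sqn numeas (fun x => H (c, x))).
  apply: (measurable_fun_fubini_tonelli_F (fun p => (abs2 (H p))%:E)).
    exact: emeasurable_abs2.
  by move=> p; rewrite lee_fin abs2_ge0.
have ab0 m c : (0 <= (abs2 (coef m H c))%:E)%E by rewrite lee_fin abs2_ge0.
have mab m : measurable_fun setT (fun c => (abs2 (coef m H c))%:E).
  by apply: emeasurable_abs2; exact: cmeas_coef.
pose u N c := (\sum_(m <- initial_in M N) (abs2 (coef m H c))%:E)%E.
rewrite (_ : (vol%:E * _)%E = (\int[cube_measure]_c limn (u ^~ c))%E); last first.
  rewrite (sqn_prod _ mH) -ge0_integralZl//; last 2 first.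
  - by move=> c _; exact: sqn_ge0.
  - by rewrite lee_fin ltW.
  apply: eq_integral => c _; apply/esym/cvg_lim => //.
  rewrite (sqnE (LH c)) -EFinM /u; under eq_fun do rewrite sumEFin.
  by apply: cvg_EFin; [exact: nearW|exact: (parseval_cvg nu0 orthM comp (LH c))].
rewrite (_ : (fun N => _) = (fun N => \int[cube_measure]_c u N c)%E); last first.
  by apply/funext => N; rewrite ge0_integral_sum.
apply: cvg_monotone_convergence => //.
- by move=> N; exact: emeasurable_sum.
- by move=> N c _; exact: sume_ge0.
move=> c _ N N' NN'; rewrite /u !sumEFin lee_fin.
apply: ler_sum_subset => //; try exact: initial_in_uniq.
- exact: initial_in_mono.
- by move=> m; exact: abs2_ge0.
Qed.

Lemma nrm2_spec_synth s g : uniq s -> (forall k, L2 numeas (g k)) ->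
  trunc (domain A O) (synth A O s g) = synth A O s g ->
  D * nrm2 leb (trunc spec_set (fourier (synth A O s g))) = vol * nrm2 leb (synth A O s g).
Proof.
move=> us Lg sD; have Ls := L2_synth disjO us Lg.
have L1s : L1 leb (synth A O s g) by exact: L1_synth.
have LF := L2_spec_fourier sD L1s Ls.
apply/eqP; rewrite eq_le nrm2_spec_fourier_le//= -lee_fin !EFinM -(sqnE Ls) -(sqnE LF).
rewrite -(sqn_twist_tensor disjO us Lg).
apply: (cvge_to_le (sum_sqn_coef_parseval _ _)).
- by have [] := L2_twist_tensor us Lg.
- by move=> c; exact: L2_twist_slice.
apply: nearW => N; rewrite -sqn_cells_synth//; last exact: initial_in_uniq.
rewrite lee_pmul2l// ?lte_fin//; apply: sqn_cells_le.
  by move=> m; exact: initial_inP.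
by apply: cmeas_fourier; have [] := Ls.
Qed.

(** Parseval's identity settles finitely many translates; Bessel's inequality applied to
    the differences carries it to the limit. *)
Theorem nrm2_spec_fourier f : trunc (domain A O) f = f -> L1 leb f -> L2 leb f ->
  D * nrm2 leb (trunc spec_set (fourier f)) = vol * nrm2 leb f.
Proof.
move=> fD L1f L2f; pose p N := partial A O f N.
have Lp N : L2 leb (p N) by exact: L2_partial.
have L1p N : L1 leb (p N) by exact: L1_partial.
have pD N : trunc (domain A O) (p N) = p N.
  rewrite /p /partial synth_fibers//; apply/funext => x; rewrite !truncE.
  by case: ifPn => // xD; case: ifPn => // _; rewrite -fD truncE (negbTE xD).
have pf : sqn leb (p N \- f) @[N --> \oo] --> 0%E by exact: partial_cvg.
have LFf := L2_spec_fourier fD L1f L2f.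
have LFp N := L2_spec_fourier (pD N) (L1p N) (Lp N).
have nsub N : D * nrm2 leb (trunc spec_set (fourier (p N)) \- trunc spec_set (fourier f)) <=
    vol * nrm2 leb (p N \- f).
  rewrite -trunc_subE.
  have -> : fourier (p N) \- fourier f = fourier (p N \- f).
    by apply/funext => t /=; rewrite fourierB.
  apply: nrm2_spec_fourier_le; last exact: L2B.
    by rewrite trunc_subE pD fD.
  have := L1D (L1p N) (L1Z (-1) L1f); congr L1.
  by apply/funext => x /=; rewrite mulN1r.
have c0 : sqn leb (trunc spec_set (fourier (p N)) \- trunc spec_set (fourier f))
    @[N --> \oo] --> 0%E.
  under eq_fun do rewrite (sqnE (L2B (LFp _) LFf)).
  apply: cvg_EFin; first exact: nearW.
  have pf' : vol / D * nrm2 leb (p N \- f) @[N --> \oo] --> (0 : R).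
    by rewrite -(mulr0 (vol / D)); apply: cvg_scale; exact: (fine_cvg pf).
  apply: (squeeze_cvgr _ (cvg_cst 0) pf'); apply: nearW => N.
  by rewrite nrm2_ge0/= mulrAC ler_pdivlMr// [X in X <= _]mulrC.
have l1 := @cvg_scale R D _ _ (nrm2_cvg LFf LFp c0).
have l2 := @cvg_scale R vol _ _ (nrm2_cvg L2f Lp pf).
rewrite -[LHS](cvg_lim (@Rhausdorff R) l1) -[RHS](cvg_lim (@Rhausdorff R) l2).
suff -> : (fun N => D * nrm2 leb (trunc spec_set (fourier (p N)))) =
  (fun N => vol * nrm2 leb (p N)) by [].
apply/funext => N; apply: nrm2_spec_synth; last exact: (pD N).
  exact: initial_seq_uniq.
by move=> k; exact: L2_fibers.
Qed.

End complete.
End isometry.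

(** * Density of the range *)

Section dual_synthesis.
Context {R : realType} {n : nat} (A : 'M[R]_n) (uA : A \in unitmx).
Local Notation V := 'cV[R]_n.
Local Notation leb := (lebesgue_cV n : {sigma_finite_measure set 'cV[R]_n -> \bar R}).
Context (O : set V) (mO : measurable O) (finO : (leb O < +oo)%E).
Hypothesis O_gt0 : (0 < leb O)%E.
Hypothesis disjO : forall (k k' : 'cV[int]_n) (y : V),
  O (y + latp A k) -> O (y + latp A k') -> k = k'.
Context (M : set 'cV[int]_n).
Implicit Types (k m : 'cV[int]_n) (s : seq 'cV[int]_n) (g : 'cV[int]_n -> V -> R[i]).

Local Notation nu := (base_measure mO finO).
Local Notation numeas := (nu : {measure set V -> \bar R}).
Local Notation prodm := (@cube_measure R n \x nu)%E.
Local Notation D := `|\det A|.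
Local Notation vol := (vol nu).
Local Notation spec_norm := (spec_norm A M).
Local Notation spec_set := (spec_set A M).
Local Notation twist := (twist A).
Local Notation coef := (coef A nu).
Local Notation char := (char A).
Implicit Types (H G : V * V -> R[i]).

Let D0 : 0 < D := D_gt0 uA.
Let nu0 : (0 < numeas setT)%E := base_gt0 mO finO O_gt0.
Let v0 : 0 < vol := vol_gt0 nu0.

Lemma eq_sqn_cube (u v : V -> R[i]) : cmeas u -> cmeas v ->
  (forall c, cube n c -> u c = v c) -> sqn cube_measure u = sqn cube_measure v.
Proof.
move=> mu mv uv; rewrite /sqn !ge0_integral_restr; last 4 first.
- exact: emeasurable_abs2.
- by move=> x; rewrite lee_fin abs2_ge0.
- exact: emeasurable_abs2.
- by move=> x; rewrite lee_fin abs2_ge0.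
by apply: eq_integral => c; rewrite inE => /uv ->.
Qed.

Definition on_cell m (h : V -> R[i]) : V -> R[i] := fun c => h (dualp A (c + intv m)).

Lemma cmeas_on_cell m h : cmeas h -> cmeas (on_cell m h).
Proof.
move=> mh; apply: (cmeas_comp _ mh).
exact: (measurableT_comp (measurable_dualp A) (measurable_shift_cV (intv m))).
Qed.

Lemma L2_on_cell m h : L2 leb h -> L2 cube_measure (on_cell m h).
Proof.
move=> [mh ho]; split; first exact: cmeas_on_cell.
have := sqn_cells uA (s := [:: m]) isT mh; rewrite big_seq1 => <-.
rewrite lte_mul_pinfty ?lee_fin ?ltW//; apply: le_lt_trans ho.
apply: le_sqn => //; first by apply: cmeas_trunc => //; exact: measurable_cells.
by move=> x; exact: abs2_trunc_le.
Qed.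

Lemma cube_cell m c : cube n c -> cell A m (dualp A (c + intv m)).
Proof. by move=> nc; rewrite /cell /= dualpK// addrK. Qed.

(** For [h] square integrable and orthogonal characters, this is the function whose
    coefficients over [c] are the values of [h] at the points [dualp (c + m)]. *)
Definition dual_synth s h : V * V -> R[i] :=
  fun p => \sum_(m <- s) (on_cell m h p.1 / vol%:C%C) * char m p.2.

Lemma L2_dual_synth s h : L2 leb h -> L2 prodm (dual_synth s h).
Proof.
move=> Lh; apply: L2_sum => m; have [mh _] := Lh.
rewrite (_ : (fun p => _) = (fun p => (vol%:C%C)^-1 * (on_cell m h p.1 * char m p.2))).
  apply: L2Z; have mF : cmeas (fun p : V * V => on_cell m h p.1 * char m p.2).
    apply: cmeasM; first exact: (cmeas_comp measurable_fst (cmeas_on_cell m mh)).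
    exact: (cmeas_comp measurable_snd (cmeas_expchar _)).
  split => //; rewrite sqn_prod//.
  rewrite (_ : (\int[_]_c _)%E = (vol%:E * sqn cube_measure (on_cell m h))%E).
    by rewrite lte_mul_pinfty ?lee_fin ?ltW//; have [] := L2_on_cell m Lh.
  rewrite /sqn -ge0_integralZl//; last 3 first.
  - by apply: emeasurable_abs2; exact: cmeas_on_cell.
  - by move=> c _; rewrite lee_fin abs2_ge0.
  - by rewrite lee_fin ltW.
  apply: eq_integral => c _; 
  have Lc := L2_char A nu m; have LZ := L2Z (on_cell m h c) Lc.
  rewrite -[LHS]/(sqn numeas (fun x => on_cell m h c * char m x)) (sqnE LZ).
  by rewrite (nrm2Z _ Lc) nrm2_char -EFinM mulrC.
by apply/funext => p; rewrite mulrCA mulrA mulrC; congr (_ * _); rewrite mulrC.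
Qed.

Lemma L2_dual_synth_slice s h c : L2 numeas (fun x => dual_synth s h (c, x)).
Proof.
apply: (@L2_sum _ _ _ _ _ s (fun m x => (on_cell m h c / vol%:C%C) * char m x)) => m.
by apply: L2Z; exact: L2_char.
Qed.

Hypothesis orthM : forall m m', M m -> M m' -> m != m' ->
  ip numeas (char m) (char m') = 0.

Lemma coef_dual_synth s h m : uniq s -> (forall m, m \in s -> M m) -> M m ->
  coef m (dual_synth s h) = fun c => if m \in s then on_cell m h c else 0.
Proof.
move=> us sM Mm; apply/funext => c; rewrite /coef /dual_synth /=.
rewrite ip_sumZl; [|by move=> k; exact: L2_char|exact: L2_char].
have z k : k \in s -> k != m -> on_cell k h c / vol%:C%C * ip numeas (char k) (char m) = 0.
  by move=> ks km; rewrite orthM ?mulr0//; exact: sM.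
case: ifPn => ms; last first.
  rewrite big_seq big1// => k ks; apply: z => //.
  by apply: contraNneq ms => <-.
rewrite (bigD1_seq m)//= big_seq_cond big1 ?addr0; last by move=> k /andP[] /z/[apply].
rewrite ipxx ?nrm2_char; last exact: L2_char.
by rewrite divfK// fmorph_eq0 gt_eqF.
Qed.

(** Transforms of functions supported on the domain approximate every square
    integrable function on the spectral set: cut it to finitely many cells, and
    approximate the function having the resulting coefficients by a twisted tensor. *)
Theorem fourier_range_dense h (e : R) : L2 leb h -> trunc spec_set h = h -> 0 < e ->
  exists f, [/\ trunc (domain A O) f = f, L1 leb f, L2 leb f &
    (sqn leb (trunc spec_set (fourier f) \- h)%R < e%:E)%E].
Proof.
move=> Lh hS e0; have [mh _] := Lh; have e4 : 0 < e / 4 by rewrite divr_gt0.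
pose B N := cells A (initial_in M N) `|` ~` spec_set.
have mB N : measurable (B N).
  apply: measurableU; first exact: measurable_cells.
  by apply: measurableC; exact: measurable_spec_set.
have nB t : \forall N \near \oo, B N t.
  have [[m Mm mt]|tS] := pselect (spec_set t); last by apply: nearW => N; right.
  by apply: filterS (near_initial_in Mm) => N mN; left; apply/cellsP; exists m.
have [N _ /(_ _ (leqnn N)) /= Ne] := ecvg0_lt (sqn_sub_trunc_cvg mB nB Lh) e4.
pose s := initial_in M N; pose h1 := trunc (B N) h.
have us : uniq s := initial_in_uniq M N.
have sM m : m \in s -> M m by exact: initial_inP.
have Lh1 : L2 leb h1 by exact: L2_trunc.
have [mh1 _] := Lh1.
(* Tolerance on the product that becomes e / 4 on the frequency side. *)
pose d := D * (e / 4) / vol; have d0 : 0 < d by rewrite divr_gt0// mulr_gt0.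
have [t [g [ut Lg Fd]]] := twisted_tensors_dense A (L2_dual_synth s Lh) d0.
set H := twist _ in Fd; set G := dual_synth s h in Fd.
pose f := synth A O t g; have Lf : L2 leb f by exact: L2_synth.
have [mf _] := Lf.
have LH : L2 prodm H by exact: L2_twist_tensor.
have LG : L2 prodm G by exact: L2_dual_synth.
exists f; split => //.
- apply/funext => y; rewrite truncE; case: ifPn => // yD.
  rewrite /f /synth big1// => k _; rewrite truncE memNset// => Ok.
  by move/negP: yD; apply; rewrite inE; exists k.
- exact: (L1_synth A t Lg).
have mff : cmeas (fourier f) by exact: cmeas_fourier.
have mS := measurable_spec_set A M.
have key : (D%:E * spec_norm (fourier f \- h1)%R <= (vol * d)%:E)%E.
  apply: spec_norm_le => //; first exact: cmeasB.
  move=> N'; rewrite sqn_cells ?initial_in_uniq//; last exact: cmeasB.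
  apply: (@le_trans _ _ (vol%:E * sqn prodm (H \- G)%R)%E); last first.
    by rewrite EFinM lee_pmul2l ?lte_fin// ltW.
  apply: le_trans (sum_sqn_coef_bessel nu0 orthM (initial_in_uniq M N') _ _); last 2 first.
  - by move=> m; exact: initial_inP.
  - by have [] := L2B LH LG.
  rewrite !big_seq lee_sum// => m /initial_inP Mm.
  rewrite (_ : sqn _ _ = sqn cube_measure (coef m (H \- G)))//.
  apply: eq_sqn_cube.
  - by apply: (cmeas_on_cell m (h := fourier f \- h1)); exact: cmeasB.
  - by apply: cmeas_coef; have [] := L2B LH LG.
  move=> c nc; rewrite base_coefB; last 2 first.
  - by move=> c'; exact: L2_twist_slice.
  - by move=> c'; exact: L2_dual_synth_slice.
  rewrite /= -(fourier_synth_coef uA t m Lg) coef_dual_synth//.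
  congr (_ - _); rewrite /h1 truncE -/(on_cell m h c).
  have mc := cube_cell m nc.
  case: (boolP (m \in s)) => ms.
    by rewrite mem_set//; left; apply/cellsP; exists m.
  rewrite memNset// => -[/cellsP[m' m's m'c]|]; last by apply; exists m.
  by move/negP: ms; apply; rewrite (cell_uniq mc m'c).
have {}key : (spec_norm (fourier f \- h1)%R <= (e / 4)%:E)%E.
  by move: key; rewrite /d mulrC divfK ?gt_eqF// EFinM lee_pmul2l// lte_fin.
have -> : trunc spec_set (fourier f) \- h =
    trunc spec_set (fourier f \- h1) \+ (h1 \- h).
  apply/funext => x /=; rewrite -[in LHS]hS /h1 /= !truncE.
  case: ifPn => xS; first by rewrite /= truncE addrA subrK.
  by rewrite -hS !truncE (negbTE xS); case: ifP; rewrite subrr addr0.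
apply: le_lt_trans (sqnD_le _ ltr01 _ _) _.
- by apply: cmeas_trunc => //; exact: cmeasB.
- exact: cmeasB.
rewrite invr1; have -> : e%:E = ((1 + 1)%R%:E * (e / 4)%:E + (1 + 1)%R%:E * (e / 4)%:E)%E.
  by rewrite -!EFinM -EFinD; congr EFin; lra.
apply: lee_ltD.
- by rewrite fin_numM// ge0_fin_numE ?sqn_ge0//; exact: le_lt_trans key (ltry _).
- by rewrite lee_pmul2l// lte_fin.
- by rewrite lte_pmul2l// lte_fin.
Qed.

End dual_synthesis.

(** * From the isometry back to the base *)

Lemma cvg_bigsum {R : realType} I (s : seq I) (u : I -> nat -> R) (l : I -> R) :
  (forall i, u i @ \oo --> l i) ->
  (fun N => \sum_(i <- s) u i N) @ \oo --> \sum_(i <- s) l i.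
Proof.
move=> ul; elim: s => [|i s IH].
  by rewrite big_nil; under eq_fun do rewrite big_nil; exact: cvg_cst.
by rewrite big_cons; under eq_fun do rewrite big_cons; exact: cvgD.
Qed.

Lemma ecvg0_harmonic {R : realType} (u : nat -> \bar R) : (forall j, 0 <= u j)%E ->
  (forall j, u j < (j.+1%:R^-1)%:E)%E -> u @ \oo --> 0%E.
Proof.
move=> u0 uj.
have h : (harmonic j)%:E @[j --> \oo] --> (0%R : R)%:E.
  by apply: cvg_EFin; [exact: nearW|exact: cvg_harmonic].
apply: (squeeze_cvge _ (cvg_cst 0%E) h); apply: nearW => j.
by rewrite u0 ltW.
Qed.

Section converse.
Context {R : realType} {n : nat} (A : 'M[R]_n) (uA : A \in unitmx).
Local Notation V := 'cV[R]_n.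
Local Notation leb := (lebesgue_cV n : {sigma_finite_measure set 'cV[R]_n -> \bar R}).
Context (O : set V) (mO : measurable O) (finO : (leb O < +oo)%E).
Hypothesis O_gt0 : (0 < leb O)%E.
Hypothesis disjO : forall (k k' : 'cV[int]_n) (y : V),
  O (y + latp A k) -> O (y + latp A k') -> k = k'.
Context (M : set 'cV[int]_n).
Implicit Types (k m : 'cV[int]_n) (s : seq 'cV[int]_n) (g : 'cV[int]_n -> V -> R[i]).

Local Notation nu := (base_measure mO finO).
Local Notation numeas := (nu : {measure set V -> \bar R}).
Local Notation prodm := (@cube_measure R n \x nu)%E.
Local Notation D := `|\det A|.
Local Notation vol := (vol nu).
Local Notation spec_norm := (spec_norm A M).
Local Notation twist := (twist A).
Local Notation coef := (coef A nu).
Local Notation char := (char A).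
Local Notation cubem := (@cube_measure R n : {measure set V -> \bar R}).
Implicit Types (H G : V * V -> R[i]).

Let nu0 : (0 < numeas setT)%E := base_gt0 mO finO O_gt0.
Let v0 : 0 < vol := vol_gt0 nu0.

Hypothesis iso : forall s g, uniq s -> (forall k, L2 numeas (g k)) ->
  (D%:E * spec_norm (fourier (synth A O s g)) = vol%:E * sqn leb (synth A O s g))%E.

Lemma sum_sqn_coefE s H : L2 prodm H ->
  (\sum_(m <- s) sqn cubem (coef m H) = (\sum_(m <- s) nrm2 cubem (coef m H))%:E)%E.
Proof.
by move=> LH; rewrite -sumEFin; apply: eq_bigr => m _; rewrite sqnE//; exact: L2_coef.
Qed.

(** The cells of indices in [s'] form only a part of the spectral set. *)
Lemma iso_bessel s' s g : uniq s' -> (forall m, m \in s' -> M m) ->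
    uniq s -> (forall k, L2 numeas (g k)) ->
  \sum_(m <- s') nrm2 cubem (coef m (twist (tensor_sum s g))) <=
  vol * nrm2 prodm (twist (tensor_sum s g)).
Proof.
move=> us' s'M us Lg; have LH := L2_twist_tensor A us Lg.
rewrite -lee_fin -(sum_sqn_coefE _ LH) EFinM -(sqnE LH) -(sqn_cells_synth uA disjO us' us Lg).
rewrite (sqn_twist_tensor disjO us Lg) -iso// lee_pmul2l// ?lte_fin ?D_gt0//.
apply: sqn_cells_le => //.
by apply: cmeas_fourier; have [] := L2_synth disjO us Lg.
Qed.

Lemma iso_parseval s g (K : R) : uniq s -> (forall k, L2 numeas (g k)) ->
  (forall N, \sum_(m <- initial_in M N) nrm2 cubem (coef m (twist (tensor_sum s g))) <= K) ->
  vol * nrm2 prodm (twist (tensor_sum s g)) <= K.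
Proof.
move=> us Lg HK; have LH := L2_twist_tensor A us Lg.
rewrite -lee_fin EFinM -(sqnE LH) (sqn_twist_tensor disjO us Lg) -iso//.
apply: spec_norm_le => //.
  by apply: cmeas_fourier; have [] := L2_synth disjO us Lg.
move=> N; rewrite (sqn_cells_synth uA disjO _ us Lg) ?initial_in_uniq//.
by rewrite sum_sqn_coefE// lee_fin.
Qed.

Section base_function.
Context (f : V -> R[i]).
Hypothesis Lf : L2 numeas f.

(** Testing the isometry on functions of the second variable alone turns an identity
    integrated over the cube into a statement about one function on the base. *)
Definition lift_base : V * V -> R[i] := fun p => f p.2.

Lemma cmeas_lift_base : cmeas lift_base.
Proof. by apply: (cmeas_comp measurable_snd); have [] := Lf. Qed.

Lemma sqn_lift_base : sqn prodm lift_base = sqn numeas f.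
Proof.
rewrite (sqn_prod _ cmeas_lift_base) /lift_base /= integral_cst//.
by rewrite (cube_measure_setT (R := R) (n := n)) mule1.
Qed.

Lemma L2_lift_base : L2 prodm lift_base.
Proof. by split; [exact: cmeas_lift_base|rewrite sqn_lift_base; have [] := Lf]. Qed.

Lemma nrm2_coef_lift m : nrm2 cubem (coef m lift_base) = abs2 (ip numeas f (char m)).
Proof.
rewrite /nrm2 /sqn /coef /lift_base /= integral_cst//.
by rewrite (cube_measure_setT (R := R) (n := n)) mule1.
Qed.

Lemma lift_approximation : exists s_ : nat -> seq 'cV[int]_n,
  exists g_ : nat -> 'cV[int]_n -> V -> R[i],
  [/\ forall j, uniq (s_ j), forall j k, L2 numeas (g_ j k) &
    sqn prodm (twist (tensor_sum (s_ j) (g_ j)) \- lift_base)%R @[j --> \oo] --> 0%E].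
Proof.
have key (j : nat) : exists p : seq 'cV[int]_n * ('cV[int]_n -> V -> R[i]),
    [/\ uniq p.1, forall k, L2 numeas (p.2 k) &
    (sqn prodm (twist (tensor_sum p.1 p.2) \- lift_base)%R < (j.+1%:R^-1)%:E)%E].
  have j0 : 0 < j.+1%:R^-1 :> R by rewrite invr_gt0.
  by have [s [g H]] := twisted_tensors_dense A L2_lift_base j0; exists (s, g).
have [p pP] := choice key.
exists (fun j => (p j).1), (fun j => (p j).2); split.
- by move=> j; have [] := pP j.
- by move=> j; have [] := pP j.
- by apply: ecvg0_harmonic => j; [exact: sqn_ge0|have [] := pP j].
Qed.

Lemma coef_lift_cvg (H_ : nat -> V * V -> R[i]) m : (forall j, L2 prodm (H_ j)) ->
    (forall j c, L2 numeas (fun x => H_ j (c, x))) ->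
    sqn prodm (H_ j \- lift_base) @[j --> \oo] --> 0%E ->
  nrm2 cubem (coef m (H_ j)) @[j --> \oo] --> abs2 (ip numeas f (char m)).
Proof.
move=> LH LHc Hf; rewrite -nrm2_coef_lift; apply: nrm2_cvg.
- exact: L2_coef L2_lift_base.
- by move=> j; exact: L2_coef.
have h : (vol%:E * sqn prodm (H_ j \- lift_base)%R)%E @[j --> \oo] --> 0%E.
  by rewrite -(mule0 vol%:E); apply: cvgeZl.
apply: (squeeze_cvge _ (cvg_cst 0%E) h); apply: nearW => j.
rewrite sqn_ge0/= -base_coefB; last 2 first.
- exact: LHc.
- by move=> c; exact: Lf.
by apply: sqn_coef_le => //; have [] := L2B (LH j) L2_lift_base.
Qed.

(** Approximating a function constant in the first variable by twisted tensors, the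
    integrated Bessel inequality tends to the one for [f]. *)
Lemma base_bessel s : uniq s -> (forall m, m \in s -> M m) ->
  \sum_(m <- s) abs2 (ip numeas f (char m)) <= vol * nrm2 numeas f.
Proof.
move=> us sM; have [s_ [g_ [us_ Lg_ Hf]]] := lift_approximation.
have LH j := L2_twist_tensor A (us_ j) (Lg_ j).
have LHc j c := L2_twist_slice A (s_ j) c (Lg_ j).
have c1 := cvg_bigsum (s := s) (fun m => coef_lift_cvg (m := m) LH LHc Hf).
have c2 := @cvg_scale R vol _ _ (nrm2_cvg L2_lift_base LH Hf).
have -> : nrm2 numeas f = nrm2 prodm lift_base by rewrite /nrm2 sqn_lift_base.
by apply: (ler_cvg_to c1 c2); apply: nearW => j; exact: iso_bessel.
Qed.

End base_function.

(** Bessel's inequality for [f := char m] and the pair [m, m'] is already saturated by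
    the term of index [m]. *)
Theorem iso_orthogonal m m' : M m -> M m' -> m != m' ->
  ip numeas (char m) (char m') = 0.
Proof.
move=> Mm Mm' mm'; have Lm := L2_char A nu m.
have us : uniq [:: m; m'] by rewrite /= inE mm'.
have sM k : k \in [:: m; m'] -> M k by rewrite !inE => /orP[]/eqP->.
have := base_bessel Lm us sM; rewrite !big_cons big_nil addr0.
rewrite nrm2_char ipxx// nrm2_char abs2_real -expr2 gerDl => H.
by apply: abs2_eq0; apply/eqP; rewrite eq_le abs2_ge0 andbT.
Qed.

(** If the partial projections of [f] stayed away from [f], Bessel's inequality on
    the base would be strict with a uniform gap; integrated over the cube and carried
    to the approximations of [f], this gap contradicts the isometry. *)
Theorem iso_complete : complete_chars A nu M.
Proof.
move=> f e Lf e0.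
have nrmc m : nrm2 numeas (char m) = vol by exact: nrm2_char.
have Lc m : L2 numeas (char m) by exact: L2_char.
have orthN N : ortho_family numeas char (initial_in M N).
  by apply: (ortho_char iso_orthogonal) => m; exact: initial_inP.
apply: contrapT => nex; pose K := vol * nrm2 numeas f - vol * e.
have sK N : \sum_(m <- initial_in M N) abs2 (ip numeas f (char m)) <= K.
  rewrite leNgt; apply/negP => HN; apply: nex.
  exists (initial_in M N), (fun m => ip numeas f (char m) / vol%:C%C); split.
  - exact: initial_in_uniq.
  - by move=> m; exact: initial_inP.
  rewrite -(ltr_pM2l v0).
  have := (nrm2_sub_proj Lc nrmc v0 (initial_in_uniq M N) (orthN N) Lf).
  rewrite /proj => ->.
  by move: HN; rewrite /K; lra.
suff : vol * nrm2 numeas f <= K by rewrite /K lerBrDr gerDl leNgt mulr_gt0.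
have [s_ [g_ [us_ Lg_ Hf]]] := lift_approximation Lf.
have LH j := L2_twist_tensor A (us_ j) (Lg_ j).
have LHc j c := L2_twist_slice A (s_ j) c (Lg_ j).
have LG := L2_lift_base Lf.
set H_ := fun j => twist (tensor_sum (s_ j) (g_ j)) in Hf *.
have c2 := @cvg_scale R vol _ _ (nrm2_cvg LG LH Hf).
have -> : nrm2 numeas f = nrm2 prodm (lift_base f) by rewrite /nrm2 sqn_lift_base.
have d0 : nrm2 prodm (H_ j \- lift_base f) @[j --> \oo] --> (0 : R) by exact: (fine_cvg Hf).
have K0 : 0 <= K.
  by apply: le_trans (sK 0%N); rewrite sumr_ge0// => m _; exact: abs2_ge0.
suff step (t : R) : 0 < t -> vol * nrm2 prodm (lift_base f) <= (1 + t) * K.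
  apply/ler_addgt0Pr => eps eps0.
  have t0 : 0 < eps / (K + 1) by rewrite divr_gt0// ltr_wpDl.
  apply: le_trans (step _ t0) _; rewrite mulrDl mul1r lerD2l.
  by rewrite mulrAC ler_pdivrMr ?ltr_wpDl// ler_pM2l// lerDl.
move=> t0.
have it0 : 0 < 1 + t^-1 by rewrite addr_gt0// invr_gt0.
have c3 : (1 + t) * K + (1 + t^-1) * (vol * nrm2 prodm (H_ j \- lift_base f))
    @[j --> \oo] --> (1 + t) * K.
  rewrite -[X in _ --> X]addr0; apply: cvgD; first exact: cvg_cst.
  rewrite -(mulr0 (1 + t^-1)); apply: cvg_scale.
  by rewrite -(mulr0 vol); exact: cvg_scale.
apply: (ler_cvg_to c2 c3); apply: nearW => j.
apply: iso_parseval => // N.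
have LB := L2B (LH j) LG.
have bes : \sum_(m <- initial_in M N) nrm2 cubem (coef m (H_ j \- lift_base f)) <=
    vol * nrm2 prodm (H_ j \- lift_base f).
  rewrite -lee_fin -(sum_sqn_coefE _ LB) EFinM -(sqnE LB).
  apply: (sum_sqn_coef_bessel nu0 iso_orthogonal) => //.
  - exact: initial_in_uniq.
  - by move=> m; exact: initial_inP.
  - by have [] := LB.
apply: (@le_trans _ _ (\sum_(m <- initial_in M N)
  ((1 + t) * abs2 (ip numeas f (char m)) +
   (1 + t^-1) * nrm2 cubem (coef m (H_ j \- lift_base f))))).
  apply: ler_sum => m _; rewrite -(nrm2_coef_lift f m).
  have := nrm2D_le t0 (L2_coef A nu0 m LG) (L2_coef A nu0 m LB).
  rewrite base_coefB; last 2 first.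
  - exact: LHc.
  - by move=> c; exact: Lf.
  rewrite (_ : coef m (lift_base f) \+ _ = coef m (H_ j))//.
  by apply/funext => c /=; rewrite addrC subrK.
by rewrite big_split /= -!mulr_sumr lerD// ler_pM2l// ltr_wpDl// ltW.
Qed.

End converse.

(** * Plancherel's inequality and the transform on L^2 *)

Section integrability.
Context {R : realType} {n : nat}.
Local Notation V := 'cV[R]_n.
Implicit Types (m : {measure set V -> \bar R}) (f g h : V -> R[i]) (B : set V).
Local Notation normc := ComplexField.Normc.normc.

Lemma inL2P m f : inL2 m setT f <-> L2 m f.
Proof. by []. Qed.

Lemma measurable_normc f : cmeas f -> measurable_fun setT (fun x => normc (f x)).
Proof.
move=> mf; apply: eq_measurable_fun (measurableT_comp
  (continuous_measurable_fun (@sqrt_continuous R)) (measurable_abs2 mf)) => x _ /=.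
by rewrite /abs2 sqrtr_sqr ger0_norm// ; case: (f x) => a b; exact: sqrtr_ge0.
Qed.

Lemma normc_bounds (z : R[i]) : [/\ `|complex.Re z| <= normc z, `|complex.Im z| <= normc z &
  normc z <= `|complex.Re z| + `|complex.Im z|].
Proof.
case: z => a b /=; split.
- by rewrite -sqrtr_sqr ler_wsqrtr// lerDl sqr_ge0.
- by rewrite -sqrtr_sqr ler_wsqrtr// lerDr sqr_ge0.
rewrite -[leRHS]ger0_norm ?addr_ge0// -sqrtr_sqr ler_wsqrtr//.
rewrite -[a ^+ 2]real_normK ?num_real// -[b ^+ 2]real_normK ?num_real//.
rewrite sqrrD; have : 0 <= `|a| * `|b| by rewrite mulr_ge0.
by lra.
Qed.

Lemma inL1P m f : inL1 m setT f <-> L1 m f.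
Proof.
split=> [[mf fo]|Lf].
  have iN : m.-integrable setT (EFin \o (fun x => normc (f x))).
    apply/integrableP; split; first by apply/measurable_EFinP; exact: measurable_normc.
    apply: le_lt_trans fo; rewrite /normL1.
    rewrite le_eqVlt; apply/orP; left; apply/eqP; apply: eq_integral => x _ /=.
    by rewrite ger0_norm//; case: (f x) => a b; exact: sqrtr_ge0.
  have [m1 m2] := mf.
  split; apply: (le_integrable measurableT _ _ iN); try exact/measurable_EFinP.
  - move=> x _ /=; have [h1 _ _] := normc_bounds (f x).
    by rewrite lee_fin (le_trans h1)// ler_norm.
  - move=> x _ /=; have [_ h1 _] := normc_bounds (f x).
    by rewrite lee_fin (le_trans h1)// ler_norm.
have mf := L1_cmeas Lf; have [f1 f2] := Lf; split => //.
have iN : m.-integrable setT (EFin \o (fun x => normc (f x))).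
  apply: (le_integrable measurableT _ _ (integrableD measurableT
    (integrable_abse f1) (integrable_abse f2))).
    by apply/measurable_EFinP; exact: measurable_normc.
  move=> x _ /=; rewrite lee_fin.
  have [_ _ h] := normc_bounds (f x).
  rewrite ger0_norm; last by case: (f x) => a b; exact: sqrtr_ge0.
  by rewrite (le_trans h)// ler_norm.
have /integrableP[_] := iN; rewrite /normL1.
rewrite (_ : (\int[m]_x `|_|)%E = (\int[m]_x (normc (f x))%:E)%E)//.
apply: eq_integral => x _ /=.
by rewrite ger0_norm//; case: (f x) => a b; exact: sqrtr_ge0.
Qed.

Lemma L1_trunc_lty m B f : measurable B -> (m B < +oo)%E -> L2 m f -> L1 m (trunc B f).
Proof.
move=> mB Bo Lf; have LB : L2 m (trunc B (fun=> 1)).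
  split; first by apply: cmeas_trunc => //; exact: cmeas_cst.
  rewrite (_ : sqn m _ = m B)// -[RHS]mul1e -integral_cst// [RHS]integral_mkcond.
  apply: eq_integral => x _; rewrite truncE /patch; case: ifPn => _.
    by rewrite abs2_1.
  by rewrite abs2_0.
have := L1_mul_conj Lf LB; congr L1; apply/funext => x.
by rewrite !truncE; case: ifPn => _; rewrite ?rmorph1 ?mulr1// rmorph0 mulr0.
Qed.

Lemma sqn_triangle m f g h (K L : R) : cmeas f -> cmeas g -> cmeas h ->
  (sqn m (f \- g)%R <= K%:E)%E -> (sqn m (g \- h)%R <= L%:E)%E ->
  (sqn m (f \- h)%R <= (2 * K + 2 * L)%:E)%E.
Proof.
move=> mf mg mh fg gh; rewrite (_ : f \- h = (f \- g) \+ (g \- h)); last first.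
  by apply/funext => x /=; rewrite addrA subrK.
apply: le_trans (sqnD_le m ltr01 (cmeasB mf mg) (cmeasB mg mh)) _.
rewrite invr1 (_ : (2 * K + 2 * L)%:E = (1 + 1)%R%:E * K%:E + (1 + 1)%R%:E * L%:E)%E; last first.
  by rewrite -!EFinM -EFinD; congr EFin; lra.
by apply: leeD; rewrite lee_pmul2l// lte_fin.
Qed.

Lemma nrm2_eq m f g : L2 m f -> L2 m g -> sqn m (g \- f) = 0%E -> nrm2 m g = nrm2 m f.
Proof.
move=> Lf Lg gf.
have c : nrm2 m g @[j --> \oo] --> nrm2 m f.
  apply: (@nrm2_cvg _ _ _ _ (fun=> g)) => //.
  by rewrite gf; exact: cvg_cst.
by rewrite -[RHS](cvg_lim (@Rhausdorff R) c) (cvg_lim (@Rhausdorff R) (cvg_cst _)).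
Qed.

Lemma exhaustion : exists F : nat -> set V, [/\ forall N, measurable (F N),
  forall N, (lebesgue_cV n (F N) < +oo)%E & forall x, \forall N \near \oo, F N x].
Proof.
have /sigma_finiteP[F [TF ndF Foo]] := sigma_finiteT (lebesgue_cV n : {sigma_finite_measure set 'cV[R]_n -> \bar R}).
exists F; split => [N|N|x]; [by have [] := Foo N|by have [] := Foo N|].
have [N _ FNx] : (\bigcup_N F N) x by rewrite -TF.
exists N => // N' /= NN'; have /subsetPset := ndF _ _ NN'; exact.
Qed.

End integrability.

Section plancherel.
Context {R : realType} {n : nat}.
Local Notation V := 'cV[R]_n.
Local Notation leb := (lebesgue_cV n : {sigma_finite_measure set 'cV[R]_n -> \bar R}).
Implicit Types (f g h u : V -> R[i]).

(** The cube tiles space by the integer lattice and the integer characters are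
    orthogonal on it: this is Bessel's inequality for the transform with [A] the
    identity and all integer vectors as indices. *)
Lemma sqn_fourier_le f : L1 leb f -> L2 leb f -> (sqn leb (fourier f) <= sqn leb f)%E.
Proof.
move=> L1f L2f; have u1 : (1%:M : 'M[R]_n) \in unitmx by exact: unitmx1.
have latp1 k : latp 1%:M k = intv k :> V by rewrite /latp mul1mx.
have dualp1 c : dualp 1%:M c = c :> V by rewrite /dualp trmx1 invmx1 mul1mx.
have cell1 m t : cell (1%:M : 'M[R]_n) m t = cube n (t - intv m).
  by rewrite /cell /= trmx1 mul1mx.
have c0 : (0 < leb (cube n))%E by rewrite lebesgue_cube.
have disj (k k' : 'cV[int]_n) (y : V) :
    cube n (y + latp 1%:M k) -> cube n (y + latp 1%:M k') -> k = k'.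
  rewrite !latp1 => h h'; apply: oppr_inj.
  have c1 : cell (1%:M : 'M[R]_n) (- k) y by rewrite cell1 intvN opprK.
  have c2 : cell (1%:M : 'M[R]_n) (- k') y by rewrite cell1 intvN opprK.
  exact: cell_uniq c1 c2.
have cov (y : V) : exists k : 'cV[int]_n, cube n (y - intv k).
  by have [m] := @cell_cover R n 1%:M y; rewrite cell1; exists m.
have fD : trunc (domain 1%:M (cube n)) f = f.
  apply/funext => y; rewrite truncE mem_set//.
  by have [k] := cov y; exists (- k); rewrite latp1 intvN.
have := @spec_norm_fourier_le R n 1%:M u1 (cube n) (@measurable_cube R n) (@cube_lty R n) c0
  disj setT f fD L1f L2f.
rewrite det1 normr1 mul1e (_ : vol _ = 1) ?mul1e; last first.
  by rewrite /vol restr_measure_setT; exact: (congr1 fine (@lebesgue_cube R n)).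
rewrite /spec_norm (_ : trunc _ (fourier f) = fourier f); last first.
  apply/funext => y; rewrite truncE mem_set//.
  by have [k] := cov y; exists k => //; rewrite cell1.
apply => m m' _ _ mm'; rewrite /char !dualp1; exact: ip_expchar_cube.
Qed.

Lemma L2_fourier f : L1 leb f -> L2 leb f -> L2 leb (fourier f).
Proof.
move=> L1f L2f; split; first by apply: cmeas_fourier; have [] := L2f.
by apply: le_lt_trans (sqn_fourier_le L1f L2f) _; have [] := L2f.
Qed.

Lemma L1B f g : L1 leb f -> L1 leb g -> L1 leb (f \- g).
Proof.
move=> L1f L1g; have := L1D L1f (L1Z (-1) L1g); congr L1.
by apply/funext => x /=; rewrite mulN1r.
Qed.

Lemma sqn_fourierB_le f g : L1 leb f -> L2 leb f -> L1 leb g -> L2 leb g ->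
  (sqn leb (fourier f \- fourier g)%R <= sqn leb (f \- g)%R)%E.
Proof.
move=> L1f L2f L1g L2g; have -> : fourier f \- fourier g = fourier (f \- g).
  by apply/funext => t /=; rewrite fourierB.
by apply: sqn_fourier_le; [exact: L1B|exact: L2B].
Qed.

(** A sequence of integrable truncations converging fast enough to [f] has transforms
    converging fast, by Plancherel's inequality, and the transform of any function close
    to [f] is close to theirs. *)
Lemma is_fourierL2_ex f : L2 leb f -> exists g, is_fourierL2 f g.
Proof.
move=> Lf; have [F [mF Fo Fx]] := @exhaustion R n; have [mf _] := Lf.
pose q : R := 4^-1; pose d N : R := (q ^+ 2) ^+ N.
have q0 : 0 < q by rewrite invr_gt0.
have qq0 : 0 < q ^+ 2 by rewrite exprn_gt0.
have qq1 : q ^+ 2 < 1 by rewrite exprn_ilt1 ?ltW// /q; lra.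
have d0 N : 0 < d N by rewrite exprn_gt0.
have key N : exists u, [/\ L1 leb u, L2 leb u & (sqn leb (u \- f)%R <= (d N / 4)%:E)%E].
  have d4 : 0 < d N / 4 by rewrite divr_gt0.
  have [N' _ /(_ _ (leqnn N')) /= H] := ecvg0_lt (sqn_sub_trunc_cvg mF Fx Lf) d4.
  exists (trunc (F N') f); split; [exact: (L1_trunc_lty (mF N') (Fo N') Lf)|exact: L2_trunc|exact: ltW].
have [u uP] := choice key.
have L1u N : L1 leb (u N) by have [] := uP N.
have L2u N : L2 leb (u N) by have [] := uP N.
have mu N : cmeas (u N) by have [] := L2u N.
have uf N : (sqn leb (u N \- f)%R <= (d N / 4)%:E)%E by have [] := uP N.
have dS N : d N.+1 <= d N.
  by rewrite /d exprS ler_piMl ?ltW//; exact: d0.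
have inc N : (sqn leb (fourier (u N.+1) \- fourier (u N))%R <= (d N)%:E)%E.
  apply: le_trans (sqn_fourierB_le _ _ _ _) _ => //.
  have uf' : (sqn leb (f \- u N)%R <= (d N / 4)%:E)%E by rewrite sqnBC.
  apply: le_trans (sqn_triangle (mu _) mf (mu _) (uf N.+1) uf') _.
  by rewrite lee_fin; have := dS N; lra.
have [g Lg gP] := riesz_fischer q0 (lexx _) (fun N => L2_fourier (L1u N) (L2u N)) inc.
exists g; split => // e e0; exists (e / 16); first by rewrite divr_gt0.
move=> v /inL1P L1v /inL2P L2v vf; have [mv _] := L2v; have [mg _] := Lg.
have dcvg : d N @[N --> \oo] --> (0 : R).
  by apply: cvg_expr; rewrite ger0_norm// ltW.
have e32 : 0 < e / 32 by rewrite divr_gt0.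
have [N _ /(_ _ (leqnn N)) /=] := (cvgrPdist_lt _ _).1 dcvg _ e32.
rewrite sub0r normrN ger0_norm ?ltW// => dN.
have h1 : (sqn leb (fourier (u N) \- g)%R <= (4 * d N)%:E)%E by rewrite sqnBC.
have uf' : (sqn leb (f \- u N)%R <= (d N / 4)%:E)%E by rewrite sqnBC.
have h2 : (sqn leb (fourier v \- fourier (u N))%R <= (2 * (e / 16) + 2 * (d N / 4))%:E)%E.
  apply: le_trans (sqn_fourierB_le _ _ _ _) _ => //.
  exact: (sqn_triangle mv mf (mu N) (ltW vf) uf').
apply: le_lt_trans (sqn_triangle (cmeas_fourier mv) (cmeas_fourier (mu N)) mg h2 h1) _.
by rewrite lte_fin; lra.
Qed.

Lemma fourierL2P f : L2 leb f -> is_fourierL2 f (fourierL2 f).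
Proof. by move=> Lf; have [g gP] := is_fourierL2_ex Lf; rewrite /fourierL2; exact: (xgetI _ gP). Qed.

Lemma L2_fourierL2 f : L2 leb f -> L2 leb (fourierL2 f).
Proof. by move=> /fourierL2P[/inL2P]. Qed.

Lemma fourierL2_cvg (v : nat -> V -> R[i]) f : L2 leb f ->
    (forall j, L1 leb (v j)) -> (forall j, L2 leb (v j)) ->
    sqn leb (v j \- f) @[j --> \oo] --> 0%E ->
  sqn leb (fourier (v j) \- fourierL2 f) @[j --> \oo] --> 0%E.
Proof.
move=> Lf L1v L2v vf; have [_ H] := fourierL2P Lf.
apply/fine_cvgP; split.
  apply: nearW => j; rewrite ge0_fin_numE ?sqn_ge0//.
  by have [] := L2B (L2_fourier (L1v j) (L2v j)) (L2_fourierL2 Lf).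
apply/cvgrPdist_lt => e e0; have [r r0 rP] := H e e0.
apply: filterS (ecvg0_lt vf r0) => j vj; rewrite sub0r normrN.
rewrite ger0_norm ?fine_ge0 ?sqn_ge0//.
have := rP _ ((inL1P _ _).2 (L1v j)) ((inL2P _ _).2 (L2v j)) vj.
rewrite -[sqnormL2 _ _ _]/(sqn leb (fourier (v j) \- fourierL2 f)).
by rewrite (sqnE (L2B (L2_fourier (L1v j) (L2v j)) (L2_fourierL2 Lf))) lte_fin.
Qed.

(** The constant sequence [f] is admissible in the definition of the extension. *)
Lemma sqn_fourierL2_fourier f : L1 leb f -> L2 leb f ->
  sqn leb (fourier f \- fourierL2 f) = 0%E.
Proof.
move=> L1f L2f; have ff : sqn leb (f \- f) = 0%E.
  by rewrite /sqn integral0_eq// => x _ /=; rewrite subrr abs2_0.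
have z : (fun j : nat => sqn leb (f \- f)) @ \oo --> 0%E by rewrite ff; exact: cvg_cst.
have c := fourierL2_cvg L2f (fun=> L1f) (fun=> L2f) z.
have c' : (fun j : nat => sqn leb (fourier f \- fourierL2 f)) @ \oo -->
  sqn leb (fourier f \- fourierL2 f) by exact: cvg_cst.
exact: (cvg_unique (@ereal_hausdorff R) c' c).
Qed.

End plancherel.

(** * Isometry on all square integrable functions *)

Lemma ecvg0_combine {R : realType} (a b : R) (u v : nat -> \bar R) :
  u @ \oo --> 0%E -> v @ \oo --> 0%E ->
  (a%:E * u N + b%:E * v N)%E @[N --> \oo] --> 0%E.
Proof.
move=> u0 v0.
have h1 : (a%:E * u N)%E @[N --> \oo] --> (a%:E * 0)%E by exact: cvgeZl.
have h2 : (b%:E * v N)%E @[N --> \oo] --> (b%:E * 0)%E by exact: cvgeZl.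
rewrite !mule0 in h1 h2; rewrite -[X in _ --> X](adde0 0%E).
exact: (cvgeD _ h1 h2).
Qed.

Section extension.
Context {R : realType} {n : nat} (A : 'M[R]_n).
Local Notation V := 'cV[R]_n.
Local Notation leb := (lebesgue_cV n : {sigma_finite_measure set 'cV[R]_n -> \bar R}).
Context (W S : set V) (mS : measurable S) (a b : R).
Implicit Types (f g h u : V -> R[i]).

Hypothesis iso : forall f, trunc W f = f -> L1 leb f -> L2 leb f ->
  a * nrm2 leb (trunc S (fourier f)) = b * nrm2 leb f.

(** Both sides of the identity are continuous in the [L^2] distance. *)
Lemma fourierL2_isometry f g : trunc W f = f -> trunc W g = g ->
    L2 leb f -> L2 leb g ->
  a * nrm2 leb (trunc S (fourierL2 f \- fourierL2 g)) = b * nrm2 leb (f \- g).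
Proof.
move=> fW gW Lf Lg; have [F [mF Fo Fx]] := @exhaustion R n.
have L1t h N : L2 leb h -> L1 leb (trunc (F N) h).
  by move=> Lh; exact: (L1_trunc_lty (mF N) (Fo N) Lh).
have L2t h N : L2 leb h -> L2 leb (trunc (F N) h) by move=> Lh; exact: L2_trunc.
have tW h N : trunc W h = h -> trunc W (trunc (F N) h) = trunc (F N) h.
  move=> hW; apply/funext => x; rewrite !truncE; case: ifPn => // xW.
  by case: ifPn => // _; rewrite -hW truncE (negbTE xW).
have cv h : L2 leb h -> sqn leb (trunc (F N) h \- h) @[N --> \oo] --> 0%E.
  by move=> Lh; exact: sqn_sub_trunc_cvg.
pose u N := trunc (F N) f \- trunc (F N) g.
pose w := fourierL2 f \- fourierL2 g.
have Lw : L2 leb w by apply: L2B; exact: L2_fourierL2.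
have Lfg : L2 leb (f \- g) by exact: L2B.
have uE N : u N = trunc (F N) (f \- g) by rewrite /u trunc_subE.
have L1u N : L1 leb (u N) by rewrite uE; exact: L1t.
have L2u N : L2 leb (u N) by rewrite uE; exact: L2t.
have LFu N : L2 leb (fourier (u N)) by exact: L2_fourier.
have c0 : sqn leb (fourier (u N) \- w) @[N --> \oo] --> 0%E.
  have cf := fourierL2_cvg Lf (fun N => L1t f N Lf) (fun N => L2t f N Lf) (cv _ Lf).
  have cg := fourierL2_cvg Lg (fun N => L1t g N Lg) (fun N => L2t g N Lg) (cv _ Lg).
  have cs : ((1 + 1)%R%:E * sqn leb (fourier (trunc (F N) f) \- fourierL2 f)%R +
      (1 + 1)%R%:E * sqn leb (fourier (trunc (F N) g) \- fourierL2 g)%R)%E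
      @[N --> \oo] --> 0%E.
    exact: (ecvg0_combine (1 + 1) (1 + 1) cf cg).
  apply: (squeeze_cvge _ (cvg_cst 0%E) cs); apply: nearW => N.
  rewrite sqn_ge0/=.
  have -> : fourier (u N) \- w = (fourier (trunc (F N) f) \- fourierL2 f) \+
      (fun x => - (fourier (trunc (F N) g) \- fourierL2 g) x).
    apply/funext => x; rewrite /w /u /= fourierB; [|exact: L1t|exact: L1t].
    by rewrite !opprB addrACA [in RHS]addrACA; congr (_ + _); rewrite addrC.
  rewrite -[in leRHS](sqnN leb (fourier (trunc (F N) g) \- fourierL2 g)).
  have L' h : L2 leb h -> cmeas (fourier (trunc (F N) h) \- fourierL2 h).
    move=> Lh; have [//] : L2 leb (fourier (trunc (F N) h) \- fourierL2 h).
    by apply: L2B; [apply: L2_fourier; [exact: L1t|exact: L2t]|exact: L2_fourierL2].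
  have := sqnD_le leb ltr01 (L' _ Lf) (cmeasN (L' _ Lg)).
  by rewrite invr1.
have c1 : sqn leb (trunc S (fourier (u N)) \- trunc S w) @[N --> \oo] --> 0%E.
  apply: (squeeze_cvge _ (cvg_cst 0%E) c0); apply: nearW => N.
  rewrite sqn_ge0/= -trunc_subE; have [mw _] := L2B (LFu N) Lw.
  apply: le_sqn => //; first exact: cmeas_trunc.
  by move=> x; exact: abs2_trunc_le.
have l1 := @cvg_scale R a _ _
  (nrm2_cvg (L2_trunc mS Lw) (fun N => L2_trunc mS (LFu N)) c1).
have c2 : sqn leb (u N \- (f \- g)) @[N --> \oo] --> 0%E.
  by under eq_fun do rewrite uE; exact: cv.
have l2 := @cvg_scale R b _ _ (nrm2_cvg Lfg L2u c2).
rewrite -[LHS](cvg_lim (@Rhausdorff R) l1) -[RHS](cvg_lim (@Rhausdorff R) l2).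
suff -> : (fun N => a * nrm2 leb (trunc S (fourier (u N)))) =
  (fun N => b * nrm2 leb (u N)) by [].
apply/funext => N; apply: iso => //.
by rewrite /u trunc_subE !tW.
Qed.

End extension.

(** An isometry hypothesis on differences says nothing directly about a single function;
    the extension at zero, which vanishes almost everywhere, is subtracted instead. *)
Lemma nrm2_trunc_fourierL2 {R : realType} {n : nat} (S : set 'cV[R]_n)
    (f : 'cV[R]_n -> R[i]) :
  let leb := (lebesgue_cV n : {sigma_finite_measure set 'cV[R]_n -> \bar R}) in
  measurable S -> L1 leb f -> L2 leb f ->
  nrm2 leb (trunc S (fourierL2 f \- fourierL2 (fun=> 0))) =
  nrm2 leb (trunc S (fourier f)).
Proof.
move=> leb mS L1f L2f.
have L1z : L1 leb (fun=> 0 : R[i]) by split; exact: integrable0.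
have L2z : L2 leb (fun=> 0 : R[i]) by exact: L2_cst0.
have z0 (t : 'cV[R]_n) : fourier (fun=> 0) t = 0 :> R[i].
  rewrite fourierE -[RHS](cint0 leb); congr cint.
  by apply/funext => x; rewrite /= mul0r.
have LF := L2_fourier L1f L2f; have LG := L2_fourierL2 L2f.
have LZ := L2_fourierL2 L2z.
have Lw := L2B LG LZ.
apply: nrm2_eq; [exact: L2_trunc|exact: L2_trunc|].
apply/eqP; rewrite eq_le sqn_ge0 andbT -trunc_subE.
have Ld := L2B Lw LF.
apply: (@le_trans _ _ (sqn leb ((fourierL2 f \- fourierL2 (fun=> 0)) \- fourier f))).
  apply: le_sqn; [by apply: cmeas_trunc => //; have [] := Ld|by have [] := Ld|].
  by move=> x; exact: abs2_trunc_le.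
have h1 := sqn_fourierL2_fourier L1f L2f.
have h2 := sqn_fourierL2_fourier L1z L2z.
rewrite (_ : _ \- fourier f = (fun x => - (fourier f \- fourierL2 f) x) \+
    (fourier (fun=> 0) \- fourierL2 (fun=> 0))); last first.
  by apply/funext => x; rewrite /= z0 opprB add0r addrAC.
have m1 : cmeas (fourier f \- fourierL2 f) by have [] := L2B LF LG.
have m2 : cmeas ((fourier (fun=> 0) : 'cV[R]_n -> R[i]) \- fourierL2 (fun=> 0)).
  by have [] := L2B (L2_fourier L1z L2z) LZ.
apply: le_trans (sqnD_le leb ltr01 (cmeasN m1) m2) _.
by rewrite sqnN h1 h2 !mule0 adde0.
Qed.

(** * Packing and the dual set *)

Section geometry.
Context {R : realType} {n : nat} (A : 'M[R]_n) (uA : A \in unitmx).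
Local Notation V := 'cV[R]_n.
Local Notation leb := (lebesgue_cV n : {sigma_finite_measure set 'cV[R]_n -> \bar R}).
Implicit Types (k m : 'cV[int]_n) (O : set V).

Lemma intv_inj : injective (@intv R n).
Proof.
move=> k k' /matrixP kk'; apply/matrixP => i j; have := kk' i j; rewrite !mxE.
by move/eqP; rewrite eqr_int => /eqP.
Qed.

Lemma latp_inj : injective (latp A).
Proof. by move=> k k' /(congr1 (mulmx (invmx A))); rewrite /latp !mulKmx// => /intv_inj. Qed.

Lemma latpN k : latp A (- k) = - latp A k.
Proof. by rewrite /latp intvN mulmxN. Qed.

Lemma dualp_inj : injective (fun m => dualp A (intv m)).
Proof. by move=> m m' /(congr1 (mulmx A^T)); rewrite !dualpK// => /intv_inj. Qed.

Lemma open_translate O (a : V) : open O -> open [set y | O (y + a)].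
Proof.
move=> oO; apply: (@open_comp _ _ (fun y : V => y + a)) => // y _.
exact: (cvgD cvg_id (cvg_cst _)).
Qed.

Lemma image_translate O (a : V) : [set x + a | x in O] = [set y | O (y - a)].
Proof.
apply/seteqP; split=> [_ [x Ox <-]|y Oy]; first by rewrite /= addrK.
by exists (y - a) => //; rewrite subrK.
Qed.

(** Two translates that overlap overlap in a nonempty open set, which is not null. *)
Lemma packs_disjoint O : open O -> packs O (lattice A) ->
  forall k k' (y : V), O (y + latp A k) -> O (y + latp A k') -> k = k'.
Proof.
move=> oO [_ pO] k k' y Ok Ok'; apply: contrapT => kk'.
have lat j : lattice A (- latp A j) by exists (- j) => //; rewrite -[LHS]/(latp A (- j)) latpN.
have neq : - latp A k <> - latp A k' by move=> /oppr_inj/latp_inj.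
have := pO _ _ (lat k) (lat k') neq; rewrite !image_translate !opprK => z.
have oU := openI (open_translate (a := latp A k) oO) (open_translate (a := latp A k') oO).
have := open_lebesgue_gt0 oU (ex_intro _ y (conj Ok Ok')).
by rewrite [X in (0 < X)%E -> _]z ltxx.
Qed.

Lemma sumset_lattice O : sumset O (lattice A) = domain A O.
Proof.
apply/seteqP; split=> [_ [x Ox [_ [k _ <-] <-]]|y [k Ok]].
  by exists (- k); rewrite -[X in x + X]/(latp A k) latpN addrK.
exists (y + latp A k) => //; exists (- latp A k); last by rewrite addrK.
by exists (- k) => //; rewrite -[LHS]/(latp A (- k)) latpN.
Qed.

Definition closed_cell m : set V := [set t | closed_cube n (A^T *m t - intv m)].

Lemma measurable_dual_coord m : measurable_fun setT (fun t : V => A^T *m t - intv m).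
Proof. exact: (measurableT_comp (measurable_shift_cV (- intv m)) (measurable_mulmx A^T)). Qed.

Lemma measurable_closed_cell m : measurable (closed_cell m).
Proof.
rewrite -[closed_cell m]setTI.
exact: (measurable_dual_coord m measurableT (@measurable_closed_cube R n)).
Qed.

Lemma sub_cell_closed m : cell A m `<=` closed_cell m.
Proof. by move=> t; exact: cube_closed_cube. Qed.

(** The boundary is the inverse image of the boundary of the cube under an invertible
    affine map. *)
Lemma lebesgue_cell_boundary m : leb (closed_cell m `\` cell A m) = 0%E.
Proof.
have mB : measurable (closed_cube n `\` cube n : set V).
  by apply: measurableD; [exact: measurable_closed_cube|exact: measurable_cube].
pose g (c : V) : \bar R := (\1_(closed_cube n `\` cube n) (c - intv m))%:E.
have mi : measurable_fun setT (fun c : V => (\1_(closed_cube n `\` cube n) c : R)%:E).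
  by apply/measurable_EFinP; exact: measurable_indic.
have mg : measurable_fun setT g by exact: (measurableT_comp mi (measurable_shift_cV _)).
have g0 c : (0 <= g c)%E by rewrite lee_fin indicE.
have uAT : A^T \in unitmx by rewrite unitmx_tr.
have := linear_change_unitmx uAT mg g0.
rewrite (lebesgue_cV_shift (- intv m) mi); last by move=> c; rewrite lee_fin indicE.
rewrite [X in _ = X]integral_indic// setIT => E.
have {}E : (`|\det A^T|%:E * leb (closed_cell m `\` cell A m) = 0)%E.
  rewrite -[RHS](@lebesgue_closed_cube_boundary R n) -[RHS]E; congr (_ * _)%E.
  rewrite -[X in leb X]setIT -integral_indic//.
  by apply: measurableD; [exact: measurable_closed_cell|exact: measurable_cell].
apply/eqP; move/eqP: E; rewrite mule_eq0 => /orP[|//].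
by rewrite eqe normr_eq0 det_tr -[_ == _]negbK -unitfE -unitmxE uA.
Qed.

Section dual_set.
Context (L : set V).
Hypothesis dualL : forall (l : V) k, L l ->
  exists z : int, dot l (A *m map_mx intr k) = z%:~R.

Definition dual_index : set 'cV[int]_n := [set m | L (dualp A (intv m))].

(** Pairing with the columns of [A] shows that [L] lies in the dual lattice. *)
Lemma dual_indexP l : L l -> exists2 m, dual_index m & l = dualp A (intv m).
Proof.
move=> Ll; have /choice[z zP] i := dualL (delta_mx i ord0 : 'cV[int]_n) Ll.
suff E : A^T *m l = intv (\col_i z i).
  have lE : l = dualp A (intv (\col_i z i)) by rewrite -E dualpVK.
  by exists (\col_i z i) => //; rewrite /dual_index /= -lE.
apply/matrixP => i j; rewrite ord1 [RHS]mxE [X in _ = X%:~R]mxE -zP dot_mulmx.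
rewrite /dot (bigD1 i)//= big1 => [|i' /negbTE ii'].
  by rewrite addr0 [map_mx _ _ i ord0]mxE [delta_mx _ _ _ _]mxE !eqxx mulr1.
by rewrite [map_mx _ _ i' ord0]mxE [delta_mx _ _ _ _]mxE ii' mulr0.
Qed.

Local Notation M := dual_index.
Local Notation S := (sumset (dual_cell A) L).

Lemma dual_sumsetP t : S t <-> exists2 m, M m & closed_cell m t.
Proof.
split=> [[_ [c cc <-] [l Ll <-]]|[m Mm mt]].
  have [m Mm ->] := dual_indexP Ll; exists m => // i.
  by rewrite /= mulmxDr -!/(dualp A _) !dualpK// addrK in_itv /= -ler_norml; exact: cc.
exists (t - dualp A (intv m)); last by exists (dualp A (intv m)) => //; rewrite subrK.
exists (A^T *m t - intv m).
  by move=> i; have := mt i; rewrite /= in_itv /= -ler_norml.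
by rewrite -/(dualp A _) dualpD dualpN dualpVK.
Qed.

Lemma measurable_dual_sumset : measurable S.
Proof.
rewrite (_ : S = \bigcup_m (if `[< M m >] then closed_cell m else set0)).
  apply: countable_bigcupT_measurable => // m; case: ifPn => // _.
  exact: measurable_closed_cell.
apply/seteqP; split=> [t /dual_sumsetP[m Mm mt]|t [m _]].
  by exists m => //; rewrite asboolT.
by case: asboolP => // Mm mt; apply/dual_sumsetP; exists m.
Qed.

Lemma sub_spec_set : spec_set A M `<=` S.
Proof. by move=> t [m Mm mt]; apply/dual_sumsetP; exists m => //; exact: sub_cell_closed. Qed.

Lemma lebesgue_dual_boundary : leb (S `\` spec_set A M) = 0%E.
Proof.
have mSS : measurable (S `\` spec_set A M).
  by apply: measurableD; [exact: measurable_dual_sumset|exact: measurable_spec_set].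
pose B N := \big[setU/set0]_(m <- @initial_seq n N) (closed_cell m `\` cell A m).
apply/(negligibleP leb mSS).
apply: (negligibleS (A := \bigcup_N B N)).
  move=> t [/dual_sumsetP[m Mm mt] tS].
  have [N _ /(_ _ (leqnn N)) /= mN] := near_initial_seq m.
  exists N => //; rewrite /B -bigcup_seq; exists m => //; split=> // mt'.
  by apply: tS; exists m.
apply: negligible_bigcup => N; rewrite /B; elim/big_ind : _ => [|X Y|m _].
- exact: negligible_set0.
- exact: negligibleU.
- apply/negligibleP; last exact: lebesgue_cell_boundary.
  by apply: measurableD; [exact: measurable_closed_cell|exact: measurable_cell].
Qed.

Lemma ge0_integral_dual_sumset (h : V -> \bar R) : measurable_fun setT h ->
  (forall t, 0 <= h t)%E ->
  (\int[leb]_(t in S) h t = \int[leb]_(t in spec_set A M) h t)%E.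
Proof.
move=> mh h0; have mT := measurable_spec_set A M; have mS := measurable_dual_sumset.
have mD : measurable (S `\` spec_set A M) by exact: measurableD.
rewrite -[in LHS](setDUK sub_spec_set) ge0_integral_setU//; last 2 first.
- exact: measurable_funTS.
- by rewrite disj_set2E setDIK.
rewrite [X in (_ + X)%E](_ : _ = 0%E) ?adde0//.
apply: null_set_integral => //; first exact: measurable_funTS.
exact: lebesgue_dual_boundary.
Qed.

End dual_set.
End geometry.

(** * The pair measure and the equivalence *)

Section extension_by_zero.
Context {R : realType} {n : nat}.
Local Notation V := 'cV[R]_n.
Implicit Types (m : {measure set V -> \bar R}) (W : set V) (f g h : V -> R[i]).

Lemma ext0E W f : ext0 W f = trunc W f.
Proof. by apply/funext => x; rewrite truncE. Qed.

Lemma trunc_idem W f : trunc W (trunc W f) = trunc W f.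
Proof. by apply/funext => x; rewrite !truncE; case: (x \in W). Qed.

Lemma cmeas_trunc_in W f : measurable W -> cmeasurable W f -> cmeas (trunc W f).
Proof.
move=> mW [f1 f2]; split.
- apply: eq_measurable_fun ((measurable_restrictT _ mW).1 f1) => x _.
  by rewrite truncE /patch; case: ifPn.
- apply: eq_measurable_fun ((measurable_restrictT _ mW).1 f2) => x _.
  by rewrite truncE /patch; case: ifPn.
Qed.

Lemma cmeasurable_in W f : cmeas f -> cmeasurable W f.
Proof. by move=> [f1 f2]; split; exact: measurable_funTS. Qed.

Lemma sqnormL2_trunc m W f : sqnormL2 m W f = sqn m (trunc W f).
Proof.
rewrite /sqnormL2 integral_mkcond; apply: eq_integral => x _.
by rewrite /patch truncE; case: ifPn => // _; rewrite abs2_0.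
Qed.

Lemma normL1_trunc m W f : normL1 m W f = normL1 m setT (trunc W f).
Proof.
rewrite /normL1 integral_mkcond; apply: eq_integral => x _.
by rewrite /patch truncE; case: ifPn => // _ /=; rewrite expr0n /= addr0 sqrtr0.
Qed.

Lemma inL2_trunc m W f : measurable W -> inL2 m W f -> L2 m (trunc W f).
Proof.
by move=> mW [mf fo]; split; [exact: cmeas_trunc_in|rewrite -sqnormL2_trunc].
Qed.

Lemma inL1_trunc m W f : measurable W -> inL1 m W f -> L1 m (trunc W f).
Proof.
move=> mW [mf fo]; apply/inL1P; split; first exact: cmeas_trunc_in.
by rewrite -normL1_trunc.
Qed.

Lemma L2_inL2 m W f : trunc W f = f -> L2 m f -> inL2 m W f.
Proof.
by move=> fW [mf fo]; split; [exact: cmeasurable_in|rewrite sqnormL2_trunc fW].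
Qed.

Lemma L1_inL1 m W f : trunc W f = f -> L1 m f -> inL1 m W f.
Proof.
move=> fW /inL1P[mf fo]; split; first exact: cmeasurable_in.
by rewrite normL1_trunc fW.
Qed.

Lemma trunc0 W : trunc W (fun=> 0) = (fun=> 0) :> (V -> R[i]).
Proof. by apply/funext => x; rewrite truncE; case: ifP. Qed.

End extension_by_zero.

Section glue.
Context {R : realType} {n : nat} (A : 'M[R]_n) (uA : A \in unitmx).
Local Notation V := 'cV[R]_n.
Local Notation leb := (lebesgue_cV n : {sigma_finite_measure set 'cV[R]_n -> \bar R}).
Context (O : set V) (mO : measurable O) (finO : (leb O < +oo)%E).
Hypothesis O_gt0 : (0 < leb O)%E.
Hypothesis disjO : forall (k k' : 'cV[int]_n) (y : V),
  O (y + latp A k) -> O (y + latp A k') -> k = k'.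
Context (L : set V).
Hypothesis dualL : forall (l : V) (k : 'cV[int]_n), L l ->
  exists z : int, dot l (A *m map_mx intr k) = z%:~R.
Implicit Types (f g h : V -> R[i]).

Local Notation nu := (base_measure mO finO).
Local Notation numeas := (nu : {measure set V -> \bar R}).
Local Notation D := `|\det A|.
Local Notation vol := (vol nu).
Local Notation M := (dual_index A L).
Local Notation S := (sumset (dual_cell A) L).
Local Notation mu := (pair_measure A O S).
Local Notation W := (domain A O).
Local Notation char := (char A).

Let D0 : 0 < D := D_gt0 uA.
Let nu0 : (0 < numeas setT)%E := base_gt0 mO finO O_gt0.
Let v0 : 0 < vol := vol_gt0 nu0.
Let mS : measurable S := measurable_dual_sumset uA dualL.
Let mW : measurable W := measurable_domain A mO.

Definition orthogonal_chars := forall m m', M m -> M m' -> m != m' ->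
  ip numeas (char m) (char m') = 0.

(** ** The pair measure *)

(** The dual set is measurable, which selects the first branch of the definition. *)
Lemma Leb_onE : Leb_on S = mrestr leb mS :> {measure set V -> \bar R}.
Proof.
rewrite /Leb_on; case: pselect => // mS'.
by rewrite (Prop_irrelevance mS' mS).
Qed.

Lemma volO : vol = fine (leb O).
Proof. by rewrite /vol restr_measure_setT. Qed.

Lemma sqnormL2_pair h : cmeas h ->
  sqnormL2 mu setT h = ((D / vol)%:E * spec_norm A M h)%E.
Proof.
move=> mh; have m2 := emeasurable_abs2 mh.
have p2 x : (0 <= (abs2 (h x))%:E)%E by rewrite lee_fin abs2_ge0.
rewrite volO /pair_measure -[LHS]/(sqn _ h) /sqn ge0_integral_mscale//.
congr (_ * _)%E; rewrite Leb_onE ge0_integral_mrestr//.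
rewrite (ge0_integral_dual_sumset uA dualL)// integral_mkcond.
apply: eq_integral => x _.
by rewrite /patch truncE; case: ifPn => // _; rewrite abs2_0.
Qed.

Lemma sqnormL2_pair_in h : cmeas h -> sqnormL2 mu S h = sqnormL2 mu setT h.
Proof.
move=> mh; have m2 := emeasurable_abs2 mh.
have p2 x : (0 <= (abs2 (h x))%:E)%E by rewrite lee_fin abs2_ge0.
rewrite [RHS](_ : _ = sqn mu h)// (_ : sqnormL2 _ _ _ = \int[mu]_(x in S) (abs2 (h x))%:E)%E//.
rewrite /sqn /pair_measure !ge0_integral_mscale//; last exact: measurable_funTS.
by rewrite Leb_onE ge0_integral_mrestr// integral_mrestr_in.
Qed.

Lemma radon_pair : radon mu.
Proof.
move=> K cK; have [mK Ko] := compact_lebesgue_lty cK.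
rewrite /pair_measure /= /mscale /= Leb_onE /= /mrestr lte_mul_pinfty//.
  by rewrite lee_fin density_ge0.
apply: le_lt_trans Ko; apply: le_measure; rewrite ?inE//; exact: measurableI.
Qed.

Lemma spec_norm_isoP h f : L2 leb (trunc (spec_set A M) h) -> L2 leb f ->
  sqnormL2 mu setT h = sqn leb f -> cmeas h ->
  D * nrm2 leb (trunc (spec_set A M) h) = vol * nrm2 leb f.
Proof.
move=> Lh Lf E mh; move: E; rewrite sqnormL2_pair// /spec_norm (sqnE Lh) (sqnE Lf) -EFinM.
by move=> [<-]; rewrite mulrA [vol * _]mulrC divfK// gt_eqF.
Qed.

Lemma sqnormL2_pairE h f : cmeas h -> L2 leb (trunc (spec_set A M) h) -> L2 leb f ->
  D * nrm2 leb (trunc (spec_set A M) h) = vol * nrm2 leb f ->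
  sqnormL2 mu setT h = sqn leb f.
Proof.
move=> mh Lh Lf E; rewrite sqnormL2_pair// /spec_norm (sqnE Lh) (sqnE Lf) -EFinM.
by rewrite mulrAC E mulrC mulKf// gt_eqF.
Qed.

(** ** Spectra of the base *)

Lemma inner_base f g : cmeas f -> cmeas g -> inner leb O f g = ip numeas f g.
Proof.
move=> mf mg; have [m1 m2] := cmeasM mf (cmeas_conj mg).
rewrite /inner /ip /cintegral /cint /Rintegral.
rewrite !integral_restr//; exact/measurable_EFinP.
Qed.

Lemma sqnormL2_base f : cmeas f -> sqnormL2 leb O f = sqn numeas f.
Proof. by move=> mf; rewrite sqnormL2_trunc sqn_trunc_base. Qed.

Lemma sqnormL2_base_in f g : cmeasurable O g -> cmeas f ->
  sqnormL2 leb O (f \- g) = sqn numeas (f \- trunc O g).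
Proof.
move=> mg mf; have mg' := cmeas_trunc_in mO mg.
rewrite sqnormL2_trunc -sqn_trunc_base; last exact: cmeasB.
by congr sqn; apply/funext => x; rewrite !truncE /= truncE; case: ifPn.
Qed.

Lemma spectrum_orthogonal : has_spectrum O L -> orthogonal_chars.
Proof.
move=> [_ _ _ oL _] m m' Mm Mm' /eqP mm'.
rewrite -inner_base; [|exact: cmeas_expchar|exact: cmeas_expchar].
by apply: oL => // /(dualp_inj uA).
Qed.

(** A trigonometric sum over a sequence of frequencies with repetitions is rewritten as
    one over distinct indices of the dual lattice, with multiplicities in the
    coefficients. *)
Lemma spectrum_complete : has_spectrum O L -> complete_chars A nu M.
Proof.
move=> [_ _ _ _ dL] f e Lf e0; have [mf _] := Lf.
have iLf : inL2 leb O f.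
  by split; [exact: cmeasurable_in|rewrite sqnormL2_base//; have [] := Lf].
have [_ [s [c [sL ->]]] se] := dL f iLf e e0.
have idx l : exists m, L l -> M m /\ l = dualp A (intv m).
  have [Ll|Ll] := pselect (L l); last by exists 0.
  by have [m Mm lE] := dual_indexP uA dualL Ll; exists m.
have [mof mofP] := choice idx.
pose b m := c (dualp A (intv m)) *+ count_mem (dualp A (intv m)) s.
exists (map mof (undup s)), b; split.
- rewrite map_inj_in_uniq ?undup_uniq// => l l'; rewrite !mem_undup => /sL Ll /sL Ll' E.
  by have [_ ->] := mofP _ Ll; have [_ ->] := mofP _ Ll'; rewrite E.
- by move=> m /mapP[l]; rewrite mem_undup => /sL Ll ->; have [] := mofP _ Ll.
have -> : (fun x => \sum_(m <- map mof (undup s)) b m * char m x) =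
    (fun x => \sum_(l <- s) c l * expchar l x).
  apply/funext => x; rewrite big_map -[RHS]big_undup_iterop_count.
  rewrite !big_seq; apply: eq_bigr => l; rewrite mem_undup => /sL Ll.
  by rewrite /b /char; have [_ <-] := mofP _ Ll; rewrite mulrnAl.
have Ls : L2 numeas (fun x => \sum_(l <- s) c l * expchar l x).
  by apply: L2_sum => l; apply: L2Z; apply: L2_expchar; exact: nu_lty.
move: se; rewrite sqnormL2_base; last by have [] := L2B Ls Lf.
by rewrite sqnBC (sqnE (L2B Lf Ls)) lte_fin.
Qed.

Lemma chars_spectrum : orthogonal_chars -> complete_chars A nu M -> has_spectrum O L.
Proof.
move=> oM cM; split => //.
- move=> l Ll; rewrite sqnormL2_base; last exact: cmeas_expchar.
  by rewrite sqn_expchar gt_eqF.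
- move=> l l' /(dual_indexP uA dualL)[m Mm ->] /(dual_indexP uA dualL)[m' Mm' ->] E.
  rewrite inner_base; [|exact: cmeas_expchar|exact: cmeas_expchar].
  by apply: oM => //; apply/eqP => mm'; apply: E; rewrite mm'.
move=> h [mh ho] e e0; have mh' := cmeas_trunc_in mO mh.
have Lh : L2 numeas (trunc O h).
  by split => //; rewrite -(sqn_trunc_base mO finO)// trunc_idem -sqnormL2_trunc.
have [s [a [us sM sa]]] := cM _ _ Lh e0.
have idx l : exists m, (exists2 m', M m' & l = dualp A (intv m')) -> l = dualp A (intv m).
  have [[m' _ lE]|N] := pselect (exists2 m', M m' & l = dualp A (intv m')).
    by exists m'.
  by exists 0.
have [mof mofP] := choice idx.
have Ls : L2 numeas (fun x => \sum_(m <- s) a m * char m x).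
  by apply: L2_sum => m; apply: L2Z; exact: L2_char.
exists (fun x => \sum_(m <- s) a m * char m x); last first.
  rewrite sqnormL2_base_in//; last by have [] := Ls.
  by rewrite sqnBC (sqnE (L2B Lh Ls)) lte_fin.
exists [seq dualp A (intv m) | m <- s], (fun l => a (mof l)); split.
  by move=> _ /mapP[m ms ->]; exact: sM.
apply/funext => x; rewrite big_map !big_seq; apply: eq_bigr => m ms.
congr (a _ * _); apply: (dualp_inj uA); apply: mofP.
by exists m => //; exact: sM.
Qed.

(** ** The three implications *)

Lemma fourier_ext0B f g t : inL12 W f -> inL12 W g ->
  fourier (ext0 W f) t - fourier (ext0 W g) t = fourier (trunc W (f \- g)) t.
Proof.
move=> [f1 _] [g1 _]; rewrite !ext0E trunc_subE fourierB//; exact: inL1_trunc.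
Qed.

(** The pair measure is [|det A| / |O|] times Lebesgue measure on the spectral set, up to
    a null set, so that the isometry is the scaled Parseval identity. *)
Lemma spectrum_to_pair : orthogonal_chars -> complete_chars A nu M -> spectral_pair W mu.
Proof.
move=> oM cM.
have iso f : trunc W f = f -> L1 leb f -> L2 leb f -> sqnormL2 mu setT (fourier f) = sqn leb f.
  move=> fW L1f L2f; apply: sqnormL2_pairE => //.
  - by apply: cmeas_fourier; have [] := L2f.
  - exact: (L2_spec_fourier uA O_gt0 disjO oM).
  - exact: (nrm2_spec_fourier uA O_gt0 disjO oM cM).
have fin f : inL12 W f -> (sqnormL2 mu setT (fourier (ext0 W f)) < +oo)%E.
  move=> [/(inL1_trunc mW) L1f /(inL2_trunc mW) L2f].
  by rewrite ext0E iso ?trunc_idem//; have [] := L2f.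
split => //; first exact: radon_pair.
- split => [f Wf|f g Wf Wg].
    split; last exact: fin.
    have [_ /(inL2_trunc mW)[mf _]] := Wf.
    by rewrite ext0E; exact: cmeas_fourier.
  rewrite (_ : _ \- _ = fourier (trunc W (f \- g))); last first.
    by apply/funext => t; exact: fourier_ext0B.
  have [/(inL1_trunc mW) L1f /(inL2_trunc mW) L2f] := Wf.
  have [/(inL1_trunc mW) L1g /(inL2_trunc mW) L2g] := Wg.
  rewrite iso ?trunc_idem ?sqnormL2_trunc//.
    by rewrite trunc_subE; exact: L1B.
  by rewrite trunc_subE; exact: L2B.
move=> h [mh ho] e e0; have mSS := measurable_spec_set A M.
pose h' := trunc (spec_set A M) h.
have Lh' : L2 leb h'.
  split; first exact: cmeas_trunc.
  move: ho; rewrite sqnormL2_pair// /spec_norm -/h' => ho.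
  rewrite ltey; apply/eqP => E; move: ho; rewrite E gt0_muley ?lte_fin ?divr_gt0//.
have e' : 0 < e * vol / D by rewrite divr_gt0// mulr_gt0.
have [f [fW L1f L2f fe]] := fourier_range_dense uA O_gt0 disjO oM Lh' (trunc_idem _ _) e'.
exists (fourier (ext0 W f)).
  by exists f => //; split; [exact: L1_inL1|exact: L2_inL2].
have mff : cmeas (fourier f) by apply: cmeas_fourier; have [] := L2f.
rewrite ext0E fW sqnormL2_pair; last exact: cmeasB.
rewrite /spec_norm trunc_subE -/h'.
have -> : e%:E = ((D / vol)%:E * (e * vol / D)%:E)%E.
  by rewrite -EFinM; congr EFin; field; rewrite !gt_eqF.
by rewrite lte_pmul2l// lte_fin divr_gt0.
Qed.

Lemma pair_to_isometry : spectral_pair W mu ->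
  L2_isometry leb W mu S (inL2 leb W) (fun f => fourierL2 (ext0 W f)).
Proof.
move=> [_ _ _ [_ pI] _].
have mSS := measurable_spec_set A M.
have W0 : inL12 W (fun=> 0).
  split; [apply: L1_inL1|apply: L2_inL2]; rewrite ?trunc0//.
    by split; exact: integrable0.
  exact: L2_cst0.
have iso f : trunc W f = f -> L1 leb f -> L2 leb f ->
    D * nrm2 leb (trunc (spec_set A M) (fourier f)) = vol * nrm2 leb f.
  move=> fW L1f L2f.
  have mff : cmeas (fourier f) by apply: cmeas_fourier; have [] := L2f.
  apply: spec_norm_isoP => //.
    by apply: L2_trunc => //; exact: L2_fourier.
  have Wf : inL12 W f by split; [exact: L1_inL1|exact: L2_inL2].
  have := pI _ _ Wf W0; rewrite [X in _ = X -> _]sqnormL2_trunc.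
  rewrite (_ : _ \- _ = fourier f); last first.
    apply/funext => t; rewrite -[LHS]/(_ - _) fourier_ext0B//.
    rewrite (_ : f \- _ = f) ?fW//; by apply/funext => x; rewrite /= subr0.
  by rewrite (_ : f \- _ = f) ?fW//; apply/funext => x; rewrite /= subr0.
split=> [f /(inL2_trunc mW) Lf|f g /(inL2_trunc mW) Lf /(inL2_trunc mW) Lg].
  rewrite ext0E; have LF := L2_fourierL2 Lf; have [mF Fo] := LF.
  split; first exact: cmeasurable_in.
  rewrite sqnormL2_pair_in// sqnormL2_pair// lte_mul_pinfty//.
    by rewrite lee_fin ltW// divr_gt0.
  by have [_] := L2_trunc mSS LF.
rewrite !ext0E; have LF := L2B (L2_fourierL2 Lf) (L2_fourierL2 Lg).
have [mF _] := LF; rewrite sqnormL2_pair_in// [RHS]sqnormL2_trunc trunc_subE.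
apply: sqnormL2_pairE => //; [exact: L2_trunc|exact: L2B|].
by apply: (fourierL2_isometry mSS iso) => //; exact: trunc_idem.
Qed.

(** Finite sums of translates are integrable, so on them the hypothesis speaks of the
    transform itself. *)
Lemma isometry_to_spectrum :
  L2_isometry leb W mu S (inL2 leb W) (fun f => fourierL2 (ext0 W f)) ->
  has_spectrum O L.
Proof.
move=> [_ iI]; have mSS := measurable_spec_set A M.
suff iso (s : seq 'cV[int]_n) (g : 'cV[int]_n -> V -> R[i]) : uniq s -> (forall k, L2 numeas (g k)) ->
    (D%:E * spec_norm A M (fourier (synth A O s g)) = vol%:E * sqn leb (synth A O s g))%E.
  apply: chars_spectrum.
    by move=> m m'; exact: (iso_orthogonal uA O_gt0 disjO iso).
  exact: (iso_complete uA O_gt0 disjO iso).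
move=> us Lg; set f := synth A O s g.
have L2f : L2 leb f by exact: L2_synth.
have L1f : L1 leb f by exact: L1_synth.
have fW : trunc W f = f.
  apply/funext => y; rewrite truncE; case: ifPn => // yD.
  rewrite /f /synth big1// => k _; rewrite truncE memNset// => Ok.
  by move/negP: yD; apply; rewrite inE; exists k.
have L2z : L2 leb (fun=> 0 : R[i]) by exact: L2_cst0.
have := iI _ _ (L2_inL2 fW L2f) (L2_inL2 (trunc0 W) L2z).
rewrite !ext0E trunc0 fW [in RHS]sqnormL2_trunc.
rewrite (_ : f \- _ = f) ?fW; last by apply/funext => x; rewrite /= subr0.
have LF := L2B (L2_fourierL2 L2f) (L2_fourierL2 L2z); have [mF _] := LF.
rewrite sqnormL2_pair_in// => /spec_norm_isoP - /(_ (L2_trunc mSS LF) L2f mF).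
rewrite nrm2_trunc_fourierL2// => E.
rewrite /spec_norm (sqnE L2f) (sqnE (L2_trunc mSS (L2_fourier L1f L2f))).
by rewrite -!EFinM E.
Qed.

End glue.

Theorem theorem1p6 (R : realType) (d : nat)
    (Omega0 : set 'cV[R]_d) (Lambda0 : set 'cV[R]_d) (A : 'M[R]_d)
    (Omega0_nonempty : Omega0 !=set0)
    (Omega0_bounded : bounded_set Omega0)
    (Omega0_open : open Omega0)
    (Omega0_finite : (lebesgue_cV d Omega0 < +oo)%E)
    (Lambda0_discrete : Lambda0 `<=` isolated Lambda0)
    (A_invertible : A \in unitmx)
    (Omega0_packs : packs Omega0 (lattice A))
    (Lambda0_dual : forall (l : 'cV[R]_d) (k : 'cV[int]_d), Lambda0 l ->
       exists z : int, dot l (A *m map_mx intr k) = z%:~R) :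
  let Omega := sumset Omega0 (lattice A) in
  let S := sumset (dual_cell A) Lambda0 in
  let mu := pair_measure A Omega0 S in
  [<-> has_spectrum Omega0 Lambda0;
       spectral_pair Omega mu;
       L2_isometry (lebesgue_cV d) Omega mu S (inL2 (lebesgue_cV d) Omega)
         (fun f => fourierL2 (ext0 Omega f))].
Proof.
have [mO _] := Omega0_packs.
have O_gt0 := open_lebesgue_gt0 Omega0_open Omega0_nonempty.
have disjO := packs_disjoint A_invertible Omega0_open Omega0_packs.
move=> Omega S mu; rewrite /Omega sumset_lattice; tfae.
- move=> sp; apply: (spectrum_to_pair A_invertible (mO := mO) (finO := Omega0_finite)) => //.
    exact: spectrum_orthogonal sp.
  exact: spectrum_complete sp.
- exact: (pair_to_isometry A_invertible mO Omega0_finite O_gt0 Lambda0_dual).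
- exact: (isometry_to_spectrum A_invertible mO Omega0_finite O_gt0 disjO Lambda0_dual).
Qed.
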